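(* Let $d\ge3$. As $u\to\infty$: (1) $\Big(\dfrac{L_{x,u}-L_{0,u}}{\sqrt{2u}}\Big)_{x\in\mathbb{Z}^d}$ converges in distribution to the centered Gaussian field $(\varphi_x)_{x\in\mathbb{Z}^d}$ with covariance $E[\varphi_x\varphi_{x'}]=g(x'-x)+g(0)-g(x)-g(x')$, $x,x'\in\mathbb{Z}^d$; (2) $\Big(\dfrac1u L_{x,u}\Big)_{x\in\mathbb{Z}^d}$ converges in distribution to the constant field equal to $1$.
   Context: Convergence in distribution of random fields means in $\mathbb{R}^{\mathbb{Z}^d}$ with the product topology, i.e. convergence in distribution of all finite-dimensional marginals. $g(x)=\sum_{n\ge0}P_x[X_n=0]$ is the Green function of simple random walk $(X_n)$ on $\mathbb{Z}^d$ (started at $x$ under $P_x$). Continuous time random interlacements on $\mathbb{Z}^d$, $d\ge3$. $\widehat W$ is the space of doubly infinite sequences $(X_n,\sigma_n)_{n\in\mathbb{Z}}$ in $\mathbb{Z}^d\times(0,\infty)$ such that $(X_n)$ is a nearest-neighbour trajectory visiting every finite subset of $\mathbb{Z}^d$ only finitely many times, and $\sum_{n\ge0}\sigma_n=\sum_{n<0}\sigma_n=\infty$; it has the $\sigma$-algebra generated by the coordinates. $\widehat W^*=\widehat W/\sim$, where $\widehat w\sim\widehat w'$ iff $\widehat w(\cdot)=\widehat w'(\cdot+k)$ for some $k\in\mathbb{Z}$; $\pi^*:\widehat W\to\widehat W^*$ is the canonical map and $\widehat W^*$ is endowed with the $\sigma$-algebra of sets whose inverse image under $\pi^*$ is measurable.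 For finite $K\subset\mathbb{Z}^d$ let $e_K(x)=P_x[X_n\notin K\text{ for all }n\ge1]\,1_K(x)$, and let $\widehat Q_K$ be the finite measure on $\widehat W$ with $\widehat Q_K(X_0=x)=e_K(x)$ and such that, when $e_K(x)>0$, conditionally on $X_0=x$, $(X_n)_{n\ge0}$, $(X_{-n})_{n\ge0}$, $(\sigma_n)_{n\in\mathbb{Z}}$ are independent and distributed respectively as simple random walk started at $x$, simple random walk started at $x$ conditioned never to return to $K$ (at times $n\ge1$), and i.i.d. exponential variables of parameter $1$. There is a unique $\sigma$-finite measure $\widehat\nu$ on $\widehat W^*$ such that for every finite $K$ its restriction to the trajectories modulo time-shift that enter $K$ equals the image of $\widehat Q_K$ under $\pi^*$. Under $\mathbb{P}$, $\omega=\sum_{i\ge0}\delta_{(\widehat w_i^*,u_i)}$ is a Poisson point process on $\widehat W^*\times\mathbb{R}_+$ with intensity measure $\widehat\nu(d\widehat w^* )\,du$. The occupation times are $$L_{x,u}(\omega)=\sum_{i\ge0}\sum_{n\in\mathbb{Z}}\sigma_n(\widehat w_i)\,1\{X_n(\widehat w_i)=x,\ u_i\le u\},\quad x\in\mathbb{Z}^d,\ u\ge0,$$ where $\widehat w_i$ is any element with $\pi^*(\widehat w_i)=\widehat w_i^*$. *)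

(* Defs.v *)
From HB Require Import structures.
From mathcomp Require Import all_boot all_order all_algebra.
From mathcomp Require Import finmap.
From mathcomp Require Import all_classical all_reals all_analysis.
From mathcomp Require Import measurable_realfun.

Set Implicit Arguments.
Unset Strict Implicit.
Unset Printing Implicit Defensive.

Import Order.TTheory GRing.Theory Num.Theory.
Import numFieldNormedType.Exports.

Local Open Scope classical_set_scope.
Local Open Scope ring_scope.
Local Open Scope quotient_scope.

Section conditioning.
Context dT (T : measurableType dT) (R : realType).

Definition cprob (mu : set T -> \bar R) (A B : set T) : R :=
  fine (mu (A `&` B)) / fine (mu B).

End conditioning.

Definition neighbor (d : nat) (x y : 'rV[int]_d) : bool :=
  \sum_(i < d) `|x 0 i - y 0 i| == 1.

Definition walk (d : nat) : Type := nat -> 'rV[int]_d.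

HB.instance Definition _ (d : nat) := Choice.on (walk d).
HB.instance Definition _ (d : nat) := isPointed.Build (walk d) (fun=> 0).

Definition walk_cylinders (d : nat) : set (set (walk d)) :=
  [set A | exists n x, A = [set w : walk d | w n = x]].

Notation walk_space d := (g_sigma_algebraType (@walk_cylinders d)).

Section simple_random_walk.
Context (d : nat) (R : realType).

Definition step_prob (x y : 'rV[int]_d) : R :=
  if neighbor x y then (2 * d)%:R^-1 else 0.

Definition is_srw (x : 'rV[int]_d) (P : probability (walk_space d) R) : Prop :=
  forall (n : nat) (y : walk d),
    P [set w : walk d | forall k, (k <= n)%N -> w k = y k] =
    ((y 0%N == x)%:R * \prod_(k < n) step_prob (y k) (y k.+1))%:E.

Variable P : 'rV[int]_d -> probability (walk_space d) R.

(* fine: the series converges for transient walks, i.e. when 3 <= d *)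
Definition green (x : 'rV[int]_d) : R :=
  fine (\sum_(n <oo) P x [set w : walk d | w n = 0%R])%E.

Definition no_return (K : {fset 'rV[int]_d}) : set (walk d) :=
  [set w : walk d | forall n, (1 <= n)%N -> w n \notin K].

Definition eqm (K : {fset 'rV[int]_d}) (x : 'rV[int]_d) : R :=
  if x \in K then fine (P x (no_return K)) else 0.

End simple_random_walk.

Section trajectories.
Context (d : nat) (R : realType).

Definition traj_set : set (int -> 'rV[int]_d * R) :=
  [set w | [/\ forall n : int, 0 < (w n).2,
               forall n : int, neighbor (w n).1 (w (n + 1)).1,
               forall K : {fset 'rV[int]_d},
                 finite_set [set n : int | (w n).1 \in K],
               (\sum_(n <oo) ((w n%:Z).2)%:E = +oo)%E
             & (\sum_(n <oo) ((w (- n.+1%:Z)).2)%:E = +oo)%E]].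

Definition traj : Type := set_type traj_set.

HB.instance Definition _ := Choice.on traj.

Definition pos (w : traj) (n : int) : 'rV[int]_d := (val w n).1.
Definition hold (w : traj) (n : int) : R := (val w n).2.

Definition traj_cylinders : set (set traj) :=
  [set A | (exists n x, A = [set w | pos w n = x]) \/
           (exists n (B : set R), measurable B /\
              A = [set w | B (hold w n)])].

Definition shift_equiv (w w' : traj) : bool :=
  `[< exists k : int, forall n : int, val w n = val w' (n + k) >].

Lemma shift_equiv_refl : reflexive shift_equiv.
Proof. by move=> w; apply/asboolP; exists 0 => n; rewrite addr0. Qed.

Lemma shift_equiv_sym : symmetric shift_equiv.
Proof.
have H w w' : shift_equiv w w' -> shift_equiv w' w.
  move=> /asboolP[k wk]; apply/asboolP; exists (- k) => n.
  by rewrite wk subrK.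
by move=> w w'; apply/idP/idP; exact: H.
Qed.

Lemma shift_equiv_trans : transitive shift_equiv.
Proof.
move=> w w1 w2 /asboolP[k wk] /asboolP[l wl]; apply/asboolP.
by exists (k + l) => n; rewrite wk wl addrA.
Qed.

Definition shift_equiv_rel := EquivRel shift_equiv
  shift_equiv_refl shift_equiv_sym shift_equiv_trans.

Definition traj_mod : Type := {eq_quot shift_equiv_rel}.

HB.instance Definition _ := Choice.on traj_mod.
HB.instance Definition _ := EqQuotient.on traj_mod.

Definition pi_star (w : traj) : traj_mod := \pi_traj_mod w.

End trajectories.

(* Measurable types are pointed, and the trajectory space is empty in
   dimension 0; hence the successor on dimensions from here on. *)
Section trajectory_space.
Context (d : nat) (R : realType).

Let line (n : int) : 'rV[int]_d.+1 * R :=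
  (\row_i (if i == 0 then n else 0), 1).

Let series1 : (\sum_(n <oo) (1 : R)%:E = +oo)%E.
Proof.
apply/cvg_lim => //; rewrite (_ : (fun n : nat => _) = (fun n => n%:R%:E)).
  exact/cvgeryP/cvgr_idn.
apply/funext => n; rewrite sumEFin; congr EFin.
by rewrite big_mkord sumr_const card_ord.
Qed.

Let line_traj : traj_set line.
Proof.
split => //.
- move=> n; rewrite /neighbor (bigD1 ord0)//= !mxE eqxx big1 ?addr0.
    by rewrite opprD addrA subrr sub0r normrN normr1.
  by move=> i i0; rewrite !mxE (negbTE i0) subrr normr0.
- move=> K; apply: (@sub_finite_set _ _
    ((fun x : 'rV[int]_d.+1 => x 0 0) @` [set` K])).
    by move=> n /= nK; exists (line n).1 => //; rewrite mxE eqxx.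
  exact/finite_image/finite_fset.
Qed.

HB.instance Definition _ :=
  isPointed.Build (traj d.+1 R) (exist _ line (mem_set line_traj)).

HB.instance Definition _ := @isMeasurable.Build default_measure_display
  (traj d.+1 R) <<s @traj_cylinders d.+1 R >>
  (@sigma_algebra0 _ setT _) (@sigma_algebraC _ _)
  (@sigma_algebra_bigcup _ setT _).

HB.instance Definition _ :=
  isPointed.Build (traj_mod d.+1 R) (pi_star point).

Let measurable_mod : set (set (traj_mod d.+1 R)) :=
  [set A | measurable (@pi_star d.+1 R @^-1` A)].

Let measurable_mod0 : measurable_mod set0.
Proof. by rewrite /measurable_mod/= preimage_set0. Qed.

Let measurable_modC A : measurable_mod A -> measurable_mod (~` A).
Proof.
by rewrite /measurable_mod/= -preimage_setC; exact: measurableC.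
Qed.

Let measurable_mod_bigcup (F : (set (traj_mod d.+1 R))^nat) :
  (forall i, measurable_mod (F i)) -> measurable_mod (\bigcup_i F i).
Proof.
move=> mF; rewrite /measurable_mod/= preimage_bigcup.
exact: bigcupT_measurable.
Qed.

HB.instance Definition _ := @isMeasurable.Build default_measure_display
  (traj_mod d.+1 R) measurable_mod
  measurable_mod0 measurable_modC measurable_mod_bigcup.

End trajectory_space.

Definition hold_cylinders (R : realType) : set (set (int -> R)) :=
  [set A | exists n (B : set R), measurable B /\ A = [set s | B (s n)]].

Notation hold_space R := (g_sigma_algebraType (@hold_cylinders R)).

Section intensity.
Context (d : nat) (R : realType).
Local Notation traj := (traj d.+1 R).
Local Notation traj_mod := (traj_mod d.+1 R).
Local Notation walk := (walk_space d.+1).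

Variable P : 'rV[int]_d.+1 -> probability walk R.

Definition forward (w : traj) : walk := fun n => pos w n%:Z.
Definition backward (w : traj) : walk := fun n => pos w (- n%:Z).
Definition holding (w : traj) : hold_space R := hold w.

Definition is_QK (K : {fset 'rV[int]_d.+1})
    (Q : {finite_measure set traj -> \bar R}) : Prop :=
  (forall x, Q [set w | pos w 0 = x] = (eqm P K x)%:E) /\
  forall x, 0 < eqm P K x ->
    let Qx (A : set traj) := cprob Q A [set w | pos w 0 = x] in
    [/\ forall (A B : set walk) (C : set (hold_space R)),
          measurable A -> measurable B -> measurable C ->
          Qx (forward @^-1` A `&` backward @^-1` B `&` holding @^-1` C) =
          Qx (forward @^-1` A) * Qx (backward @^-1` B) * Qx (holding @^-1` C),
        forall A : set walk, measurable A ->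
          Qx (forward @^-1` A) = fine (P x A),
        forall B : set walk, measurable B ->
          Qx (backward @^-1` B) = cprob (P x) B (no_return K)
      & forall (F : {fset int}) (D : int -> set R),
          (forall n, measurable (D n)) ->
          Qx [set w | forall n, n \in F -> D n (hold w n)] =
          \prod_(n <- F) fine (exponential_prob 1 (D n))].

Definition entering (K : {fset 'rV[int]_d.+1}) : set traj_mod :=
  @pi_star d.+1 R @` [set w | exists n, pos w n \in K].

Definition is_intensity (Q : {fset 'rV[int]_d.+1} ->
      {finite_measure set traj -> \bar R})
    (nu : {sigma_finite_measure set traj_mod -> \bar R}) : Prop :=
  forall (K : {fset 'rV[int]_d.+1}) (A : set traj_mod), measurable A ->
    nu (A `&` entering K) = Q K (@pi_star d.+1 R @^-1` A).

End intensity.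

Section poisson_point_process.
Context dO (Omega : measurableType dO) (R : realType).
Context dT (T : measurableType dT).

Definition point_count (p : Omega -> nat -> T) (D : set T) (w : Omega)
  : \bar R := (\sum_(i <oo) \d_(p w i) D)%E.

(* The Poisson weights are written out because poisson_pmf 0 is constantly 1;
   the Poisson distribution of parameter +oo is the Dirac mass at +oo. *)
Definition is_ppp (P : probability Omega R) (p : Omega -> nat -> T)
    (mu : set T -> \bar R) : Prop :=
  [/\ forall D : set T, measurable D -> measurable_fun setT (point_count p D),
      forall (D : set T) (k : nat), measurable D -> (mu D < +oo)%E ->
        P [set w | point_count p D w = k%:R%:E] =
        (fine (mu D) ^+ k / k`!%:R * expR (- fine (mu D)))%:E,
      forall D : set T, measurable D -> mu D = +oo%E ->
        P [set w | point_count p D w = +oo%E] = 1%E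
    & forall (n : nat) (D : 'I_n -> set T) (B : 'I_n -> set (\bar R)),
        (forall i, measurable (D i)) -> trivIset setT D ->
        (forall i, measurable (B i)) ->
        P (\bigcap_i (point_count p (D i) @^-1` B i)) =
        (\prod_(i < n) fine (P (point_count p (D i) @^-1` B i)))%:E].

End poisson_point_process.

Section interlacements.
Context (d : nat) (R : realType).
Context dO (Omega : measurableType dO).
Local Notation traj_mod := (traj_mod d.+1 R).

(* The second coordinate lives in R, so that R_+ is encoded by restricting
   Lebesgue measure to the half-line (and by the first clause of
   is_interlacement). *)
Definition interlacement_intensity
    (nu : {sigma_finite_measure set traj_mod -> \bar R})
    (A : set (traj_mod * R)) : \bar R :=
  (nu \x (@lebesgue_measure R))%E (A `&` (setT `*` `[0, +oo[)).

Definition is_interlacement (P : probability Omega R)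
    (nu : {sigma_finite_measure set traj_mod -> \bar R})
    (p : Omega -> nat -> traj_mod * R) : Prop :=
  (forall w i, 0 <= (p w i).2) /\ is_ppp P p (interlacement_intensity nu).

Definition occupation_ereal (p : Omega -> nat -> traj_mod * R)
    (x : 'rV[int]_d.+1) (u : R) (w : Omega) : \bar R :=
  (\sum_(i <oo) \esum_(n in [set: int])
     (hold (repr (p w i).1) n *
      ((pos (repr (p w i).1) n == x) && ((p w i).2 <= u))%:R)%:E)%E.

(* The sum above is almost surely finite; fine sends +oo to 0. *)
Definition occupation (p : Omega -> nat -> traj_mod * R)
    (x : 'rV[int]_d.+1) (u : R) (w : Omega) : R :=
  fine (occupation_ereal p x u w).

End interlacements.

Section random_fields.
Context (R : realType) (I : Type).

(* normal_prob 0 0 is the uniform distribution on [0, 1], not the degenerate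
   normal distribution. *)
Definition centered_normal dO (Omega : measurableType dO)
    (P : probability Omega R) (X : Omega -> R) : Prop :=
  exists s : R, forall B : set R, measurable B ->
    P (X @^-1` B) = if s == 0 then \d_(0 : R) B else normal_prob 0 s B.

Definition centered_gaussian_field dO (Omega : measurableType dO)
    (P : probability Omega R) (phi : I -> Omega -> R) (C : I -> I -> R) : Prop :=
  [/\ forall x, measurable_fun setT (phi x),
      forall (n : nat) (x : 'I_n -> I) (a : 'I_n -> R),
        centered_normal P (fun w => \sum_(i < n) a i * phi (x i) w)
    & forall x y, ('E_P[(fun w => phi x w * phi y w)%R] = (C x y)%:E)%E].

(* Convergence in distribution, as u tends to +oo, in R^I with the product
   topology, i.e. weak convergence of the finite-dimensional marginals; that
   the fields consist of random variables is part of the claim. *)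
Definition field_cvg_dist
    dO (Omega : measurableType dO) (P : probability Omega R)
    (Y : R -> I -> Omega -> R)
    dO' (Omega' : measurableType dO') (P' : probability Omega' R)
    (Z : I -> Omega' -> R) : Prop :=
  [/\ forall u : R, 0 < u -> forall x, measurable_fun setT (Y u x),
      forall x, measurable_fun setT (Z x)
    & forall (n : nat) (x : 'I_n -> I) (f : 'rV[R]_n -> R),
        continuous f -> (exists M : R, forall z, `|f z| <= M) ->
        (\int[P]_w (f (\row_i Y u (x i) w))%:E)%E @[u --> +oo] -->
        (\int[P']_w (f (\row_i Z (x i) w))%:E)%E].

End random_fields.

(* Main.v *)
Require Import Defs.
From HB Require Import structures.
From mathcomp Require Import all_boot all_order all_algebra.
From mathcomp Require Import finmap.
From mathcomp Require Import all_classical all_reals all_analysis.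
From mathcomp Require Import measurable_realfun.
From mathcomp Require Import ring lra.

(** For fixed [u], the trajectories with label at most [u] form a Poisson random
    measure [N_u] with intensity [u * nu], and [L_{x,u}] is the integral against
    [N_u] of the time [l_x] that a trajectory spends at [x]. Hence, for [h]
    integrable,
      [E cos (N_u h + a) =
       exp (u * \int (cos h - 1) dnu) * cos (u * \int sin h dnu + a)],
    where the free phase [a] plays the role of the complex exponential.
    Reading [nu] off [Q_K] with [K = {x, y}], the last exit decomposition gives
    [\int l_x dnu = 1] and the Markov property gives
    [\int l_x l_y dnu = 2 g (x - y)]. For a linear combination [h] of the
    [l_x - l_0], scaled by [1 / sqrt (2 u)], the exponent thus tends to minus half
    of the quadratic form of the limiting covariance; for the [l_x] scaled by
    [1 / u] only the mean survives. Together with bounded second moments, this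
    yields weak convergence, because bounded continuous functions are uniformly
    close on boxes to trigonometric polynomials with the same bound. *)

Set Implicit Arguments.
Unset Strict Implicit.
Unset Printing Implicit Defensive.

Import Order.TTheory GRing.Theory Num.Theory.
Import numFieldNormedType.Exports.

Local Open Scope classical_set_scope.
Local Open Scope ring_scope.

(** * Trigonometric inequalities *)

(** The measure [nu] is accessible only through [Q K], under which the backward walk avoids [K]; at
    points of [K] the two-sided local time is thus a sum over nonnegative times, to which the Markov
    property applies. Last exits exist only for a transient walk, and transience is not assumed: the
    Green function is bounded by means of an explicit superharmonic function [1 / sqrt (c + |x|^2)].
    The factor [2] in the mixed moments counts the two orders of the visits, [E sigma^2 = 2] making
    the diagonal count in both; the [2] in [sqrt (2 u)] compensates it. Since every [l_x] has mean
    one, the differences [l_x - l_0] have mean zero, and no drift of order [sqrt u] survives the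
    scaling. The second moments are themselves deduced from the characteristic function. That the
    approximating polynomials obey the bound of [f] everywhere is what lets Chebyshev's inequality
    handle the outside of the box; for this reason they are Bernstein polynomials, a positive
    operator, in the variables [(1 + sin (v_i / L)) / 2]. *)

Section trigonometric_inequalities.
Context (R : realType).
Implicit Types x y : R.

(** Mean value theorem. The Taylor bounds below follow from [sin <= 1] and [cos <= 1] by integrating
    repeatedly from [0]. *)
Lemma nneg_of_nneg_derive (g dg : R -> R) :
  (forall x, is_derive x 1 g (dg x)) -> (forall x, 0 <= x -> 0 <= dg x) ->
  g 0 = 0 -> forall x, 0 <= x -> 0 <= g x.
Proof.
move=> d dge0 g0 x x0.
have cg : {within `[0, x], continuous g}.
  apply: continuous_subspaceT => z; apply: differentiable_continuous.
  by apply/derivable1_diffP; exact: ex_derive.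
have [c c0x] := MVT_segment x0 (fun z _ => d z) cg.
rewrite g0 !subr0 => ->; rewrite mulr_ge0// dge0//.
by move: c0x; rewrite in_itv/= => /andP[].
Qed.

Lemma sin_le_id x : 0 <= x -> sin x <= x.
Proof.
move=> x0; rewrite -subr_ge0; move: x x0.
apply: (@nneg_of_nneg_derive (fun x => x - sin x) (fun x => 1 - cos x)).
- by move=> x _; rewrite subr_ge0 cos_le1.
- by rewrite sin0 subrr.
Qed.

Lemma cos_ge_quadratic x : 1 - x ^+ 2 / 2 <= cos x.
Proof.
wlog x0 : x / 0 <= x => [H|].
  have [/H//|/ltW x0] := leP 0 x.
  by rewrite -cosN -sqrrN; apply: H; rewrite oppr_ge0.
rewrite -subr_ge0; move: x x0.
apply: (@nneg_of_nneg_derive (fun x => cos x - (1 - x ^+ 2 / 2))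
  (fun x => x - sin x)).
- by move=> x; apply: is_derive_eq; rewrite /GRing.scale/=; field.
- by move=> x x0; rewrite subr_ge0 sin_le_id.
- by rewrite cos0 expr0n/= mul0r subr0 subrr.
Qed.

Lemma sin_ge_quadratic x : 0 <= x -> x - x ^+ 2 / 2 <= sin x.
Proof.
move=> x0; rewrite -subr_ge0; move: x x0.
apply: (@nneg_of_nneg_derive (fun x => sin x - (x - x ^+ 2 / 2))
  (fun x => x - (1 - cos x))).
- by move=> x; apply: is_derive_eq; rewrite /GRing.scale/=; field.
- apply: (@nneg_of_nneg_derive (fun x => x - (1 - cos x)) (fun x => 1 - sin x)).
  + by move=> x; apply: is_derive_eq; rewrite /GRing.scale/=; ring.
  + by move=> x _; rewrite subr_ge0 sin_le1.
  + by rewrite cos0 subrr subrr.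
- by rewrite sin0 expr0n/= mul0r !subr0.
Qed.

Lemma sin_ge_cubic x : 0 <= x -> x - x ^+ 3 / 6 <= sin x.
Proof.
move=> x0; rewrite -subr_ge0; move: x x0.
apply: (@nneg_of_nneg_derive (fun x => sin x - (x - x ^+ 3 / 6))
  (fun x => cos x - (1 - x ^+ 2 / 2))).
- by move=> x; apply: is_derive_eq; rewrite /GRing.scale/=; field.
- by move=> x _; rewrite subr_ge0 cos_ge_quadratic.
- by rewrite sin0 expr0n/= mul0r !subr0.
Qed.

Lemma cos_le_quartic x : cos x <= 1 - x ^+ 2 / 2 + x ^+ 4 / 24.
Proof.
wlog x0 : x / 0 <= x => [H|].
  have [/H//|/ltW x0] := leP 0 x.
  rewrite -cosN -(sqrrN x) (_ : x ^+ 4 = (- x) ^+ 4); last by ring.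
  by apply: H; rewrite oppr_ge0.
rewrite -subr_ge0; move: x x0.
apply: (@nneg_of_nneg_derive (fun x => 1 - x ^+ 2 / 2 + x ^+ 4 / 24 - cos x)
  (fun x => sin x - (x - x ^+ 3 / 6))).
- by move=> x; apply: is_derive_eq; rewrite /GRing.scale/=; field.
- by move=> x x0; rewrite subr_ge0 sin_ge_cubic.
- by rewrite cos0 !expr0n/= !mul0r subr0 addr0 subrr.
Qed.

Lemma normr_sin_le x : `|sin x| <= `|x|.
Proof.
wlog x0 : x / 0 <= x => [H|].
  have [/H//|/ltW x0] := leP 0 x.
  by rewrite -normrN -sinN -(normrN x); apply: H; rewrite oppr_ge0.
rewrite [leRHS]ger0_norm// ler_norml sin_le_id// andbT.
have := sin_ge_quadratic x0; have := sin_geN1 x.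
(* For the lower bound [- x <= sin x]: up to [4] one has [- x <= x - x ^ 2 / 2], and beyond [4]
   already [- x <= - 1]. *)
have [x2|x2] := leP x 4; nra.
Qed.

Lemma normr_sinB_id x : `|sin x - x| <= x ^+ 2 / 2.
Proof.
wlog x0 : x / 0 <= x => [H|].
  have [/H//|/ltW x0] := leP 0 x.
  rewrite -normrN opprB addrC -sinN -sqrrN -[X in _ + X]opprK.
  by apply: H; rewrite oppr_ge0.
have := sin_ge_quadratic x0; have := sin_le_id x0.
by rewrite ler_norml; lra.
Qed.

Lemma normr_sinB_id_cubic x : `|sin x - x| <= `|x| ^+ 3 / 6.
Proof.
wlog x0 : x / 0 <= x => [H|].
  have [/H//|/ltW x0] := leP 0 x.
  rewrite -normrN opprB addrC -sinN -[X in _ + X]opprK -(normrN x).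
  by apply: H; rewrite oppr_ge0.
have := sin_ge_cubic x0; have := sin_le_id x0; rewrite (ger0_norm x0).
have : 0 <= x ^+ 3 by rewrite exprn_ge0.
by rewrite ler_norml; lra.
Qed.

Lemma cosB_lipschitz x y : `|cos x - cos y| <= `|x - y|.
Proof.
have -> : cos x - cos y = - (2 * (sin ((x + y) / 2) * sin ((x - y) / 2))).
  rewrite -[in cos x](_ : (x + y) / 2 + (x - y) / 2 = x); last by field.
  rewrite -[in cos y](_ : (x + y) / 2 - (x - y) / 2 = y); last by field.
  by rewrite cosD cosB; ring.
rewrite normrN !normrM ger0_norm//.
have := normr_sin_le ((x - y) / 2); have := sin_max ((x + y) / 2).
rewrite normrM (ger0_norm (_ : 0 <= 2^-1))// => h1 h2.
have := normr_ge0 (sin ((x - y) / 2)); have := normr_ge0 (sin ((x + y) / 2)).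
nra.
Qed.

Lemma sinB_lipschitz x y : `|sin x - sin y| <= `|x - y|.
Proof.
rewrite -(cosBpihalf x) -(cosBpihalf y).
by apply: (le_trans (cosB_lipschitz _ _)); rewrite opprB addrA subrK.
Qed.

End trigonometric_inequalities.

(** * Simple random walk *)

Section walk_measurability.
Context (d : nat).
Local Notation V := 'rV[int]_d.
Local Notation W := (walk_space d).

(** The bound is strict, so that length [0] gives the whole space; the event in [is_srw] at [n] is
    the prefix of length [n.+1]. *)
Definition prefix_set (n : nat) (y : walk d) : set (walk d) :=
  [set w : walk d | forall k, (k < n)%N -> w k = y k].

Definition walk_shift (w : walk d) : walk d := fun n => w n.+1.

Lemma measurable_walk_coord (n : nat) (x : V) :
  measurable ([set w : walk d | w n = x] : set W).
Proof. by apply: sub_sigma_algebra; exists n, x. Qed.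

Lemma measurable_walk_coord_in (n : nat) (A : set V) :
  measurable ([set w : walk d | A (w n)] : set W).
Proof.
rewrite (_ : [set _ | _] =
    \bigcup_(x in A) [set w : walk d | w n = x]); last first.
  by apply/seteqP; split=> [w /= Aw|w [x Ax /= ->//]]; exists (w n).
rewrite bigcup_mkcond; apply: countable_bigcupT_measurable => // x.
by case: ifP => // _; exact: measurable_walk_coord.
Qed.

Lemma measurable_prefix_set n y : measurable (prefix_set n y : set W).
Proof.
rewrite (_ : prefix_set n y =
    \bigcap_(k in [set k | (k < n)%N]) [set w : walk d | w k = y k]).
  by apply: bigcap_measurableType => k _; exact: measurable_walk_coord.
by apply/seteqP; split.
Qed.

Lemma measurable_walk_map dT (T : measurableType dT) (F : T -> W) :
  (forall n x, measurable (F @^-1` [set w : walk d | w n = x])) ->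
  measurable_fun setT F.
Proof.
move=> mF; apply: (@measurability _ _ T W setT F (@walk_cylinders d) erefl) => //.
by move=> _ [_ [n [x ->]] <-]; rewrite setTI; exact: mF.
Qed.

Lemma measurable_walk_shift : measurable_fun setT (walk_shift : W -> W).
Proof. by apply: measurable_walk_map => n x; exact: measurable_walk_coord. Qed.

Lemma measurable_walk_iter n :
  measurable_fun setT ((fun w k => w (n + k)%N) : W -> W).
Proof. by apply: measurable_walk_map => k x; exact: measurable_walk_coord. Qed.

(** Two prefixes are nested or disjoint, so prefixes together with the empty set form a pi-system;
    it generates the sigma-algebra because the lattice is countable. *)
Lemma walk_measure_unique (R : realType) (m1 m2 : {measure set W -> \bar R}) :
  (forall n y, m1 (prefix_set n y) = m2 (prefix_set n y)) ->
  (m1 setT < +oo)%E -> forall A : set W, measurable A -> m1 A = m2 A.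
Proof.
move=> m12 m1oo A mA.
pose G := [set A : set W | A = set0 \/ exists n y, A = prefix_set n y].
have T_pref y : setT = prefix_set 0 y by apply/seteqP; split.
apply: (@measure_unique _ R W G (fun=> setT)) => //.
- apply/seteqP; split.
    apply: smallest_sub; first exact: smallest_sigma_algebra.
    move=> _ [n [x ->]].
    (* The default value [x] of [nth] fills position [n], just beyond the tuple, so these prefixes
       prescribe [w n = x] and leave the first [n] values free. *)
    rewrite (_ : [set _ | _] = \bigcup_(s : n.-tuple V)
      prefix_set n.+1 (nth x s)).
      apply: (@countable_bigcupT_measurable _ (g_sigma_algebraType G)) => // s.
      by apply: sub_sigma_algebra; right; exists n.+1, (nth x s).
    apply/seteqP; split => [w /= wx|w [s _ ws] /=].
      exists [tuple of mkseq w n] => // k.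
      rewrite ltnS leq_eqVlt => /predU1P[->|kn].
        by rewrite nth_default ?size_mkseq.
      by rewrite nth_mkseq.
    by rewrite ws// nth_default ?size_tuple.
  apply: smallest_sub; first exact: sigma_algebra_measurable.
  move=> _ [->|[n [y ->]]]; [exact: measurable0|exact: measurable_prefix_set].
- suff H n m y z : (n <= m)%N -> G (prefix_set n y `&` prefix_set m z).
    move=> _ _ [->|[n [y ->]]] [->|[m [z ->]]].
    + by rewrite setI0; left.
    + by rewrite set0I; left.
    + by rewrite setI0; left.
    + by have [nm|/ltnW nm] := leqP n m; [|rewrite setIC]; exact: H.
  move=> nm; have [yz|yz] := pselect (forall k, (k < n)%N -> y k = z k).
    right; exists m, z; apply/seteqP; split => [w []//|w wz].
    by split => // k kn; rewrite yz// wz// (leq_trans kn).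
  left; apply/seteqP; split => // w [wy wz]; apply: yz => k kn.
  by rewrite -wy// wz// (leq_trans kn).
- by move=> _; right; exists 0%N, (fun=> 0); exact: T_pref.
- by rewrite bigcup_const//; exists 0%N.
- by move=> _ [->|[n [y ->]]]; [rewrite !measure0|exact: m12].
Qed.

End walk_measurability.

Lemma probability_setI_full dT (T : measurableType dT) (R : realType)
    (P : probability T R) (A D : set T) :
  measurable A -> measurable D -> P D = 1%E -> P (A `&` D) = P A.
Proof.
move=> mA mD PD; rewrite (measureDI P mA mD).
rewrite [X in _ = (X + _)%E](_ : _ = 0%E) ?add0e//.
apply: (subset_measure0 (B := ~` D)) => //.
- exact: measurableD.
- exact: measurableC.
- by rewrite [LHS](probability_setC P mD) PD subee.
Qed.

Section simple_random_walk_markov.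
Context (R : realType) (d : nat).
Local Notation V := 'rV[int]_d.
Local Notation W := (walk_space d).

Definition nbr (x : V) (e : 'I_d * bool) : V :=
  x + (-1) ^+ e.2 *: delta_mx 0 e.1.

Lemma nbr_neighbor x e : neighbor x (nbr x e).
Proof.
rewrite /neighbor (bigD1 e.1)//= big1 => [|i ie].
  rewrite !mxE !eqxx /= addr0 opprD addrA subrr sub0r normrN mulr1.
  by rewrite normrX normrN1 expr1n.
by rewrite !mxE (negbTE ie) andbF mulr0 addr0 subrr normr0.
Qed.

Lemma nbr_inj x : injective (nbr x).
Proof.
move=> [i b] [j c] /addrI /rowP h.
have := h i; rewrite !mxE !eqxx /= mulr1.
have [->|ij] := eqVneq i j; last first.
  by rewrite mulr0; case: (b).
by rewrite mulr1; case: b {h} => //; case: c.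
Qed.

(** The [n]-step transition probability, by recursion on the first step and without reference to the
    measures [P x]; translation and reflection invariance, hence symmetry, become inductions. *)
Fixpoint walk_prob (n : nat) (x y : V) : R :=
  if n is n'.+1 then
    (2 * d)%:R^-1 * \sum_(e : 'I_d * bool) walk_prob n' (nbr x e) y
  else (x == y)%:R.

Lemma walk_prob_ge0 n x y : 0 <= walk_prob n x y.
Proof.
elim: n x => [|n IH] x /=; first by rewrite ler0n.
by rewrite mulr_ge0 ?invr_ge0 ?ler0n ?sumr_ge0.
Qed.

Lemma walk_probD n x y z : walk_prob n (x + z) (y + z) = walk_prob n x y.
Proof.
elim: n x => [|n IH] x /=; first by rewrite (inj_eq (addIr z)).
congr (_ * _); apply: eq_bigr => e _.
by rewrite -[RHS]IH; congr walk_prob; rewrite /nbr addrAC.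
Qed.

Lemma walk_probN n x y : walk_prob n (- x) (- y) = walk_prob n x y.
Proof.
elim: n x => [|n IH] x /=; first by rewrite (inj_eq oppr_inj).
congr (_ * _).
rewrite (reindex (fun e : 'I_d * bool => (e.1, ~~ e.2))) /=; last first.
  by apply: onW_bij; exists (fun e : 'I_d * bool => (e.1, ~~ e.2));
    case=> ? ? /=; rewrite negbK.
apply: eq_bigr => e _; rewrite -[RHS]IH; congr walk_prob.
by rewrite /nbr opprD/= -scaleNr signrN.
Qed.

Lemma walk_prob_diff n x y : walk_prob n x y = walk_prob n (x - y) 0.
Proof. by rewrite -(walk_probD n _ _ (- y)) subrr. Qed.

Lemma walk_prob_sym n x y : walk_prob n x y = walk_prob n y x.
Proof.
by rewrite walk_prob_diff -walk_probN opprB oppr0 -walk_prob_diff.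
Qed.

Variable P : V -> probability W R.
Hypothesis hP : forall x, is_srw x (P x).

Lemma srw_start x (A : set V) :
  P x [set w : walk d | A (w 0%N)] = (x \in A)%:R%:E.
Proof.
have P0 y : P x [set w : walk d | w 0%N = y] = (y == x)%:R%:E.
  have := hP x 0 (fun=> y); rewrite big_ord0 mulr1 => <-.
  congr (P x _); apply/seteqP; split=> [w /= w0 k|w /= w0].
    by rewrite leqn0 => /eqP ->.
  exact: w0.
have mA := measurable_walk_coord_in 0.
have Px1 : P x [set w : walk d | w 0%N = x] = 1%E by rewrite P0 eqxx.
have [xA|xA] := boolP (x \in A).
  apply/eqP; rewrite eq_le; apply/andP; split; first exact: probability_le1.
  rewrite -[X in (X <= _)%E]Px1.
  apply: le_measure; rewrite ?inE; [exact: measurable_walk_coord|exact: mA|].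
  by move=> w /= ->; rewrite inE in xA.
apply/eqP; rewrite -measure_le0.
have <- : P x (~` [set w : walk d | w 0%N = x]) = 0%E.
  by rewrite probability_setC ?Px1 ?subee//; exact: measurable_walk_coord.
apply: le_measure; rewrite ?inE; [exact: mA| |].
  by apply: measurableC; exact: measurable_walk_coord.
by move=> w /= Aw w0; move: xA; rewrite -w0 mem_set.
Qed.

Lemma srw_start1 x : P x [set w : walk d | w 0%N = x] = 1%E.
Proof. by rewrite (srw_start x [set z | z = x]) mem_set. Qed.

Lemma srw_prefix x n y : P x (prefix_set n.+1 y) =
  ((y 0%N == x)%:R * \prod_(k < n) step_prob R (y k) (y k.+1))%:E.
Proof.
by rewrite -hP; congr (P x _); apply/seteqP; split=> w /= wy k /wy.
Qed.

(** Both sides are finite measures in [B]. They agree on prefixes, where the product formula of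
    [is_srw] gives up its first factor. *)
Lemma srw_first_step x y (B : set W) : measurable B ->
  P x ([set w : walk d | w 1%N = y] `&` (@walk_shift d : W -> W) @^-1` B) =
  ((step_prob R x y)%:E * P y B)%E.
Proof.
move=> mB.
pose D : set W := [set w : walk d | w 1%N = y].
have mD : measurable D by exact: measurable_walk_coord.
have s0 : (0 <= step_prob R x y).
  by rewrite /step_prob; case: ifP => // _; rewrite invr_ge0.
have ms := @measurable_walk_shift d.
transitivity (pushforward (mrestr (P x) mD) (@walk_shift d : W -> W) B).
  by rewrite /pushforward /mrestr setIC.
transitivity (mscale (NngNum s0) (P y) B); last by [].
apply: walk_measure_unique => //; last first.
  rewrite /pushforward /mrestr /= (le_lt_trans (probability_le1 _ _)) ?ltry//.
  by rewrite preimage_setT setTI.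
have H n z : (pushforward (mrestr (P x) mD) (@walk_shift d : W -> W))
     (prefix_set n.+1 z) = mscale (NngNum s0) (P y) (prefix_set n.+1 z).
  rewrite /pushforward /mrestr /mscale/= srw_prefix -EFinM.
  have [zy|zy] := eqVneq (z 0%N) y; last first.
    rewrite mul0r mulr0 (_ : _ `&` _ = set0) ?measure0//.
    by apply/seteqP; split => // w /= [wz wy]; move/eqP: zy; apply; rewrite -wz.
  pose z' k := if k is k'.+1 then z k' else x.
  transitivity (P x (prefix_set n.+2 z')); last first.
    by rewrite srw_prefix eqxx big_ord_recl !mul1r /= zy.
  have mS : measurable ((@walk_shift d : W -> W) @^-1` prefix_set n.+1 z `&` D).
    apply: measurableI => //; rewrite -[X in measurable X]setTI.
    by apply: ms => //; exact: measurable_prefix_set.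
  rewrite -(probability_setI_full mS (measurable_walk_coord 0 x) (srw_start1 x)).
  congr (P x _); apply/seteqP; split => [w [[wz wD] w0]|w wz].
    by case => //= k kn; rewrite -wz.
  split; last by rewrite /= wz.
  by split=> [k kn|]; [rewrite /walk_shift wz|rewrite /D/= wz].
(* The product formula starts at length one. For the empty prefix, total masses are compared through
   the prefix of length one at [y], which carries all the mass on both sides. *)
move=> [|n] z; last exact: H.
have -> : prefix_set 0 z = setT by apply/seteqP; split.
have yy : [set w : walk d | w 0%N = y] = prefix_set 1 (fun=> y).
  by apply/seteqP; split => [w/= wy k|w /= wy]; [case: k|exact: wy].
transitivity (pushforward (mrestr (P x) mD) (@walk_shift d : W -> W)
    (prefix_set 1 (fun=> y))).
  rewrite -yy /pushforward /mrestr /=; congr (P x _).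
  by apply/seteqP; split => w /= -[] // _ wD; split.
rewrite H -yy /mscale/= (srw_start y [set z | z = y]) mem_set//=.
by congr (_ * _)%E; exact/esym/(probability_setT (P y)).
Qed.

End simple_random_walk_markov.

Section simple_random_walk_green.
Context (R : realType) (d : nat).
Hypothesis d_gt0 : (0 < d)%N.
Local Notation V := 'rV[int]_d.
Local Notation W := (walk_space d).
Variable P : V -> probability W R.
Hypothesis hP : forall x, is_srw x (P x).

(** The [2 * d] events of a first step to a given neighbour are disjoint and their probabilities add
    up to one, so no other first step contributes. *)
Lemma srw_step x (B : set W) : measurable B ->
  P x ((@walk_shift d : W -> W) @^-1` B) =
  ((2 * d)%:R^-1%:E * \sum_(e : 'I_d * bool) P (nbr x e) B)%E.
Proof.
move=> mB.
pose D e : set W := [set w : walk d | w 1%N = nbr x e].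
have mD e : measurable (D e) by exact: measurable_walk_coord.
have tD : trivIset setT D.
  apply/trivIsetP => e e' _ _ ee'; apply/seteqP; split => // w [/= h1 h2].
  by move/eqP: ee'; apply; apply: (nbr_inj (x := x)); rewrite -h1 -h2.
have msB : measurable ((@walk_shift d : W -> W) @^-1` B).
  by rewrite -[X in measurable X]setTI; exact: measurable_walk_shift.
have PD (A : set W) : measurable A ->
    P x ((\bigcup_e D e) `&` (@walk_shift d : W -> W) @^-1` A) =
    (((2 * d)%:R^-1)%:E * \sum_(e : 'I_d * bool) P (nbr x e) A)%E.
  move=> mA.
  have msA : measurable ((@walk_shift d : W -> W) @^-1` A).
    by rewrite -[X in measurable X]setTI; exact: measurable_walk_shift.
  rewrite setI_bigcupl measure_fin_bigcup//=; last 2 first.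
  - apply/trivIsetP => e e' _ _ ee'; rewrite setIACA.
    by move/trivIsetP : tD => -> //; rewrite set0I.
  - by move=> e _; exact: measurableI.
  rewrite (_ : [set: 'I_d * bool] = [set` xpredT]); last first.
    by apply/seteqP; split.
  rewrite -(@bigfs _ _ _ _ (index_enum _)) ?index_enum_uniq//; last first.
    by move=> e _; rewrite mem_index_enum.
  rewrite ge0_sume_distrr//; apply: eq_bigr => e _.
  by rewrite srw_first_step// /step_prob nbr_neighbor.
have mU : measurable (\bigcup_e D e).
  by apply: fin_bigcup_measurable.
have PU : P x (\bigcup_e D e) = 1%E.
  have := PD setT measurableT; rewrite preimage_setT setIT => ->.
  under eq_bigr do rewrite probability_setT.
  rewrite sumEFin -EFinM sumr_const card_prod card_ord card_bool mulnC.
  by rewrite mulVf// pnatr_eq0 muln_eq0 negb_or -lt0n d_gt0.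
by rewrite -PD// setIC probability_setI_full.
Qed.

(** Induction on [n] by the first step: the event for [n.+1] is the preimage under [walk_shift] of
    the event for [n]. *)
Lemma srw_markov n x y (B : set W) : measurable B ->
  P x ([set w : walk d | w n = y] `&`
       ((fun w k => w (n + k)%N) : W -> W) @^-1` B) =
  ((walk_prob R n x y)%:E * P y B)%E.
Proof.
move=> mB; elim: n x => [|n IH] x /=.
  have [->|xy] := eqVneq x y.
    rewrite mul1e setIC probability_setI_full//; first exact: measurable_walk_coord.
    exact: (srw_start1 hP).
  rewrite mul0e; apply: (subset_measure0 (B := [set w : walk d | w 0%N = y] : set W)) => //.
  - by apply: measurableI => //; exact: measurable_walk_coord.
  - exact: measurable_walk_coord.
  rewrite [LHS](srw_start hP x [set z | z = y]) (_ : (x \in _) = false)//.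
  by apply/negbTE/negP; rewrite inE => h; move/eqP : xy.
pose E : set W := [set w : walk d | w n = y] `&`
       ((fun w k => w (n + k)%N) : W -> W) @^-1` B.
have mE : measurable E.
  apply: measurableI; first exact: measurable_walk_coord.
  by rewrite -[X in measurable X]setTI; exact: measurable_walk_iter.
rewrite (_ : _ `&` _ = (@walk_shift d : W -> W) @^-1` E)//.
rewrite srw_step//.
have {}IH z : P z E = ((walk_prob R n z y)%:E * P y B)%E by exact: IH.
rewrite (eq_bigr (fun e => (walk_prob R n (nbr x e) y)%:E * P y B)%E) => [|e _]; last exact: IH.
rewrite EFinM -muleA; congr (_ * _)%E.
rewrite -ge0_sume_distrl ?sumEFin// => e _.
by rewrite lee_fin walk_prob_ge0.
Qed.

Lemma srw_coord n x y :
  P x [set w : walk d | w n = y] = (walk_prob R n x y)%:E.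
Proof.
have := srw_markov n x y (@measurableT _ W).
by rewrite preimage_setT setIT probability_setT mule1.
Qed.

Lemma measurable_no_return (K : {fset V}) : measurable (no_return K : set W).
Proof.
rewrite (_ : no_return K = \bigcap_n
    [set w : walk d | (1 <= n)%N -> w n \notin K]); last first.
  by apply/seteqP; split=> [w h n _ /h//|w h n]; exact: h.
apply: bigcap_measurableType => n _.
exact: (measurable_walk_coord_in n [set x | (1 <= n)%N -> x \notin K]).
Qed.

(** Kept in the extended reals, so that transience can be stated as finiteness before [fine] is
    taken as in [green]. *)
Definition walk_green (x y : V) : \bar R :=
  (\sum_(n <oo) (walk_prob R n x y)%:E)%E.

Lemma greenE x : green P x = fine (walk_green x 0).
Proof. by congr fine; apply: eq_eseriesr => n _; rewrite srw_coord. Qed.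

Lemma eqmE (K : {fset V}) x : (x \in K) ->
  (eqm P K x)%:E = P x (no_return K).
Proof.
by move=> xK; rewrite /eqm xK fineK// fin_num_measure//; exact: measurable_no_return.
Qed.

Lemma eqm_ge0 (K : {fset V}) x : 0 <= eqm P K x.
Proof. by rewrite /eqm; case: ifP => // _; rewrite fine_ge0. Qed.

Section last_exit.
Hypothesis green_fin : forall x y, (walk_green x y < +oo)%E.

(* Decompose according to the last visit of [K], which exists by
   Borel-Cantelli. *)
Lemma last_exit (K : {fset V}) x : x \in K ->
  (\sum_(n <oo) \sum_(z <- K) (walk_prob R n x z)%:E * (eqm P K z)%:E = 1)%E.
Proof.
move=> xK.
pose F n : set W := [set w : walk d | w n \in K].
have mF n : measurable (F n) by exact: (measurable_walk_coord_in n [set` K]).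
pose E n : set W := F n `&` ((fun w k => w (n + k)%N) : W -> W) @^-1` no_return K.
have mE n : measurable (E n).
  apply: measurableI => //.
  rewrite -[X in measurable X]setTI; apply: measurable_walk_iter => //.
  exact: measurable_no_return.
have PF n : P x (F n) = (\sum_(z <- K) (walk_prob R n x z)%:E)%E.
  rewrite (_ : F n = \bigcup_(z in [set` K]) [set w : walk d | w n = z]); last first.
    apply/seteqP; split=> [w Fw|w [z /= zK wz]]; first by exists (w n).
    by rewrite /F /= wz.
  rewrite bigcup_fset measure_fbigsetU//=.
  - by apply: eq_bigr => z _; exact: srw_coord.
  - by move=> z _; exact: measurable_walk_coord.
  - apply/trivIsetP => z z' _ _ zz'; apply/seteqP; split => // w [/= h1 h2].
    by rewrite -h1 -h2 eqxx in zz'.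
have PE n : P x (E n) =
    (\sum_(z <- K) (walk_prob R n x z)%:E * (eqm P K z)%:E)%E.
  rewrite (_ : E n = \bigcup_(z in [set` K]) ([set w : walk d | w n = z] `&`
     ((fun w k => w (n + k)%N) : W -> W) @^-1` no_return K)); last first.
    apply/seteqP; split=> [w [Fw rw]|w [z /= zK [wz rw]]]; last first.
      by split=> //; rewrite /F /= wz.
    by exists (w n).
  have mR : measurable (((fun w k => w (n + k)%N) : W -> W) @^-1` no_return K).
    rewrite -[X in measurable X]setTI; apply: measurable_walk_iter => //.
    exact: measurable_no_return.
  rewrite bigcup_fset measure_fbigsetU//=.
  - rewrite !big_seq; apply: eq_bigr => z zK; rewrite srw_markov ?eqmE//.
    exact: measurable_no_return.
  - by move=> z _; apply: measurableI => //; exact: measurable_walk_coord.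
  - apply/trivIsetP => z z' _ _ zz'; apply/seteqP; split => // w [[/= h1 _] [h2 _]].
    by rewrite -h1 -h2 eqxx in zz'.
transitivity (\sum_(n <oo) P x (E n))%E; first exact: eq_eseriesr.
have tE : trivIset setT E.
  apply/trivIsetP => m n _ _ mn; apply/seteqP; split => // w.
  wlog : m n mn / (m < n)%N => [H|{}mn].
    move=> [Em En]; have [h|h|h] := ltngtP m n; [|rewrite eq_sym in mn|].
    - exact: (H m n mn h (conj Em En)).
    - exact: (H n m mn h (conj En Em)).
    
    by rewrite h eqxx in mn.
  move=> [[_ rm] [Fn _]]; have := rm (n - m)%N.
  by rewrite subn_gt0 mn subnKC ?(ltnW mn)// Fn => /(_ isT).
rewrite -measure_semi_bigcup//; last exact: bigcupT_measurable.
have mU : measurable (\bigcup_n E n) by exact: bigcupT_measurable.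
have F0 : P x (lim_sup_set F) = 0%E.
  apply: lim_sup_set_cvg0 => //.
  rewrite (eq_eseriesr (fun n _ => PF n)).
  rewrite nneseries_sum; last by move=> z n _; rewrite lee_fin walk_prob_ge0.
  rewrite big_seq; apply: lte_sum_pinfty => z _; exact: green_fin.
have mL : measurable (lim_sup_set F).
  apply: bigcapT_measurable => n; apply: bigcup_measurable => k _; exact: mF.
have sub : [set w : walk d | w 0%N = x] `<=` (\bigcup_n E n) `|` lim_sup_set F.
  move=> w /= w0.
  have [L|/existsNP[N /= nL]] := pselect (forall n, exists2 k, (n <= k)%N & F k w).
    by right => n _; have [k nk Fk] := L n; exists k.
  left.
  have bnd k : F k w -> (k <= N)%N.
    by move=> Fk; rewrite leqNgt; apply/negP => /ltnW Nk; apply: nL; exists k.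
  have ex : exists k, (w k \in K) by exists 0%N; rewrite w0.
  have [k wk kmax] := @ex_maxnP (fun k => w k \in K) N ex bnd.
  exists k => //; split=> // j j1; apply/negP => /kmax.
  by rewrite -[leqRHS]addn0 leq_add2l leqNgt j1.
apply/eqP; rewrite eq_le; apply/andP; split; first exact: probability_le1.
have := srw_start hP x [set z | z = x]; rewrite mem_set//= => <-.
rewrite -[leRHS]adde0 -F0.
apply: le_trans (measureU2 _ mU mL).
apply: le_measure; rewrite ?inE//; first exact: measurable_walk_coord.
exact: measurableU.
Qed.

End last_exit.
End simple_random_walk_green.

(** * Transience in dimension at least three *)

Section transience.
Context (R : realType).

Lemma inv_sqrt_le (p y : R) : 0 < y -> 0 < p -> 1 <= p ^+ 2 * y ->
  (Num.sqrt y)^-1 <= p.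
Proof.
move=> y0 p0 py; rewrite invf_ple ?posrE ?sqrtr_gt0//.
have -> : p^-1 = Num.sqrt (p^-1 ^+ 2) by rewrite sqrtr_sqr ger0_norm// invr_ge0 ltW.
rewrite ler_wsqrtr//.
by rewrite exprVn -[_^-1]mul1r ler_pdivrMr ?exprn_gt0// mulrC.
Qed.

(** The cubic Taylor polynomial of [(1 + q)^(-1/2)], with the fourth coefficient [35 / 128] raised
    to [1] to absorb the remainder. In [p ^ 2 * (1 + q) - 1] all powers below the fourth cancel, and
    the cofactor of [q ^ 4] is nonnegative for [|q| <= 1 / 2]. *)
Lemma inv_sqrt_taylor (q : R) : `|q| <= 2^-1 ->
  (Num.sqrt (1 + q))^-1 <=
  1 - q / 2 + 3 / 8 * q ^+ 2 - 5 / 16 * q ^+ 3 + q ^+ 4.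
Proof.
rewrite ler_norml => /andP[q1 q2].
have q2' : q ^+ 2 <= 4^-1 by nra.
have q3 : `|q ^+ 3| <= 8^-1.
  by rewrite exprS ler_norml; apply/andP; split; nra.
move: q3; rewrite ler_norml => /andP[q31 q32].
have q4 : 0 <= q ^+ 4 by rewrite (_ : q ^+ 4 = q ^+ 2 ^+ 2) ?sqr_ge0// -exprM.
have q4' : q ^+ 4 <= 16^-1.
  by rewrite (_ : q ^+ 4 = q ^+ 2 ^+ 2) -?exprM//; nra.
apply: inv_sqrt_le; [lra|nra|].
rewrite -subr_ge0.
rewrite (_ : _ - 1 = q ^+ 4 * ((- (35 / 64) + 14 / 64 * q - 35 / 256 * q ^+ 2 +
    25 / 256 * q ^+ 3) + 2 * (1 + q / 2 - q ^+ 2 / 8 + q ^+ 3 / 16 -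
    5 / 16 * q ^+ 4) + q ^+ 4 * (1 + q))); last by field.
rewrite mulr_ge0//; have : 0 <= q ^+ 4 * (1 + q) by rewrite mulr_ge0//; lra.
lra.
Qed.

(** Opposite neighbours along an axis correspond to [q] and [- q], so the odd Taylor terms
    cancel. *)
Lemma inv_sqrt_second_difference (q : R) : `|q| <= 2^-1 ->
  (Num.sqrt (1 + q))^-1 + (Num.sqrt (1 - q))^-1 <=
  2 + 3 / 4 * q ^+ 2 + 2 * q ^+ 4.
Proof.
move=> q1; have := inv_sqrt_taylor q1.
have := @inv_sqrt_taylor (- q); rewrite normrN => /(_ q1).
have -> : (- q) ^+ 2 = q ^+ 2 by ring.
have -> : (- q) ^+ 3 = - q ^+ 3 by ring.
have -> : (- q) ^+ 4 = q ^+ 4 by ring.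
lra.
Qed.

(** The tangent at [r] of the convex function [r^(-1/2)] lies below its graph at [r - 1]. *)
Lemma inv_sqrt_pred (r : R) : 1 < r ->
  (Num.sqrt r)^-1 * (1 + (2 * r)^-1) <= (Num.sqrt (r - 1))^-1.
Proof.
move=> r1; have r0 : 0 < r by lra.
have p0 : 0 < 1 + (2 * r)^-1 by rewrite addr_gt0// invr_gt0; lra.
rewrite -ler_pdivlMr// -invfM.
rewrite lef_pV2 ?posrE ?sqrtr_gt0// ?mulr_gt0 ?sqrtr_gt0//; last lra.
rewrite -(ger0_norm (ltW p0)) -sqrtr_sqr -sqrtrM; last lra.
rewrite ler_wsqrtr//.
have -> : (r - 1) * (1 + (2 * r)^-1) ^+ 2 =
   r - 3 / 4 * r^-1 - 4^-1 * r^-1 ^+ 2 by field; lra.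
have : 0 < r^-1 by rewrite invr_gt0.
nra.
Qed.

Context (d : nat).
Hypothesis d_ge3 : (3 <= d)%N.
Local Notation V := 'rV[int]_d.

Definition sqnorm (x : V) : R := \sum_i ((x 0 i)%:~R) ^+ 2.

(* Superharmonic when [3 <= d], strictly at [0], so that a multiple of it dominates
   the Green function; the constant [11] leaves room for the Taylor remainder. *)
Definition lyap (x : V) : R := (Num.sqrt (11 + sqnorm x))^-1.

Lemma sqnorm_ge0 x : 0 <= sqnorm x.
Proof. by apply: sumr_ge0 => i _; rewrite sqr_ge0. Qed.

Lemma sqnorm_nbr x i b :
  sqnorm (nbr x (i, b)) = sqnorm x + 1 + (-1) ^+ b * (2 * (x 0 i)%:~R).
Proof.
rewrite /sqnorm (bigD1 i)//= [in RHS](bigD1 i)//= !mxE !eqxx/= mulr1.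
rewrite (eq_bigr (fun j => ((x 0 j)%:~R) ^+ 2)) => [|j ji]; last first.
  by rewrite !mxE (negbTE ji) andbF mulr0 addr0.
by case: b; rewrite ?expr1 ?expr0 ?rmorphD ?rmorphN ?rmorph1 /=; ring.
Qed.

(** With [r = 12 + |x|^2] and [q i = 2 x_i / r], the neighbours along axis [i] have
    [11 + |y|^2 = r (1 + q i)] or [r (1 - q i)], while [lyap x = (r - 1)^(-1/2)]. After division by
    [r^(-1/2)], the sum over neighbours exceeds [2 d] by at most [3 / r - 36 / r^2 + 32 / r^2], and
    the tangent bound leaves room for [d / r]: hence [3 <= d]. The [36] is three times the constant
    [12], the [32] comes from the quartic terms. *)
Lemma lyap_superharmonic x :
  (2 * d)%:R^-1 * (\sum_(e : 'I_d * bool) lyap (nbr x e)) <= lyap x.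
Proof.
have d0 : 0 < d%:R :> R by rewrite ltr0n (leq_trans _ d_ge3).
rewrite mulrC ler_pdivrMr ?natrM ?mulr_gt0//.
rewrite -(pair_bigA _ (fun i b => lyap (nbr x (i, b))))/=.
set r := 12 + sqnorm x.
have s0 := sqnorm_ge0 x.
have r12 : 12 <= r by rewrite /r; lra.
have r0 : 0 < r by lra.
have xr i : ((x 0 i)%:~R) ^+ 2 <= r - 12.
  rewrite /r addrAC subrr add0r /sqnorm (bigD1 i)//= lerDl.
  by apply: sumr_ge0 => j _; rewrite sqr_ge0.
pose q i : R := 2 * (x 0 i)%:~R / r.
have q2 i : q i ^+ 2 = 4 * ((x 0 i)%:~R) ^+ 2 * r^-1 ^+ 2.
  by rewrite /q; field; lra.
have ri0 : 0 < r^-1 by rewrite invr_gt0.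
have qle i : `|q i| <= 2^-1.
  rewrite -(@ler_pXn2r _ 2)// ?nnegrE// ?invr_ge0// real_normK ?num_real//.
  have h : ((x 0 i)%:~R) ^+ 2 * r^-1 ^+ 2 <= (r - 12) * r^-1 ^+ 2.
    by rewrite ler_wpM2r ?sqr_ge0.
  have e : (r - 12) * r^-1 ^+ 2 = r^-1 - 12 * r^-1 ^+ 2 by field; lra.
  by rewrite q2 -mulrA; nra.
have ph i : \sum_b lyap (nbr x (i, b)) <=
    (Num.sqrt r)^-1 * (2 + 3 / 4 * q i ^+ 2 + 2 * q i ^+ 4).
  have E b : lyap (nbr x (i, b)) =
      (Num.sqrt r)^-1 * (Num.sqrt (1 + (-1) ^+ b * q i))^-1.
    rewrite /lyap sqnorm_nbr -invfM -sqrtrM ?ltW//; congr (Num.sqrt _)^-1.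
    by rewrite /q mulrDr mulr1 mulrA mulrCA [r * _]mulrC divfK ?gt_eqF// /r; ring.
  rewrite big_bool/= !E /= expr1 expr0 mul1r mulN1r -mulrDr.
  rewrite ler_wpM2l ?invr_ge0// addrC; exact: inv_sqrt_second_difference.
apply: (le_trans (ler_sum _ (fun i _ => ph i))).
rewrite -mulr_sumr.
have sq2 : \sum_i q i ^+ 2 = 4 * (r - 12) * r^-1 ^+ 2.
  under eq_bigr do rewrite q2.
  have -> : r - 12 = sqnorm x by rewrite /r; ring.
  by rewrite -mulr_suml -mulr_sumr.
have sq4 : \sum_i q i ^+ 4 <= (\sum_i q i ^+ 2) ^+ 2.
  have sge0 : 0 <= \sum_i q i ^+ 2 by apply: sumr_ge0 => i _; rewrite sqr_ge0.
  rewrite [leRHS]expr2 mulr_suml; apply: ler_sum => i _.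
  rewrite (_ : q i ^+ 4 = q i ^+ 2 * q i ^+ 2); last by rewrite -exprD.
  rewrite ler_wpM2l ?sqr_ge0// (bigD1 i)//= lerDl.
  by apply: sumr_ge0 => j _; rewrite sqr_ge0.
rewrite !big_split/= sumr_const card_ord -!mulr_sumr.
have rN : 1 < r by lra.
have := inv_sqrt_pred rN.
have -> : r - 1 = 11 + sqnorm x by rewrite /r; ring.
rewrite -/(lyap x) => Hl.
apply: (@le_trans _ _ ((Num.sqrt r)^-1 * (1 + (2 * r)^-1) * (2 * d%:R))); last first.
  by rewrite ler_wpM2r// mulr_ge0// ltW.
rewrite -mulrA ler_wpM2l ?invr_ge0//.
rewrite sq2 in sq4 *.
have -> : (1 + (2 * r)^-1) * (2 * d%:R) = 2 * d%:R + d%:R * r^-1.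
  by field; lra.
have d3 : 3 <= d%:R :> R by rewrite ler_nat.
have h1 : 3 * r^-1 <= d%:R * r^-1 by rewrite ler_wpM2r// ltW.
have h2 : (4 * (r - 12) * r^-1 ^+ 2) ^+ 2 <= 16 * r^-1 ^+ 2.
  rewrite (_ : 4 * (r - 12) * r^-1 ^+ 2 = 4 * (1 - 12 * r^-1) * r^-1); last first.
    by field; lra.
  have : r^-1 <= 12^-1 by rewrite lef_pV2 ?posrE//.
  nra.
have -> : 3 / 4 * (4 * (r - 12) * r^-1 ^+ 2) = 3 * r^-1 - 36 * r^-1 ^+ 2.
  by field; lra.
have : 0 <= r^-1 ^+ 2 by rewrite sqr_ge0.
move: sq4 h2 h1; set A := \sum_i q i ^+ 4.
lra.
Qed.

(** Every neighbour of [0] has the value [12^(-1/2)], below [11^(-1/2)]. *)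
Lemma lyap_gap :
  0 < lyap 0 - (2 * d)%:R^-1 * (\sum_(e : 'I_d * bool) lyap (nbr 0 e)).
Proof.
have n0 : sqnorm 0 = 0 by apply: big1 => i _; rewrite mxE rmorph0 expr0n.
have d0 : 0 < d%:R :> R by rewrite ltr0n (leq_trans _ d_ge3).
have E e : lyap (nbr 0 e) = (Num.sqrt 12)^-1.
  case: e => i b; rewrite /lyap sqnorm_nbr n0 mxE rmorph0 !mulr0 addr0 add0r.
  by congr (Num.sqrt _)^-1; ring.
rewrite (eq_bigr _ (fun e _ => E e)) sumr_const card_prod card_ord card_bool.
rewrite -[_ *+ (d * 2)]mulr_natl mulrA mulnC mulVf ?mul1r; last first.
  by rewrite natrM mulf_neq0 ?gt_eqF.
rewrite subr_gt0 /lyap n0 addr0 ltf_pV2 ?posrE ?sqrtr_gt0//; try lra.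
by rewrite ltr_sqrt; lra.
Qed.

(** The partial Green sums satisfy [G_(N+1) (z) = [z = 0] +] the mean of [G_N] over the neighbours
    of [z]. With [c] the gap at the origin, [lyap / c] is a supersolution of this recursion and thus
    bounds them uniformly in [N]. *)
Lemma walk_green_fin (x y : V) : (walk_green R x y < +oo)%E.
Proof.
set c := lyap 0 - (2 * d)%:R^-1 * (\sum_(e : 'I_d * bool) lyap (nbr 0 e)).
have c0 : 0 < c := lyap_gap.
have H N z : \sum_(n < N) walk_prob R n z 0 <= lyap z / c.
  elim: N z => [|N IH] z.
    by rewrite big_ord0 divr_ge0 ?invr_ge0// ltW.
  rewrite big_ord_recl/=.
  rewrite -mulr_sumr exchange_big/=.
  apply: (@le_trans _ _ ((z == 0)%:R + (2 * d)%:R^-1 *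
      \sum_(e : 'I_d * bool) lyap (nbr z e) / c)).
    rewrite lerD2l ler_wpM2l ?invr_ge0//; apply: ler_sum => e _; exact: IH.
  rewrite -mulr_suml mulrA -(@ler_pM2r _ c)// mulrDl !mulfVK ?gt_eqF//.
  have [->|z0] := eqVneq z 0; first by rewrite mul1r /c subrK.
  by rewrite mul0r add0r; exact: lyap_superharmonic.
apply: (@le_lt_trans _ _ (lyap (x - y) / c)%:E); last exact: ltry.
apply: lime_le; first by apply: is_cvg_nneseries => n _ _; rewrite lee_fin walk_prob_ge0.
apply: nearW => N; rewrite sumEFin lee_fin big_mkord.
under eq_bigr do rewrite walk_prob_diff.
exact: H.
Qed.

End transience.

(** * Poisson random measures *)

Section poisson_characteristic_series.
Context (R : realType).
Implicit Types a b c t : R.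

(** The power series with these coefficients is the real part of [exp (i b + t e^(i c))];
    differentiation in [t] shifts the phase [b] by [c]. *)
Let coef c b (n : nat) : R := cos (c * n%:R + b) * (n`!%:R)^-1.

Let is_cvg_coef c b t : cvgn (pseries (coef c b) t).
Proof.
apply: normed_cvg; apply: (@series_le_cvg _ _ (exp_coeff `|t|)).
- by move=> n; exact: normr_ge0.
- by move=> n; apply: exp_coeff_ge0.
- move=> n; rewrite /= !normrM normrX normfV (@ger0_norm _ (n`!%:R))//.
  rewrite /exp_coeff /= -mulrA [leRHS]mulrC ler_piMl ?cos_max//.
- exact: is_cvg_series_exp_coeff.
Qed.

Let diffs_coef c b : pseries_diffs (coef c b) = coef c (b + c).
Proof.
apply/funext => n; rewrite /pseries_diffs /coef factS natrM invfM.
rewrite [LHS]mulrCA mulVKf ?pnatr_eq0// -[in LHS]natr1.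
by congr (cos _ * _); ring.
Qed.

Let char_sum c b t := limn (pseries (coef c b) t).

Let is_derive_char_sum c b t : is_derive t 1 (char_sum c b) (char_sum c (b + c) t).
Proof.
have tt : `|t| < `| (`|t| + 1) | by rewrite [ltRHS]ger0_norm ?addr_ge0// ltrDl.
have := @pseries_snd_diffs _ (coef c b) (`|t| + 1) t (@is_cvg_coef _ _ _).
by rewrite !diffs_coef; apply => //; exact: is_cvg_coef.
Qed.

Let char_sumE c b t :
  char_sum c b t = cos b * char_sum c 0 t + sin b * char_sum c (pi / 2) t.
Proof.
apply/cvg_lim => //.
rewrite (_ : pseries _ t = fun n => cos b * pseries (coef c 0) t n +
    sin b * pseries (coef c (pi / 2)) t n).
  by apply: cvgD; apply: cvgM; by [exact: cvg_cst|exact: is_cvg_coef].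
apply/funext => n; rewrite /pseries /series/= !mulr_sumr -big_split/=.
by apply: eq_bigr => i _; rewrite /coef cosDpihalf cosD addr0; ring.
Qed.

Let char_sum0 c b : char_sum c b 0 = cos b.
Proof.
apply/cvg_lim => //; apply: cvg_near_cst; exists 1%N => // n /= n1.
rewrite /pseries /series/= big_mkord; case: n n1 => // n _.
rewrite big_ord_recl /= expr0 mulr1 /coef mulr0 add0r fact0 invr1 mulr1.
by rewrite big1 ?addr0// => i _; rewrite expr0n/= mulr0.
Qed.

(* As a function of [t], the pair of sums with phases [0] and [pi / 2] solves the
   linear system whose solution is [exp (t cos c)] times the rotation by
   [t sin c]; undoing this rotation and growth yields a zero derivative. *)
Let rotated c b t : R := expR (- (t * cos c)) *
  (cos (b - t * sin c) * char_sum c 0 t + sin (b - t * sin c) * char_sum c (pi / 2) t).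

Let rotatedE c b t : rotated c b t = cos b.
Proof.
have d (s : R) : is_derive s 1 (rotated c b) 0.
  have d0 := is_derive_char_sum c 0 s; have d1 := is_derive_char_sum c (pi / 2) s.
  rewrite add0r char_sumE in d0; rewrite addrC char_sumE cosDpihalf sinDpihalf in d1.
  rewrite /rotated; apply: is_derive_eq; rewrite /GRing.scale/=; ring.
rewrite (_ : cos b = rotated c b 0).
  by apply: is_derive_0_is_cst => s; exact: d.
by rewrite /rotated !mul0r subr0 oppr0 expR0 mul1r -char_sumE char_sum0.
Qed.

Lemma poisson_char_series c a t :
  series (fun n => t ^+ n / n`!%:R * expR (- t) * cos (c * n%:R + a)) @ \oo -->
  expR (t * (cos c - 1)) * cos (t * sin c + a).
Proof.
have -> : expR (t * (cos c - 1)) * cos (t * sin c + a) = expR (- t) * char_sum c a t.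
  rewrite -(rotatedE c (t * sin c + a) t) /rotated addrAC subrr add0r -char_sumE.
  by rewrite mulrA -expRD; congr (expR _ * _); ring.
rewrite (_ : series _ = fun n => expR (- t) * pseries (coef c a) t n).
  by apply: cvgM; [exact: cvg_cst|exact: is_cvg_coef].
apply/funext => n; rewrite /pseries /series/= mulr_sumr.
by apply: eq_bigr => i _; rewrite /coef; ring.
Qed.

Lemma poisson_total_mass t :
  series (fun n => t ^+ n / n`!%:R * expR (- t)) @ \oo --> (1 : R).
Proof.
have := @poisson_char_series 0 0 t.
rewrite cos0 subrr mulr0 expR0 sin0 mulr0 addr0 cos0 mulr1.
by under [X in series X]eq_fun do rewrite mul0r addr0 cos0 mulr1.
Qed.

End poisson_characteristic_series.

Lemma measurable_cos (R : realType) : measurable_fun setT (@cos R).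
Proof. by apply: continuous_measurable_fun; exact: continuous_cos. Qed.

Lemma measurable_sin (R : realType) : measurable_fun setT (@sin R).
Proof. by apply: continuous_measurable_fun; exact: continuous_sin. Qed.

Section rintegral_bounded.
Context (R : realType) dO (Omega : measurableType dO) (PP : probability Omega R).

Lemma integrable_bounded (D : set Omega) (g : Omega -> R) (M : R) :
  measurable D -> measurable_fun D g -> (forall w, `|g w| <= M) ->
  PP.-integrable D (EFin \o g).
Proof.
move=> mD mg gM; apply: measurable_bounded_integrable => //.
  by rewrite (le_lt_trans (probability_le1 _ _)) ?ltry.
by exists M; split; [exact: num_real|move=> x Mx y _ /=; rewrite (le_trans (gM _)) ?ltW].
Qed.

Lemma le_normr_Rintegral_bounded (D : set Omega) (g : Omega -> R) (M : R) :
  measurable D -> measurable_fun D g -> (forall w, `|g w| <= M) ->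
  `|\int[PP]_(w in D) g w| <= M * fine (PP D).
Proof.
move=> mD mg gM; have ig := integrable_bounded mD mg gM.
apply: (le_trans (le_normr_Rintegral mD ig)).
rewrite -Rintegral_cst//; apply: le_Rintegral => //.
- exact: (integrable_norm ig).
- exact: finite_measure_integrable_cst.
Qed.

(** The levels [X = k] carry total mass one, so what [A] has outside the first [n] of them has mass
    tending to zero, and [|g| <= 1] there. *)
Lemma Rintegral_nat_split (X : Omega -> \bar R) (q : nat -> R) (A : set Omega)
    (g : Omega -> R) :
  measurable_fun setT X ->
  (forall k : nat, PP [set w | X w = k%:R%:E] = (q k)%:E) ->
  series q @ \oo --> (1 : R) ->
  measurable A -> measurable_fun setT g -> (forall w, `|g w| <= 1) ->
  series (fun k : nat => \int[PP]_(w in A `&` [set w | X w = k%:R%:E]) g w)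
    @ \oo --> \int[PP]_(w in A) g w.
Proof.
move=> mX hq q1 mA mg g1.
pose E (k : nat) := [set w | X w = k%:R%:E].
have mE k : measurable (E k).
  by rewrite (_ : E k = X @^-1` [set k%:R%:E])// -[X in measurable X]setTI; exact: mX.
pose U n := \big[setU/set0]_(k < n) E k.
have mU n : measurable (U n) by exact: bigsetU_measurable.
have UE n : U n `&` E n = set0.
  rewrite /U -bigcup_mkord; apply/seteqP; split=> // w [[k /= kn Ek] En].
  move: Ek En; rewrite /E/= => -> [] /eqP; rewrite eqr_nat => /eqP kn'.
  by rewrite kn' ltnn in kn.
have mgT B : measurable_fun B g by exact: measurable_funTS.
have ig B : measurable B -> PP.-integrable B (EFin \o g).
  by move=> mB; apply: (@integrable_bounded _ _ 1).
have S n : \int[PP]_(w in A `&` U n) g w =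
    series (fun k : nat => \int[PP]_(w in A `&` E k) g w) n.
  elim: n => [|n IH].
    by rewrite /U big_ord0 setI0 Rintegral_set0 /series/= big_nil.
  rewrite seriesSr -IH /U big_ord_recr/= -/(U n) setIUr Rintegral_setU//=.
  - exact: measurableI.
  - exact: measurableI.
  - by apply: ig; apply: measurableU; exact: measurableI.
  - by apply/disj_setPS; rewrite setIACA UE setI0.
have PU n : PP (U n) = (series q n)%:E.
  elim: n => [|n IH]; first by rewrite /U big_ord0 measure0 /series/= big_nil.
  rewrite seriesSr EFinD -IH -hq /U big_ord_recr/= measureU//.
    exact: mU.
  exact: UE.
rewrite -/E; apply/cvgrPdist_le => e e0.
move/cvgrPdist_le: q1 => /(_ _ e0); apply: filterS => n /=; apply: le_trans.
have EA : A = A `&` U n `|` A `&` ~` U n by rewrite -setIUr setUv setIT.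
rewrite -S {1}EA Rintegral_setU//=.
- rewrite [X in `|X|]addrAC subrr add0r.
  apply: (le_trans (le_normr_Rintegral_bounded _ _ g1)) => //.
    by apply: measurableI => //; exact: measurableC.
  rewrite mul1r; apply: (@le_trans _ _ (fine (PP (~` U n)))).
    apply: fine_le; rewrite ?fin_num_measure//; [|exact: measurableC|].
      by apply: measurableI => //; exact: measurableC.
    apply: le_measure; rewrite ?inE//; last exact: measurableC.
    by apply: measurableI => //; exact: measurableC.
  by rewrite probability_setC// PU -EFinB/= ler_norm.
- exact: measurableI.
- by apply: measurableI => //; exact: measurableC.
- by rewrite -EA; exact: ig.
- by apply/disj_setPS; rewrite setIACA setICr setI0.
Qed.

End rintegral_bounded.

Section poisson_random_measure.
Context (R : realType) dO (Omega : measurableType dO) (PP : probability Omega R).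
Context dT (T : measurableType dT).
Variables (N : Omega -> {measure set T -> \bar R}) (m : {measure set T -> \bar R}).

(** The form of [is_ppp] in which the counts come from a measure [N w], so that functions can be
    integrated against it. *)
Definition poisson_random_measure : Prop :=
  [/\ forall A, measurable A -> measurable_fun setT (fun w => N w A),
      forall A (k : nat), measurable A -> (m A < +oo)%E ->
        PP [set w | N w A = k%:R%:E] =
        (fine (m A) ^+ k / k`!%:R * expR (- fine (m A)))%:E
    & forall n (D : 'I_n -> set T) (B : 'I_n -> set (\bar R)),
        (forall i, measurable (D i)) -> trivIset setT D ->
        (forall i, measurable (B i)) ->
        PP (\bigcap_i [set w | B i (N w (D i))]) =
        (\prod_(i < n) fine (PP [set w | B i (N w (D i))]))%:E].

Hypothesis prm : poisson_random_measure.

Let mN A (mA : measurable A) : measurable_fun setT (fun w => N w A).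
Proof. by case: prm => h _ _; exact: h. Qed.

Lemma prm_count_level A (k : nat) : measurable A -> measurable [set w | N w A = k%:R%:E].
Proof.
move=> mA; rewrite (_ : [set w | _] = (fun w => N w A) @^-1` [set k%:R%:E])//.
by rewrite -[X in measurable X]setTI; exact: mN.
Qed.

Lemma trivIset_prm_count A : trivIset setT (fun k : nat => [set w | N w A = k%:R%:E]).
Proof.
apply/trivIsetP => i j _ _ ij; apply/seteqP; split => // w [] /= -> [] /eqP.
by rewrite eqr_nat (negbTE ij).
Qed.

Lemma prm_count_setC A : measurable A -> (m A < +oo)%E ->
  PP (~` \bigcup_k [set w | N w A = k%:R%:E]) = 0%E.
Proof.
move=> mA mAoo; have mE k := prm_count_level k mA.
have mU : measurable (\bigcup_k [set w | N w A = k%:R%:E]) by exact: bigcupT_measurable.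
rewrite probability_setC// measure_semi_bigcup//; last exact: trivIset_prm_count.
case: prm => _ hq _; rewrite (eq_eseriesr (fun k _ => hq A k mA mAoo)).
suff -> : (\sum_(k <oo) (fine (m A) ^+ k / k`!%:R * expR (- fine (m A)))%:E = 1)%E.
  by rewrite subee.
apply/cvg_lim => //; apply/fine_cvgP; split.
  by apply: nearW => n; rewrite sumEFin.
apply: cvg_trans (@poisson_total_mass R (fine (m A))).
by apply: near_eq_cvg; apply: nearW => n /=; rewrite sumEFin.
Qed.

Lemma prm_finite A : measurable A -> (m A < +oo)%E ->
  {ae PP, forall w, (N w A < +oo)%E}.
Proof.
move=> mA mAoo; exists (~` \bigcup_k [set w | N w A = k%:R%:E]); split.
- by apply/measurableC/bigcupT_measurable => k; exact: prm_count_level.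
- exact: prm_count_setC.
- by move=> w /= nw [k _ Ek]; apply: nw; rewrite Ek ltry.
Qed.

(** Independence is given for events only, so the counts are integrated out one at a time: where a
    count equals [k] its contribution joins the phase, and summing over [k] is
    [poisson_char_series]. *)
Lemma prm_char_disjoint n (D : 'I_n -> set T) (c : 'I_n -> R) (a : R) :
  (forall i, measurable (D i)) -> trivIset setT D ->
  (forall i, (m (D i) < +oo)%E) ->
  \int[PP]_w cos (\sum_(i < n) c i * fine (N w (D i)) + a) =
  expR (\sum_(i < n) fine (m (D i)) * (cos (c i) - 1)) *
  cos (\sum_(i < n) fine (m (D i)) * sin (c i) + a).
Proof.
move=> mD tD Doo.
have [_ hq hI] := prm.
pose mu i := fine (m (D i)).
(* Generalised for the induction: sets of index below [j] enter the cosine and are unconstrained,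
   the others enter only through the events [B i], and the phase [b] is free. *)
suff H (j : nat) (B : 'I_n -> set (\bar R)) (b : R) : (j <= n)%N ->
    (forall i, measurable (B i)) -> (forall i : 'I_n, (i < j)%N -> B i = setT) ->
  \int[PP]_(w in \bigcap_i [set w | B i (N w (D i))])
    cos (\sum_(i < n | (i < j)%N) c i * fine (N w (D i)) + b) =
  expR (\sum_(i < n | (i < j)%N) mu i * (cos (c i) - 1)) *
  cos (\sum_(i < n | (i < j)%N) mu i * sin (c i) + b) *
  \prod_(i < n) fine (PP [set w | B i (N w (D i))]).
  have := H n (fun=> setT) a (leqnn n) (fun=> measurableT) (fun _ _ => erefl).
  have -> : \prod_(i < n) fine (PP [set w | [set: \bar R] (N w (D i))]) = 1.
    apply: big1 => i _; rewrite (_ : [set w | _] = setT) ?probability_setT//.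
  rewrite (_ : \bigcap_i _ = setT); last by apply/seteqP; split.
  rewrite mulr1.
  rewrite (eq_bigl xpredT) => [|i]; last exact: ltn_ord.
  rewrite [in X in _ * X](eq_bigl xpredT) => [<-|i]; last exact: ltn_ord.
  apply: eq_Rintegral => w _.
  by rewrite [in RHS](eq_bigl xpredT) => [//|i]; exact: ltn_ord.
elim: j B b => [|j IH] B b jn mB BT.
  have Z (F : 'I_n -> R) : \sum_(i < n | (i < 0)%N) F i = 0 by exact: big_pred0.
  under eq_Rintegral do rewrite Z.
  rewrite !Z !add0r expR0 mul1r.
  have mI : measurable (\bigcap_i [set w | B i (N w (D i))]).
    apply: fin_bigcap_measurable => // i _.
    by rewrite -[X in measurable X]setTI; exact: mN.
  rewrite Rintegral_cst//; congr (_ * _).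
  exact: (congr1 fine (hI n D B mD tD mB)).
pose i0 : 'I_n := Ordinal jn.
pose X w := N w (D i0).
have mX : measurable_fun setT X by exact: mN.
set A := \bigcap_i _.
have mA : measurable A.
  apply: fin_bigcap_measurable => // i _.
  by rewrite -[X in measurable X]setTI; exact: mN.
set g := fun w => cos _.
have mg : measurable_fun setT g.
  apply: (@measurableT_comp _ _ _ _ _ _ (@cos R)) => //.
    exact: measurable_cos.
  apply: measurable_funD => //; under eq_fun do rewrite big_mkcond/=.
  have mt (i : 'I_n) : measurable_fun setT (fun w : Omega =>
      if (i < j.+1)%N then c i * fine (N w (D i)) else 0).
    case: (i < j.+1)%N => //.
    by apply: measurable_funM => //; apply: measurableT_comp => //; exact: mN.
  exact: (measurable_sum _ mt).
have g1 w : `|g w| <= 1 by rewrite ler_norml cos_geN1 cos_le1.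
have SP (F : 'I_n -> R) : \sum_(i < n | (i < j.+1)%N) F i =
    \sum_(i < n | (i < j)%N) F i + F i0.
  rewrite (bigD1 i0)//= addrC; congr (_ + _); apply: eq_bigl => i.
  by rewrite ltnS ltn_neqAle andbC -val_eqE.
have s1 := @Rintegral_nat_split _ _ _ PP X _ A g mX
   (fun k => hq _ k (mD i0) (Doo i0)) (@poisson_total_mass R _) mA mg g1.
set p := \prod_(i < n) _.
pose th := \sum_(i < n | (i < j)%N) mu i * sin (c i).
pose ex := expR (\sum_(i < n | (i < j)%N) mu i * (cos (c i) - 1)).
have term k : \int[PP]_(w in A `&` [set w | X w = k%:R%:E]) g w =
    ex * p * (mu i0 ^+ k / k`!%:R * expR (- mu i0) *
      cos (c i0 * k%:R + (th + b))).
  pose B' i := if i == i0 then [set k%:R%:E] else B i.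
  have -> : A `&` [set w | X w = k%:R%:E] = \bigcap_i [set w | B' i (N w (D i))].
    apply/seteqP; split => [w [Aw Xk] i _|w Aw].
      by rewrite /B' /=; case: eqVneq => [->//|_]; exact: Aw.
    split => [i _|]; last by have := Aw i0 Logic.I; rewrite /B' eqxx.
    have := Aw i Logic.I; rewrite /B' /=; case: eqVneq => [->|//] _.
    by rewrite BT.
  transitivity (\int[PP]_(w in \bigcap_i [set w | B' i (N w (D i))])
    cos (\sum_(i < n | (i < j)%N) c i * fine (N w (D i)) + (c i0 * k%:R + b))).
    apply: eq_Rintegral => w; rewrite inE => /(_ i0 Logic.I).
    by rewrite /g SP /B' eqxx /= => ->; rewrite addrA.
  rewrite IH; last 3 first.
  - exact: ltnW.
  - by move=> i; rewrite /B'; case: ifP => // _; exact: emeasurable_set1.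
  - move=> i ij; rewrite /B' ifF ?BT ?ltnS 1?ltnW//.
    by apply/negbTE; rewrite -val_eqE /= neq_ltn ij.
  rewrite -/th -/ex (_ : th + (c i0 * k%:R + b) = c i0 * k%:R + (th + b)); last first.
    by rewrite addrCA.
  rewrite (_ : \prod_(i < n) _ = p * (mu i0 ^+ k / k`!%:R * expR (- mu i0))).
    ring.
  rewrite /p (bigD1 i0)//= [in RHS](bigD1 i0)//= /B' eqxx.
  rewrite (_ : [set w | [set k%:R%:E] _] = [set w | N w (D i0) = k%:R%:E])//.
  rewrite hq//= (_ : [set w | B i0 _] = setT) ?probability_setT ?mul1r; last first.
    by apply/seteqP; split => // w _ /=; rewrite BT.
  rewrite mulrC; congr (_ * _); apply: eq_bigr => i ii0.
  by rewrite (negbTE ii0).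
have s2 : series (fun k : nat => \int[PP]_(w in A `&` [set w | X w = k%:R%:E]) g w)
    @ \oo --> ex * p *
    (expR (mu i0 * (cos (c i0) - 1)) * cos (mu i0 * sin (c i0) + (th + b))).
  under [X in series X]eq_fun do rewrite term.
  have := @poisson_char_series R (c i0) (th + b) (mu i0).
  move=> /(cvgMr (a := ex * p)).
  apply: cvg_trans; apply: near_eq_cvg; apply: nearW => k.
  by rewrite /series/= mulr_sumr.
rewrite -(cvg_lim _ s1)// (cvg_lim _ s2)// !SP expRD -/ex -/th.
rewrite (_ : th + _ + b = mu i0 * sin (c i0) + (th + b)); last by ring.
ring.
Qed.

End poisson_random_measure.

Import HBSimple HBNNSimple.

Lemma ae_foralln_ord d (T : measurableType d) (R : realType)
    (mu : {measure set T -> \bar R}) n (P : 'I_n -> T -> Prop) :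
  (forall i, {ae mu, forall x, P i x}) -> {ae mu, forall x, forall i, P i x}.
Proof.
move=> H; pose Q (k : nat) x := forall i : 'I_n, i = k :> nat -> P i x.
have HQ k : {ae mu, forall x, Q k x}.
  have [kn|kn] := ltnP k n.
    apply: filterS (H (Ordinal kn)) => x Px i ik.
    by rewrite (_ : i = Ordinal kn)//; exact: val_inj.
  by apply: aeW => x i ik; move: (ltn_ord i); rewrite ik ltnNge kn.
have := ae_foralln HQ; apply: filterS => x Qx i.
exact: (Qx i i erefl).
Qed.

Lemma measurable_cos_comp d (T : measurableType d) (R : realType) (f : T -> R) :
  measurable_fun setT f -> measurable_fun setT (fun x => cos (f x)).
Proof.
move=> mf; apply: (@measurableT_comp _ _ _ _ _ _ (@cos R)) => //.
exact: measurable_cos.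
Qed.

Lemma integrableB_EFin d (T : measurableType d) (R : realType)
    (mu : {measure set T -> \bar R}) (D : set T) (f g : T -> R) : measurable D ->
  mu.-integrable D (EFin \o f) -> mu.-integrable D (EFin \o g) ->
  mu.-integrable D (EFin \o (fun x => f x - g x)).
Proof. by move=> mD fi gi; have := integrableB mD fi gi; apply. Qed.

Section simple_function_levels.
Context (R : realType) dT (T : measurableType dT) (f : {sfun T >-> R}).

(** The value zero is dropped: its level set may have infinite measure even when [f] is integrable,
    and it contributes nothing to [g (f x)] when [g 0 = 0]. *)
Definition levels : seq R := [seq r <- fset_set (range f) | r != 0].

Definition level (i : 'I_(size levels)) : R := nth 0 levels i.

Definition level_set i : set T := f @^-1` [set level i].

Lemma level_neq0 i : level i != 0.
Proof.
by have := mem_nth 0 (ltn_ord i); rewrite mem_filter => /andP[].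
Qed.

Lemma level_in_range i : exists x, f x = level i.
Proof.
have := mem_nth 0 (ltn_ord i); rewrite mem_filter => /andP[_].
by rewrite in_fset_set// inE => -[x _ fx]; exists x.
Qed.

Lemma measurable_level_set i : measurable (level_set i).
Proof. by rewrite /level_set -[X in measurable X]setTI; exact: measurable_funP. Qed.

Lemma trivIset_level_set : trivIset setT level_set.
Proof.
apply/trivIsetP => i j _ _ ij; apply/seteqP; split => // x [/= h1 h2].
have /eqP := etrans (esym h1) h2.
rewrite /level nth_uniq//; last by rewrite filter_uniq// fset_uniq.
by rewrite val_eqE (negbTE ij).
Qed.

Lemma sfun_levelE (g : R -> R) : g 0 = 0 ->
  forall x, g (f x) = \sum_i g (level i) * \1_(level_set i) x.
Proof.
move=> g0 x.
transitivity (\sum_(r <- levels) g r * (f x == r)%:R).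
  have ul : uniq levels by rewrite filter_uniq// fset_uniq.
  have [fx0|fx0] := eqVneq (f x) 0.
    rewrite fx0 g0 big_seq big1// => r; rewrite mem_filter => /andP[r0 _].
    by rewrite eq_sym (negbTE r0) mulr0.
  have fxl : f x \in levels.
    by rewrite mem_filter fx0 in_fset_set//= inE; exists x.
  rewrite (bigD1_seq _ fxl ul)/= eqxx mulr1 big1 ?addr0// => r rf.
  by rewrite eq_sym (negbTE rf) mulr0.
rewrite (big_nth 0) big_mkord; apply: eq_bigr => i _; congr (_ * _).
have -> : (f x == levels`_i) = (x \in level_set i) by apply/eqP/idP; rewrite inE.
by rewrite indicE.
Qed.

Lemma measurable_indic_level_set i :
  measurable_fun setT (fun x => (\1_(level_set i) x)%:E : \bar R).
Proof. exact/measurable_EFinP/measurable_indic/measurable_level_set. Qed.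

Lemma integrable_indic_fin (mu : {measure set T -> \bar R}) (A : set T) :
  measurable A -> (mu A < +oo)%E -> mu.-integrable setT (fun x => (\1_A x)%:E).
Proof.
move=> mA Aoo; apply/integrableP; split; first exact/measurable_EFinP.
by under eq_integral do rewrite gee0_abs ?lee_fin//; rewrite integral_indic// setIT.
Qed.

Lemma Rintegral_sfun_level (mu : {measure set T -> \bar R}) (g : R -> R) :
  g 0 = 0 -> (forall i, (mu (level_set i) < +oo)%E) ->
  \int[mu]_x g (f x) = \sum_i g (level i) * fine (mu (level_set i)).
Proof.
move=> g0 muoo.
under eq_Rintegral do rewrite sfun_levelE//.
rewrite /Rintegral; under eq_integral do rewrite -sumEFin.
rewrite integral_sum//=; last first.
  move=> i; under eq_fun do rewrite EFinM; apply: integrableZl => //.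
  by apply: integrable_indic_fin => //; exact: measurable_level_set.
rewrite -sum_fine//= => [|i _].
  apply: eq_bigr => i _; under eq_integral do rewrite EFinM.
  rewrite integralZl//; last first.
    by apply: integrable_indic_fin => //; exact: measurable_level_set.
  rewrite integral_indic// ?setIT; last exact: measurable_level_set.
  by rewrite fineM// ge0_fin_numE.
under eq_integral do rewrite EFinM.
rewrite integralZl//; last first.
  by apply: integrable_indic_fin => //; exact: measurable_level_set.
rewrite integral_indic// ?setIT; last exact: measurable_level_set.
by rewrite fin_numM// ge0_fin_numE.
Qed.

Lemma integral_sfun_level (mu : {measure set T -> \bar R}) :
  (forall x, 0 <= f x) ->
  (\int[mu]_x (f x)%:E = \sum_i (level i)%:E * mu (level_set i))%E.
Proof.
move=> f0.
have l0 i : 0 <= level i by have [x <-] := level_in_range i.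
under eq_integral do rewrite (@sfun_levelE id)// -sumEFin.
rewrite ge0_integral_sum//=.
- apply: eq_bigr => i _; under eq_integral do rewrite EFinM.
  have mI := @measurable_indic_level_set i.
  rewrite ge0_integralZl ?lee_fin//.
  by rewrite integral_indic// ?setIT//; exact: measurable_level_set.
- move=> i; apply/measurable_EFinP; apply: measurable_funM => //.
  exact/measurable_indic/measurable_level_set.
- by move=> i x _; rewrite lee_fin mulr_ge0.
Qed.

(** Markov's inequality at a nonzero level. *)
Lemma level_set_fin (mu : {measure set T -> \bar R}) i :
  mu.-integrable setT (EFin \o f) -> (mu (level_set i) < +oo)%E.
Proof.
move=> /integrableP[_]; apply: contraTT; rewrite -!leNgt !leye_eq => /eqP muoo.
rewrite -leye_eq.
apply: (@le_trans _ _ (\int[mu]_x (`|level i| * \1_(level_set i) x)%:E)%E).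
  under eq_integral do rewrite EFinM.
  have mI := @measurable_indic_level_set i.
  rewrite ge0_integralZl ?lee_fin//.
  rewrite integral_indic// ?setIT; last exact: measurable_level_set.
  by rewrite muoo gt0_muley// lte_fin normr_gt0 level_neq0.
apply: ge0_le_integral => //=.
- apply/measurable_EFinP; apply: measurable_funM => //.
  exact/measurable_indic/measurable_level_set.
- by apply/measurable_EFinP; apply: measurableT_comp.
- move=> x _; rewrite lee_fin indicE.
  have [|_] := boolP (x \in _); last by rewrite mulr0.
  by rewrite inE /level_set/= => ->; rewrite mulr1.
Qed.

End simple_function_levels.

Section poisson_random_measure_char.
Context (R : realType) dO (Omega : measurableType dO) (PP : probability Omega R).
Context dT (T : measurableType dT).
Variables (N : Omega -> {measure set T -> \bar R}) (m : {measure set T -> \bar R}).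
Hypothesis prm : poisson_random_measure PP N m.

Let mN A (mA : measurable A) : measurable_fun setT (fun w => N w A).
Proof. by case: prm => h _ _; exact: h. Qed.

Lemma measurable_prm_Rintegral (h : T -> R) : measurable_fun setT h ->
  measurable_fun setT (fun w => \int[N w]_x h x).
Proof.
move=> mh; apply: measurableT_comp => //.
under eq_fun do rewrite integralE.
apply: emeasurable_funB.
- apply: measurable_fun_integral_kernel => //; apply: measurable_funepos.
  exact/measurable_EFinP.
- apply: measurable_fun_integral_kernel => //; apply: measurable_funeneg.
  exact/measurable_EFinP.
Qed.

Lemma prm_char_sfun (f : {sfun T >-> R}) a : m.-integrable setT (EFin \o f) ->
  \int[PP]_w cos (\int[N w]_x f x + a) =
  expR (\int[m]_x (cos (f x) - 1)) * cos (\int[m]_x sin (f x) + a).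
Proof.
move=> intf.
have moo i : (m (level_set i) < +oo)%E := level_set_fin i intf.
rewrite (@Rintegral_sfun_level _ _ _ f m (fun y => cos y - 1)) ?cos0 ?subrr//.
rewrite (@Rintegral_sfun_level _ _ _ f m sin) ?sin0//.
have := prm_char_disjoint prm (level (f := f)) a (measurable_level_set (f := f))
  (@trivIset_level_set _ _ _ f) moo.
rewrite -(eq_bigr _ (fun i _ => mulrC (fine (m (level_set i))) (cos (level i) - 1))).
rewrite -(eq_bigr _ (fun i _ => mulrC (fine (m (level_set i))) (sin (level i)))).
move=> <-.
have mX : measurable_fun setT (fun w => \int[N w]_x f x).
  exact: measurable_prm_Rintegral.
have mY : measurable_fun setT
    (fun w => \sum_(i < size (levels f)) level i * fine (N w (level_set i))).
  apply: measurable_sum => i; apply: measurable_funM => //.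
  by apply: measurableT_comp => //; apply: mN; exact: measurable_level_set.
congr fine; apply: ae_eq_integral => //.
- by apply/measurable_EFinP; apply: measurable_cos_comp; exact: measurable_funD.
- by apply/measurable_EFinP; apply: measurable_cos_comp; exact: measurable_funD.
have ae : {ae PP, forall w, forall i, (N w (level_set (f := f) i) < +oo)%E}.
  apply: ae_foralln_ord => i; apply: (prm_finite prm) => //.
  exact: measurable_level_set.
apply: filterS ae => w Nw _.
by rewrite (Rintegral_sfun_level (g := id)).
Qed.

Lemma prm_mean_set A : measurable A -> (m A < +oo)%E ->
  (\int[PP]_w N w A = m A)%E.
Proof.
move=> mA mAoo; have [_ /(_ A) hq _] := prm.
have mNA := mN mA; pose mu := fine (m A).
pose E (k : nat) := [set w | N w A = k%:R%:E].
have mE k : measurable (E k) by exact: (prm_count_level prm).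
have tE : trivIset setT E by exact: trivIset_prm_count.
have mU : measurable (\bigcup_k E k) by exact: bigcupT_measurable.
have P0 : PP (~` \bigcup_k E k) = 0%E by exact: (prm_count_setC prm).
rewrite (@ge0_negligible_integral _ _ _ _ _ (~` \bigcup_k E k))//; last first.
  exact: measurableC.
rewrite setTD setCK ge0_integral_bigcup//; last exact: measurable_funTS.
have -> : m A = mu%:E by rewrite fineK// ge0_fin_numE.
have IE k : (\int[PP]_(w in E k) N w A)%E =
    (k%:R * (mu ^+ k / k`!%:R * expR (- mu)))%:E.
  rewrite EFinM -hq// -integral_cst//; last exact: mE.
  by apply: eq_integral => w; rewrite inE.
rewrite (eq_eseriesr (fun k _ => IE k)).
apply/cvg_lim => //; apply/fine_cvgP; split.
  by apply: nearW => n; rewrite sumEFin.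
have : (fun n => mu * series (fun n => mu ^+ n / n`!%:R * expR (- mu)) n) @ \oo -->
    mu * 1.
  by apply: cvgM; [exact: cvg_cst|exact: poisson_total_mass].
(* The term [k = 0] vanishes and [k mu^k / k! = mu mu^(k-1) / (k-1)!], so the shifted series is [mu]
   times the total mass. *)
rewrite mulr1 => H; rewrite -(cvg_shiftS (_ \o _)).
move: H; apply: cvg_trans; apply: near_eq_cvg; apply: nearW => n /=.
rewrite sumEFin/= /series/= !big_mkord big_ord_recl/= mul0r add0r mulr_sumr.
apply: eq_bigr => i _; rewrite /bump/= add1n factS natrM exprS invfM.
have H (c p v s : R) : c != 0 -> mu * (p * v * s) = c * (mu * p * (c^-1 * v) * s).
  by move=> c0; field.
by apply: H; rewrite pnatr_eq0.
Qed.

Lemma prm_mean_nnsfun (f : {nnsfun T >-> R}) : m.-integrable setT (EFin \o f) ->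
  (\int[PP]_w (\int[N w]_x (f x)%:E) = \int[m]_x (f x)%:E)%E.
Proof.
move=> intf.
have moo i : (m (level_set (f := f) i) < +oo)%E := level_set_fin i intf.
have l0 i : 0 <= level (f := f) i by have [x <-] := level_in_range (f := f) i.
rewrite integral_sfun_level//.
under eq_integral do rewrite integral_sfun_level//.
have mL i : measurable_fun setT (fun w => N w (level_set (f := f) i)).
  by apply: mN; exact: measurable_level_set.
rewrite ge0_integral_sum//=.
- apply: eq_bigr => i _; rewrite ge0_integralZl ?lee_fin//.
  by rewrite prm_mean_set//; exact: measurable_level_set.
- by move=> i; exact: measurable_funeM.
- by move=> i w _; rewrite mule_ge0 ?lee_fin.
Qed.

(** Campbell's formula, by monotone convergence from simple functions in all three integrals. *)
Lemma prm_mean (G : T -> \bar R) : measurable_fun setT G ->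
  (forall x, (0 <= G x)%E) -> (\int[m]_x G x < +oo)%E ->
  (\int[PP]_w (\int[N w]_x G x) = \int[m]_x G x)%E.
Proof.
move=> mG G0 Goo.
pose g := nnsfun_approx measurableT mG.
have ig n : m.-integrable setT (EFin \o g n).
  apply/integrableP; split; first exact/measurable_EFinP.
  apply: le_lt_trans Goo; apply: ge0_le_integral => //.
  - by apply/measurable_EFinP; apply: measurableT_comp.
  - move=> x _; rewrite gee0_abs ?lee_fin//= /g nnsfun_approxE.
    by apply: le_approx => // y _; exact: G0.
have gG x : (g n x)%:E @[n --> \oo] --> G x.
  by apply: cvg_nnsfun_approx => // y _; exact: G0.
have gnd x : nondecreasing_seq (fun n => (g n x)%:E).
  by move=> a b ab; rewrite lee_fin; exact/lefP/nd_nnsfun_approx.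
have mono (mu : {measure set T -> \bar R}) :
    (\int[mu]_x (g n x)%:E)%E @[n --> \oo] --> (\int[mu]_x G x)%E.
  have -> : (\int[mu]_x G x = \int[mu]_x limn (fun n => (g n x)%:E))%E.
    by apply: eq_integral => x _; apply/esym/cvg_lim.
  apply: cvg_monotone_convergence => //.
  - by move=> n; exact/measurable_EFinP.
  - by move=> n x _; rewrite lee_fin.
have mI n : measurable_fun setT (fun w => \int[N w]_x (g n x)%:E)%E.
  apply: measurable_fun_integral_kernel => //.
    by move=> x; rewrite lee_fin.
  exact/measurable_EFinP.
have : (\int[PP]_w \int[N w]_x (g n x)%:E)%E @[n --> \oo] -->
    (\int[PP]_w \int[N w]_x G x)%E.
  have -> : (\int[PP]_w \int[N w]_x G x =
      \int[PP]_w limn (fun n => \int[N w]_x (g n x)%:E))%E.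
    by apply: eq_integral => w _; apply/esym/cvg_lim => //; exact: mono.
  apply: cvg_monotone_convergence => //.
  - by move=> n w _; apply: integral_ge0 => x _; rewrite lee_fin.
  - move=> w _ a b ab; apply: ge0_le_integral => //.
    + by move=> x _; rewrite lee_fin.
    + exact/measurable_EFinP.
    + exact/measurable_EFinP.
    + by move=> x _; exact: gnd.
under eq_fun do rewrite prm_mean_nnsfun//.
by move=> h; apply: (cvg_unique _ h (mono m)).
Qed.

Lemma prm_ae_integrable (h : T -> R) : m.-integrable setT (EFin \o h) ->
  {ae PP, forall w, (N w).-integrable setT (EFin \o h)}.
Proof.
move=> /integrableP[mh hoo].
have mah : measurable_fun setT (fun x => `|(h x)%:E|%E) by exact: measurableT_comp.
have mI : measurable_fun setT (fun w => \int[N w]_x `|(h x)%:E|)%E.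
  exact: measurable_fun_integral_kernel.
have : PP.-integrable setT (fun w => \int[N w]_x `|(h x)%:E|)%E.
  apply/integrableP; split => //.
  under eq_integral do rewrite gee0_abs ?integral_ge0//.
  by rewrite prm_mean.
move=> /integrable_ae -/(_ measurableT); apply: filterS => w /(_ Logic.I) fi.
by apply/integrableP; split => //; rewrite -ge0_fin_numE// integral_ge0.
Qed.

Let char_lhs (h : T -> R) a := \int[PP]_w cos (\int[N w]_x h x + a).

Let mcos (h : T -> R) a : measurable_fun setT h ->
  measurable_fun setT (fun w => cos (\int[N w]_x h x + a)).
Proof.
move=> mh; apply: measurable_cos_comp.
by apply: measurable_funD => //; exact: measurable_prm_Rintegral.
Qed.

(** As [cos] is 1-Lipschitz, the difference is at most the mean of [|N h - N g|], which Campbell's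
    formula bounds by the [L^1] distance of [h] and [g]. *)
Let char_lhs_lipschitz (h g : T -> R) a :
  m.-integrable setT (EFin \o h) -> m.-integrable setT (EFin \o g) ->
  (`|char_lhs h a - char_lhs g a|%:E <= \int[m]_x `|(h x)%:E - (g x)%:E|)%E.
Proof.
move=> ih ig; have /integrableP[/measurable_EFinP mh _] := ih.
have /integrableP[/measurable_EFinP mg _] := ig.
have bcos (k : T -> R) w : `|cos (\int[N w]_x k x + a)| <= 1 by exact: cos_max.
have icos (k : T -> R) : measurable_fun setT k ->
    PP.-integrable setT (EFin \o (fun w => cos (\int[N w]_x k x + a))).
  by move=> mk; apply: (@integrable_bounded _ _ _ _ _ _ 1) => //; exact: mcos.
have idiff : m.-integrable setT (fun x => (h x)%:E - (g x)%:E)%E.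
  exact: integrableB.
have mD : measurable_fun setT (fun x => `|(h x)%:E - (g x)%:E|)%E.
  apply: measurableT_comp => //; exact: (measurable_int _ idiff).
rewrite /char_lhs -RintegralB//; [|exact: icos|exact: icos].
have iB : PP.-integrable setT
    (EFin \o (fun w => cos (\int[N w]_x h x + a) - cos (\int[N w]_x g x + a))).
  by apply: integrableB_EFin => //; exact: icos.
rewrite EFin_normr_Rintegral//.
apply: (le_trans (le_abse_integral _ _ (measurable_int _ iB))) => //.
rewrite -prm_mean//; last by have /integrableP[] := idiff.
apply: ae_ge0_le_integral => //.
- by apply: measurableT_comp => //; exact: (measurable_int _ iB).
- by move=> w _; exact: integral_ge0.
- exact: measurable_fun_integral_kernel.
have [ah ag] := (prm_ae_integrable ih, prm_ae_integrable ig).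
apply: filterS2 ah ag => w ihw igw _.
rewrite abse_EFin.
apply: (@le_trans _ _ (`|\int[N w]_x h x - \int[N w]_x g x|)%:E).
  rewrite lee_fin; apply: (le_trans (cosB_lipschitz _ _)).
  by rewrite opprD addrACA subrr addr0.
rewrite -RintegralB// EFin_normr_Rintegral//; last first.
  exact: integrableB_EFin.
apply: (le_trans (le_abse_integral _ _ _)) => //.
by apply/measurable_EFinP; exact: measurable_funB.
Qed.

Lemma integrable_lipschitz0 (k : R -> R) (h : T -> R) : k 0 = 0 ->
  measurable_fun setT k -> (forall x y, `|k x - k y| <= `|x - y|) ->
  m.-integrable setT (EFin \o h) -> m.-integrable setT (EFin \o (k \o h)).
Proof.
move=> k0 mk kl ih; have /integrableP[/measurable_EFinP mh _] := ih.
apply: (le_integrable measurableT _ _ ih).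
  by apply/measurable_EFinP; exact: measurableT_comp.
by move=> x _; rewrite !abse_EFin lee_fin/=; have := kl (h x) 0; rewrite k0 !subr0.
Qed.

Lemma Rintegral_lipschitz0 (k : R -> R) (h g : T -> R) : k 0 = 0 ->
  measurable_fun setT k -> (forall x y, `|k x - k y| <= `|x - y|) ->
  m.-integrable setT (EFin \o h) -> m.-integrable setT (EFin \o g) ->
  (`|\int[m]_x k (h x) - \int[m]_x k (g x)|%:E <=
    \int[m]_x `|(h x)%:E - (g x)%:E|)%E.
Proof.
move=> k0 mk kl ih ig.
have /integrableP[/measurable_EFinP mh _] := ih.
have /integrableP[/measurable_EFinP mg _] := ig.
have [ikh ikg] := (integrable_lipschitz0 k0 mk kl ih, integrable_lipschitz0 k0 mk kl ig).
have iB : m.-integrable setT (EFin \o (fun x => k (h x) - k (g x))).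
  exact: (integrableB_EFin measurableT ikh ikg).
rewrite -RintegralB// EFin_normr_Rintegral//.
apply: (le_trans (le_abse_integral _ _ (measurable_int _ iB))) => //.
apply: ge0_le_integral => //.
- by apply: measurableT_comp => //; exact: (measurable_int _ iB).
- apply: measurableT_comp => //; apply/measurable_EFinP; exact: measurable_funB.
- by move=> x _; rewrite !abse_EFin lee_fin.
Qed.

(** Both sides are continuous in [h] for the [L^1] distance, because [cos - 1] and [sin] are
    1-Lipschitz and vanish at [0]; integrable simple functions are dense. *)
Lemma prm_char (h : T -> R) a : m.-integrable setT (EFin \o h) ->
  \int[PP]_w cos (\int[N w]_x h x + a) =
  expR (\int[m]_x (cos (h x) - 1)) * cos (\int[m]_x sin (h x) + a).
Proof.
move=> ih; have [g [ig _ gh]] := approximation_sfun_integrable measurableT ih.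
pose e n := (\int[m]_x `|(h x)%:E - (g n x)%:E|)%E.
have e0 : e n @[n --> \oo] --> 0%E := gh.
have efin : \forall n \near \oo, e n \is a fin_num.
  by have /fine_cvgP[] := e0.
have fe0 : fine (e n) @[n --> \oo] --> 0 by have /fine_cvgP[] := e0.
have cvg_of (X : nat -> R) (x : R) :
    (forall n, (`|x - X n|%:E <= e n)%E) -> X n @[n --> \oo] --> x.
  move=> Xe; apply/cvgrPdist_le => eps eps0.
  near=> n; have fn : e n \is a fin_num by near: n.
  rewrite -lee_fin (le_trans (Xe n))// -(fineK fn) lee_fin.
  have : `|0 - fine (e n)| <= eps by near: n; move/cvgrPdist_le: fe0; exact.
  by rewrite sub0r normrN; apply: le_trans; exact: ler_norm.
have c1 : cos (0 : R) - 1 = 0 by rewrite cos0 subrr.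
have cl x y : `|(cos x - 1) - (cos y - 1)| <= `|x - y| :> R.
  by rewrite opprB addrA subrK; exact: cosB_lipschitz.
have mc : measurable_fun setT (fun x : R => cos x - 1).
  by apply: measurable_funB => //; exact: measurable_cos.
have L : char_lhs (g n) a @[n --> \oo] --> char_lhs h a.
  by apply: cvg_of => n; apply: char_lhs_lipschitz => //; exact: ig.
have C : (\int[m]_x (cos (g n x) - 1)) @[n --> \oo] --> \int[m]_x (cos (h x) - 1).
  by apply: cvg_of => n; apply: (Rintegral_lipschitz0 c1 mc cl ih (ig n)).
have S : (\int[m]_x sin (g n x)) @[n --> \oo] --> \int[m]_x sin (h x).
  apply: cvg_of => n.
  exact: (Rintegral_lipschitz0 (@sin0 R) (@measurable_sin R) (@sinB_lipschitz R) ih (ig n)).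
have Rc : expR (\int[m]_x (cos (g n x) - 1)) * cos (\int[m]_x sin (g n x) + a)
    @[n --> \oo] -->
    expR (\int[m]_x (cos (h x) - 1)) * cos (\int[m]_x sin (h x) + a).
  apply: cvgM.
    by apply: continuous_cvg => //; exact: continuous_expR.
  apply: continuous_cvg; first exact: continuous_cos.
  by apply: cvgD => //; exact: cvg_cst.
apply: (cvg_unique _ L) => //=.
by under eq_fun do rewrite /char_lhs prm_char_sfun//.
Unshelve. all: by end_near. Qed.

End poisson_random_measure_char.

(** * Weak convergence from characteristic functions *)

Section trigonometric_polynomials.
Context (R : realType) (n : nat).
Local Notation vec := ('I_n -> R).

(** The phase [a] covers sines, so the class is an algebra. As an inductive predicate it reduces
    convergence of expectations to the single cosines of [char_cvg]. *)
Inductive trig_poly : (vec -> R) -> Prop :=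
| TrigCos (c a : R) (t : vec) :
    trig_poly (fun v => c * cos (\sum_i t i * v i + a))
| TrigAdd h k : trig_poly h -> trig_poly k -> trig_poly (fun v => h v + k v).

Lemma trig_polyE h k : h =1 k -> trig_poly h -> trig_poly k.
Proof. by move=> /funext ->. Qed.

Lemma trig_poly_cst c : trig_poly (fun=> c).
Proof.
apply: trig_polyE (TrigCos c 0 (fun=> 0)) => v.
by rewrite big1 ?addr0 ?cos0 ?mulr1// => i _; rewrite mul0r.
Qed.

Lemma trig_polyM h k : trig_poly h -> trig_poly k ->
  trig_poly (fun v => h v * k v).
Proof.
move=> th tk; elim: th => [c a t|h1 h2 _ IH1 _ IH2]; last first.
  by apply: trig_polyE (TrigAdd IH1 IH2) => v; rewrite mulrDl.
elim: tk => [c' a' t'|k1 k2 _ IH1 _ IH2]; last first.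
  by apply: trig_polyE (TrigAdd IH1 IH2) => v; rewrite mulrDr.
apply: trig_polyE (TrigAdd
  (TrigCos (c * c' / 2) (a + a') (fun i => t i + t' i))
  (TrigCos (c * c' / 2) (a - a') (fun i => t i - t' i))) => v.
set A := \sum_i t i * v i; set B := \sum_i t' i * v i.
have -> : \sum_i (t i + t' i) * v i + (a + a') = (A + a) + (B + a').
  rewrite (_ : \sum_i _ = A + B); first by ring.
  by rewrite -big_split; apply: eq_bigr => i _; rewrite mulrDl.
have -> : \sum_i (t i - t' i) * v i + (a - a') = (A + a) - (B + a').
  rewrite (_ : \sum_i _ = A - B); first by ring.
  by rewrite -sumrB; apply: eq_bigr => i _; rewrite mulrBl.
by rewrite cosD cosB; field.
Qed.

Lemma trig_poly_bounded h : trig_poly h -> exists B, forall v, `|h v| <= B.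
Proof.
elim=> [c a t|h1 h2 _ [B1 b1] _ [B2 b2]].
  by exists `|c| => v; rewrite normrM ler_piMr// cos_max.
by exists (B1 + B2) => v; rewrite (le_trans (ler_normD _ _))// lerD.
Qed.

Lemma measurable_trig_poly dO (Omega : measurableType dO) (X : Omega -> vec) h :
  (forall i, measurable_fun setT (fun w => X w i)) -> trig_poly h ->
  measurable_fun setT (fun w => h (X w)).
Proof.
move=> mX; elim=> [c a t|h1 h2 _ m1 _ m2]; last exact: measurable_funD.
apply: measurable_funM => //; apply: measurable_cos_comp.
apply: measurable_funD => //; apply: measurable_sum => i.
exact: measurable_funM.
Qed.

End trigonometric_polynomials.

(** * Bernstein polynomials in several variables *)

Section bernstein_operator.
Context (R : realType) (n : nat).
Local Notation vec := ('I_n -> R).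
Implicit Types (l : seq 'I_n) (phi psi : ('I_n -> nat) -> R) (s : vec).

Definition incr_at (i : 'I_n) (k : 'I_n -> nat) : 'I_n -> nat :=
  fun j => ((j == i) + k j)%N.

(* The mean of [phi] at the vector counting, for each coordinate, the successes
   in independent trials indexed by [l], a trial at [i] having success
   probability [s i]: the multivariate Bernstein polynomial. *)
Fixpoint bernstein l phi s : R :=
  if l is i :: l' then
    s i * bernstein l' (phi \o incr_at i) s + (1 - s i) * bernstein l' phi s
  else phi (fun=> 0%N).

Definition unit_vec s := forall i, 0 <= s i <= 1.

Lemma bernstein_cst l c s : bernstein l (fun=> c) s = c.
Proof.
elim: l => //= i l; rewrite (_ : (fun=> c) \o _ = fun=> c)// => ->.
by rewrite -mulrDl addrC subrK mul1r.
Qed.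

Lemma bernsteinD l phi psi s :
  bernstein l (fun k => phi k + psi k) s = bernstein l phi s + bernstein l psi s.
Proof.
elim: l phi psi => //= i l IH phi psi.
rewrite (_ : (fun k => phi k + psi k) \o _ =
  (fun k => (phi \o incr_at i) k + (psi \o incr_at i) k))// !IH; ring.
Qed.

Lemma bernsteinZ l c phi s :
  bernstein l (fun k => c * phi k) s = c * bernstein l phi s.
Proof.
elim: l phi => //= i l IH phi.
rewrite (_ : (fun k => c * phi k) \o _ = (fun k => c * (phi \o incr_at i) k))//.
by rewrite !IH; ring.
Qed.

Lemma bernstein_sum l (I : Type) (r : seq I) (phi : I -> ('I_n -> nat) -> R) s :
  bernstein l (fun k => \sum_(i <- r) phi i k) s =
  \sum_(i <- r) bernstein l (phi i) s.
Proof.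
elim: r => [|i r IH].
  by under eq_fun do rewrite big_nil; rewrite bernstein_cst big_nil.
by under eq_fun do rewrite big_cons; rewrite bernsteinD IH big_cons.
Qed.

(** Positivity: on the unit cube the operator averages with nonnegative weights, and it only reaches
    counts not exceeding the numbers of trials. *)
Lemma bernstein_le l phi psi s : unit_vec s ->
  (forall k, (forall i, k i <= count_mem i l)%N -> phi k <= psi k) ->
  bernstein l phi s <= bernstein l psi s.
Proof.
move=> s01; elim: l phi psi => [|i l IH] phi psi pp /=; first exact: pp.
have /andP[s0 s1] := s01 i.
apply: lerD; apply: ler_wpM2l => //; rewrite ?subr_ge0//; apply: IH => k kl.
  by apply: pp => j; rewrite /incr_at eq_sym leq_add2l; exact: kl.
by apply: pp => j; rewrite (leq_trans (kl j))// leq_addl.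
Qed.

(** The second moment of a shifted, centred binomial count. The shift [c] is the induction
    parameter: a trial at [i] turns it into [c + 1 - s i] or [c - s i]. *)
Lemma bernstein_variance l i c s :
  bernstein l (fun k => ((k i)%:R + c - (count_mem i l)%:R * s i) ^+ 2) s =
  (count_mem i l)%:R * (s i * (1 - s i)) + c ^+ 2.
Proof.
elim: l c => [|j l IH] c /=; first by ring.
have [->|ji] := eqVneq j i.
  have E1 := IH (c + 1 - s i); have E2 := IH (c - s i).
  transitivity (s i * bernstein l (fun k => ((k i)%:R + (c + 1 - s i) -
      (count_mem i l)%:R * s i) ^+ 2) s + (1 - s i) *
      bernstein l (fun k => ((k i)%:R + (c - s i) -
      (count_mem i l)%:R * s i) ^+ 2) s).
    congr (_ * bernstein l _ s + _ * bernstein l _ s); apply/funext => k /=.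
      by rewrite /incr_at eqxx !add1n -!natr1; ring.
    by rewrite add1n -natr1; ring.
  by rewrite E1 E2 add1n -natr1; ring.
rewrite add0n; transitivity (s j * bernstein l (fun k => ((k i)%:R + c -
      (count_mem i l)%:R * s i) ^+ 2) s + (1 - s j) *
      bernstein l (fun k => ((k i)%:R + c -
      (count_mem i l)%:R * s i) ^+ 2) s); last by rewrite IH; ring.
congr (_ * bernstein l _ s + _); apply/funext => k /=.
by rewrite /incr_at eq_sym (negbTE ji).
Qed.

Lemma trig_poly_bernstein l phi (s : vec -> vec) :
  (forall i, trig_poly (fun v => s v i)) ->
  trig_poly (fun v => bernstein l phi (s v)).
Proof.
move=> ts; elim: l phi => [|i l IH] phi /=; first exact: trig_poly_cst.
apply: TrigAdd; apply: trig_polyM => //.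
apply: trig_polyE (TrigAdd (trig_poly_cst _ 1)
  (trig_polyM (trig_poly_cst _ (-1)) (ts i))) => v.
by rewrite mulN1r.
Qed.

End bernstein_operator.

Section trigonometric_approximation.
Context (R : realType) (n : nat).
Local Notation vec := ('I_n -> R).

(** The sine is flat at the ends of the interval, but [b] stays away from them. As [pi / 2 < 2],
    half-sum [y] and half-difference [z] are at most [5 / 4], where [cos y >= 1 - 25 / 32 = 7 / 32]
    and [|sin z| >= (1 - 25 / 96) |z|]; the product of the two constants exceeds [1 / 10]. *)
Lemma sin_expansive (a b : R) : - (pi / 2) <= a <= pi / 2 -> `|b| <= 2^-1 ->
  `|a - b| <= 10 * `|sin a - sin b|.
Proof.
move=> /andP[a1 a2]; rewrite ler_norml => /andP[b1 b2].
have p2 : pi / 2 < 2 :> R := pihalf_lt2 R.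
pose z := (a - b) / 2; pose y := (a + b) / 2.
have za : a = y + z by rewrite /y /z; field.
have zb : b = y - z by rewrite /y /z; field.
have -> : sin a - sin b = 2 * cos y * sin z.
  by rewrite za zb sinD sinB; ring.
have y1 : `|y| <= 5 / 4 by rewrite ler_norml /y; apply/andP; split; lra.
have z1 : `|z| <= 5 / 4 by rewrite ler_norml /z; apply/andP; split; lra.
have cy : 7 / 32 <= cos y.
  have := cos_ge_quadratic y.
  by move: y1; rewrite ler_norml => /andP[]; nra.
have sz : 71 / 96 * `|z| <= `|sin z|.
  have := normr_sinB_id_cubic z.
  have : `|z| <= `|sin z| + `|sin z - z|.
    by rewrite -[X in `|X| <= _](subKr (sin z)) (le_trans (ler_normB _ _)).
  have z0 := normr_ge0 z.
  have : `|z| ^+ 3 <= 25 / 16 * `|z|.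
    rewrite exprSr; apply: ler_wpM2r => //; nra.
  lra.
have -> : `|a - b| = 2 * `|z|.
  by rewrite /z normrM (ger0_norm (_ : 0 <= 2^-1))//; field.
have -> : `|2 * cos y * sin z| = 2 * (cos y * `|sin z|).
  by rewrite !normrM (ger0_norm (_ : 0 <= 2))// (ger0_norm (_ : 0 <= cos y)) ?mulrA//; lra.
have z0 := normr_ge0 z.
have : 7 / 32 * (71 / 96 * `|z|) <= cos y * `|sin z|.
  by apply: ler_pM => //; rewrite ?mulr_ge0//; lra.
lra.
Qed.

(** Only [x] is confined to the box: the nodes at which [f] is sampled later may lie outside. *)
Lemma unif_continuous_box (f : 'rV[R]_n -> R) (M e : R) : continuous f ->
  0 < e -> exists2 delta, 0 < delta & forall x y : 'rV[R]_n,
    (forall i, `|x 0 i| <= M) -> (forall i, `|x 0 i - y 0 i| <= delta) ->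
    `|f x - f y| <= e.
Proof.
move=> cf e0.
have cK : compact [set v : 'rV[R]_n | forall i, `[- M, M]%classic (v ord0 i)].
  by apply: (@rV_compact _ _ (fun=> `[- M, M]%classic)) => i; exact: segment_compact.
have /compact_near_coveringP nc := cK.
have := nc R (0^'+) (fun delta x => forall y : 'rV[R]_n,
    (forall i, `|x 0 i - y 0 i| <= delta) -> `|f x - f y| <= e) _.
case=> [x _|delta /= delta0 H]; last first.
  near (0 : R)^'+ => dd.
  exists dd => //.
  move=> x y xM; apply: (H dd _ _ x) => //; last first.
    by move=> i /=; rewrite in_itv/= -ler_norml.
  near: dd; exists delta => //.
have e2 : 0 < e / 2 by rewrite divr_gt0.
have /cvgrPdist_lt/(_ _ e2) := cf x.
rewrite -nbhs_ballE => -[r r0 Hr].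
exists (ball x (r / 2), [set delta | 0 < delta < r / 2]).
  split => /=.
    by apply: nbhsx_ballx; rewrite divr_gt0.
  exists (r / 2) => /=; first by rewrite divr_gt0.
  by move=> z /=; rewrite sub0r normrN => zr z0; rewrite z0/= -(gtr0_norm z0).
move=> [x' dd] [/= bx' /andP[dd0 ddr]] y xy.
have fx' : `|f x - f x'| < e / 2.
  apply: Hr; apply: le_ball bx'; lra.
have fy : `|f x - f y| < e / 2.
  apply: Hr; rewrite (splitr r); apply: (ball_triangle bx').
  split => [|i j]; first by rewrite divr_gt0.
  rewrite (ord1 i) /ball/= (le_lt_trans (xy j))//.
rewrite (_ : f x' - f y = (f x - f y) - (f x - f x')); last by ring.
rewrite (le_trans (ler_normB _ _))// [leRHS]splitr.
by rewrite lerD// ltW.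
Unshelve. all: by end_near. Qed.

(** Bernstein polynomials of [f] in the variables [(1 + sin (v_i / L)) / 2]. Positivity yields the
    bound [B] for all [v]; accuracy holds on the box, where the sine can be inverted. *)
Lemma trig_poly_approx (f : 'rV[R]_n -> R) (B M e : R) : continuous f ->
  (forall v, `|f v| <= B) -> 0 < M -> 0 < e ->
  exists2 p, trig_poly p & (forall v : vec, `|p v| <= B) /\
    (forall v : vec, (forall i, `|v i| <= M) -> `|f (\row_i v i) - p v| <= e).
Proof.
move=> cf fB M0 e0.
have B0 : 0 <= B by apply: le_trans (fB 0); exact: normr_ge0.
have e2 : 0 < e / 2 by rewrite divr_gt0.
have [delta d0 fd] := unif_continuous_box M cf e2.
(* On the box the angles [v i / L] then stay within [1 / 2], as [sin_expansive] requires. *)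
pose L := 2 * M.
have L0 : 0 < L by rewrite /L; lra.
(* By [sin_expansive], a node farther than [delta] from [v] in some coordinate satisfies
   [1 <= A * (y k i - sin (v i / L)) ^ 2] there. *)
pose A := (10 * L / delta) ^+ 2.
have A0 : 0 <= A by rewrite sqr_ge0.
have BA0 : 0 <= 2 * B * A by apply: mulr_ge0 => //; lra.
(* [K] is the number of trials per coordinate; each coordinate contributes a mean square deviation
   of at most [1 / K]. *)
have [K K0 hK] : exists2 K, (0 < K)%N & 2 * B * A * n%:R * K%:R^-1 <= e / 2.
  pose C := 2 * B * A * n%:R.
  have C0 : 0 <= C by apply: mulr_ge0.
  exists (Num.truncn (C / (e / 2))).+1 => //.
  rewrite -/C ler_pdivrMr ?ltr0n// [leRHS]mulrC -ler_pdivrMr//.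
  by rewrite ltW// truncnS_gt.
pose l := flatten (nseq K (enum 'I_n)).
have cl i : count_mem i l = K.
  rewrite /l; elim: (K) => //= k IH; rewrite count_cat IH.
  by rewrite count_uniq_mem ?enum_uniq// mem_enum.
pose s (v : vec) : vec := fun i => (1 + sin (v i / L)) / 2.
have s01 v : unit_vec (s v).
  move=> i; have := sin_geN1 (v i / L); have := sin_le1 (v i / L).
  by rewrite /s => h1 h2; apply/andP; split; lra.
(* The value of the sine for which the success probability equals the observed frequency
   [k i / K]. *)
pose y (k : 'I_n -> nat) i : R := 2 * (k i)%:R / K%:R - 1.
pose node k : 'rV[R]_n := \row_i (L * asin (y k i)).
exists (fun v => bernstein l (f \o node) (s v)).
  apply: trig_poly_bernstein => i.
  apply: trig_polyE (TrigAdd (trig_poly_cst _ 2^-1)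
    (TrigCos 2^-1 (- (pi / 2)) (fun j => (j == i)%:R / L))) => v.
  rewrite (bigD1 i)//= eqxx big1 ?addr0 => [|j ji]; last by rewrite (negbTE ji) !mul0r.
  by rewrite cosBpihalf /s mulrC mul1r (mulrC L^-1); field.
split=> [v|v vM].
  rewrite ler_norml; apply/andP; split.
    rewrite -[X in X <= _](bernstein_cst l _ (s v)); apply: bernstein_le => // k _ /=.
    by have := fB (node k); rewrite ler_norml => /andP[].
  rewrite -[X in _ <= X](bernstein_cst l _ (s v)); apply: bernstein_le => // k _ /=.
  by have := fB (node k); rewrite ler_norml => /andP[].
have K0' : 0 < K%:R :> R by rewrite ltr0n.
(* A majorant of the error at every node: uniform continuity gives [e / 2] at close nodes, and at
   distant ones the trivial bound [2 * B] is multiplied by a factor that is at least one. *)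
pose T k := e / 2 + 2 * B * A * \sum_i (y k i - sin (v i / L)) ^+ 2.
have key k : (forall i, k i <= count_mem i l)%N ->
    `|f (\row_i v i) - f (node k)| <= T k.
  move=> kl.
  have S0 : 0 <= \sum_i (y k i - sin (v i / L)) ^+ 2.
    by apply: sumr_ge0 => i _; rewrite sqr_ge0.
  have yk i : -1 <= y k i <= 1.
    have k1 : (k i)%:R / K%:R <= 1 :> R.
      by rewrite ler_pdivrMr// mul1r ler_nat -(cl i).
    have k0 : 0 <= (k i)%:R / K%:R :> R by rewrite divr_ge0.
    by rewrite /y -mulrA; apply/andP; split; lra.
  have nb i : `|v i - node k 0 i| <= 10 * L * `|y k i - sin (v i / L)|.
    have -> : v i - node k 0 i = - (L * (asin (y k i) - v i / L)).
      by rewrite mxE; field; lra.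
    rewrite normrN normrM (gtr0_norm L0) (mulrC 10 L) -(mulrA L 10).
    apply: ler_wpM2l; first exact: ltW.
    have yin : y k i \in `[(-1), 1] by rewrite in_itv/=; exact: yk.
    rewrite -[in X in _ <= X](asinK yin).
    apply: sin_expansive; first by rewrite asin_geNpi2// asin_lepi2.
    rewrite normrM normfV (gtr0_norm L0) ler_pdivrMr// /L mulrA mulVf// mul1r.
    exact: vM.
  have [far|] := pselect (forall i, `|v i - node k 0 i| <= delta).
    apply: (@le_trans _ _ (e / 2)); last by rewrite /T lerDl; apply: mulr_ge0.
    by apply: fd => [i|i]; rewrite mxE//; exact: far.
  move=> /existsNP[i /negP]; rewrite -ltNge => far.
  apply: (@le_trans _ _ (2 * B)).
    rewrite (le_trans (ler_normB _ _))// mulr_natl mulr2n lerD//.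
  rewrite /T -mulrA; apply: (@le_trans _ _ (0 + 2 * B * (A * \sum_i (y k i - sin (v i / L)) ^+ 2))); last first.
    by rewrite lerD2r ltW.
  rewrite add0r ler_peMr//; first by apply: mulr_ge0.
  have h : 1 <= A * (y k i - sin (v i / L)) ^+ 2.
    have := lt_le_trans far (nb i).
    move=> /ltW h.
    have h2 : 1 <= (10 * L / delta * `|y k i - sin (v i / L)|) ^+ 2.
      by apply: exprn_ege1; rewrite mulrAC ler_pdivlMr// mul1r.
    by rewrite /A; move: h2; rewrite exprMn real_normK ?num_real.
  apply: (le_trans h); apply: ler_wpM2l => //.
  by rewrite (bigD1 i)//= lerDl sumr_ge0// => j _; rewrite sqr_ge0.
have bT : bernstein l T (s v) <= e.
  rewrite /T bernsteinD bernstein_cst bernsteinZ bernstein_sum.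
  rewrite [leRHS]splitr lerD2l.
  apply: (@le_trans _ _ (2 * B * A * \sum_(i < n) K%:R^-1)).
    apply: ler_wpM2l => //.
    apply: ler_sum => i _.
    rewrite (_ : (fun k => _) = (fun k => (4 / K%:R ^+ 2) *
       ((k i)%:R + 0 - (count_mem i l)%:R * s v i) ^+ 2)); last first.
      by apply/funext => k; rewrite /y /s cl; field; lra.
    rewrite bernsteinZ bernstein_variance cl expr0n addr0.
    have -> : 4 / K%:R ^+ 2 * (K%:R * (s v i * (1 - s v i))) =
        K%:R^-1 * (4 * (s v i * (1 - s v i))) by field; lra.
    rewrite ler_piMr ?invr_ge0//.
    by have := sqr_ge0 (2 * s v i - 1); nra.
  by rewrite sumr_const card_ord -[_ *+ n]mulr_natl mulrA.
have lin : f (\row_i v i) - bernstein l (f \o node) (s v) =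
    bernstein l (fun k => f (\row_i v i) + (-1) * f (node k)) (s v).
  by rewrite bernsteinD bernstein_cst bernsteinZ mulN1r.
rewrite lin (le_trans _ bT)// ler_norml.
have Tneg : - bernstein l T (s v) = bernstein l (fun k => (-1) * T k) (s v).
  by rewrite bernsteinZ mulN1r.
rewrite Tneg; apply/andP; split; apply: bernstein_le => // k /key;
  by rewrite ler_norml !mulN1r => /andP[].
Qed.

End trigonometric_approximation.

(** * From trigonometric polynomials to bounded continuous functions *)

Section weak_convergence.
Context (R : realType) (n : nat).
Context dO (Omega : measurableType dO) (PP : probability Omega R).
Context dO' (Omega' : measurableType dO') (PP' : probability Omega' R).
Variables (X : R -> Omega -> 'I_n -> R) (Z : Omega' -> 'I_n -> R).
Hypothesis mX : forall u, 0 < u -> forall i, measurable_fun setT (fun w => X u w i).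
Hypothesis mZ : forall i, measurable_fun setT (fun w => Z w i).
Hypothesis char_cvg : forall (t : 'I_n -> R) a,
  \int[PP]_w cos (\sum_i t i * X u w i + a) @[u --> +oo] -->
  \int[PP']_w cos (\sum_i t i * Z w i + a).

Lemma trig_poly_cvg h : trig_poly h ->
  \int[PP]_w h (X u w) @[u --> +oo] --> \int[PP']_w h (Z w).
Proof.
elim=> [c a t|g k th IHh tk IHk].
  have mc dT (T : measurableType dT) (Y : T -> 'I_n -> R) :
      (forall i, measurable_fun setT (fun w => Y w i)) ->
      measurable_fun setT (fun w => cos (\sum_i t i * Y w i + a)).
    move=> mY; apply: measurable_cos_comp; apply: measurable_funD => //.
    by apply: measurable_sum => i; exact: measurable_funM.
  rewrite RintegralZl//; last first.
    by apply: (@integrable_bounded _ _ _ _ _ _ 1) => //; [exact: mc|move=> w; exact: cos_max].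
  have : c * (\int[PP]_w cos (\sum_i t i * X u w i + a)) @[u --> +oo] -->
      c * \int[PP']_w cos (\sum_i t i * Z w i + a).
    by apply: cvgM; [exact: cvg_cst|exact: char_cvg].
  apply: cvg_trans; apply: near_eq_cvg; near=> u.
  rewrite RintegralZl//; apply: (@integrable_bounded _ _ _ _ _ _ 1) => //.
    by apply: mc; apply: mX.
  by move=> w; exact: cos_max.
have [Bh bh] := trig_poly_bounded th; have [Bk bk] := trig_poly_bounded tk.
rewrite RintegralD//; last 2 first.
- by apply: (@integrable_bounded _ _ _ _ _ _ Bh) => //; exact: measurable_trig_poly.
- by apply: (@integrable_bounded _ _ _ _ _ _ Bk) => //; exact: measurable_trig_poly.
have : \int[PP]_w g (X u w) + \int[PP]_w k (X u w) @[u --> +oo] -->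
    \int[PP']_w g (Z w) + \int[PP']_w k (Z w) by exact: cvgD.
apply: cvg_trans; apply: near_eq_cvg; near=> u.
rewrite /= RintegralD//.
- apply: (@integrable_bounded _ _ _ _ _ _ Bh) => //.
  by apply: measurable_trig_poly => //; apply: mX.
- apply: (@integrable_bounded _ _ _ _ _ _ Bk) => //.
  by apply: measurable_trig_poly => //; apply: mX.
Unshelve. all: by end_near. Qed.

(** The composite is the pointwise limit of trigonometric polynomials within [1 / (k + 1)] of [f] on
    the box of radius [k + 1], so no sigma-algebra on row vectors is involved. *)
Lemma measurable_bounded_continuous_row dT (T : measurableType dT)
    (Y : T -> 'I_n -> R) (f : 'rV[R]_n -> R) (B : R) :
  continuous f -> (forall v, `|f v| <= B) ->
  (forall i, measurable_fun setT (fun w => Y w i)) ->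
  measurable_fun setT (fun w => f (\row_i Y w i)).
Proof.
move=> cf fB mY.
have H (k : nat) : exists p, trig_poly p /\ (forall v : 'I_n -> R,
    (forall i, `|v i| <= k.+1%:R) -> `|f (\row_i v i) - p v| <= k.+1%:R^-1).
  have [//|//|p tp [_ hp]] := @trig_poly_approx R n f B k.+1%:R k.+1%:R^-1 cf fB.
  by exists p.
have [p hp] := choice H.
apply: (@measurable_fun_cvg _ _ _ setT (fun k w => p k (Y w))).
  by move=> k; apply: measurable_trig_poly => //; have [] := hp k.
move=> w _; apply/cvgrPdist_le => e e0.
near=> k; have [_ hpk] := hp k.
apply: (@le_trans _ _ k.+1%:R^-1).
  apply: hpk => i; apply: (@le_trans _ _ (\sum_j `|Y w j|)).
    by rewrite (bigD1 i)//= lerDl sumr_ge0.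
  apply: (@le_trans _ _ k%:R); last by rewrite ler_nat.
  by near: k; exact: nbhs_infty_ger.
by apply/ltW; near: k; exact: (near_infty_natSinv_lt (PosNum e0)).
Unshelve. all: by end_near. Qed.

Hypothesis X2 : exists2 C, 0 <= C & forall u, 1 <= u -> forall i,
  (\int[PP]_w (X u w i ^+ 2)%:E <= C%:E)%E.
Hypothesis Z2 : exists2 C, 0 <= C & forall i,
  (\int[PP']_w (Z w i ^+ 2)%:E <= C%:E)%E.

(** Chebyshev: outside the box the functions differ by at most [2 B], hence by at most [2 B / M ^ 2]
    times the sum of the squared coordinates. *)
Let approx_error dT (T : measurableType dT) (mu : probability T R)
    (Y : T -> 'I_n -> R) (f : 'rV[R]_n -> R) (p : ('I_n -> R) -> R) (B M e C : R) :
  0 < M -> 0 <= e -> 0 <= B -> 0 <= C ->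
  (forall i, measurable_fun setT (fun w => Y w i)) ->
  (forall i, (\int[mu]_w (Y w i ^+ 2)%:E <= C%:E)%E) ->
  measurable_fun setT (fun w => f (\row_i Y w i)) -> trig_poly p ->
  (forall v, `|f v| <= B) -> (forall v, `|p v| <= B) ->
  (forall v : 'I_n -> R, (forall i, `|v i| <= M) -> `|f (\row_i v i) - p v| <= e) ->
  `|\int[mu]_w f (\row_i Y w i) - \int[mu]_w p (Y w)| <= e + 2 * B * n%:R * C / M ^+ 2.
Proof.
move=> M0 e0 B0 C0 mY Y2 mf tp fB pB fp.
have mp : measurable_fun setT (fun w => p (Y w)) by exact: measurable_trig_poly.
have if_ : mu.-integrable setT (EFin \o (fun w => f (\row_i Y w i))).
  exact: (@integrable_bounded _ _ _ _ _ _ B).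
have ip : mu.-integrable setT (EFin \o (fun w => p (Y w))).
  exact: (@integrable_bounded _ _ _ _ _ _ B).
rewrite -RintegralB// -lee_fin EFin_normr_Rintegral//; last exact: integrableB_EFin.
have mfp : measurable_fun setT (fun w => f (\row_i Y w i) - p (Y w)).
  exact: measurable_funB.
apply: (le_trans (le_abse_integral _ _ _)) => //; first exact/measurable_EFinP.
pose D := 2 * B / M ^+ 2.
have D0 : 0 <= D by rewrite /D divr_ge0 ?sqr_ge0// mulr_ge0.
have mY2 i : measurable_fun setT (fun w => (Y w i ^+ 2)%:E).
  by apply/measurable_EFinP; exact: measurable_funX.
have mS : measurable_fun setT (fun w => \sum_(i < n) (Y w i ^+ 2)%:E)%E.
  exact: emeasurable_sum.
apply: (@le_trans _ _ (\int[mu]_w (e%:E + D%:E * \sum_(i < n) (Y w i ^+ 2)%:E))%E).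
  apply: ge0_le_integral => //.
  - by apply: measurableT_comp => //; exact/measurable_EFinP.
  - by apply: emeasurable_funD => //; exact: measurable_funeM.
  move=> w _; rewrite abse_EFin sumEFin -EFinM -EFinD lee_fin.
  have S0 : 0 <= \sum_(i < n) Y w i ^+ 2 by apply: sumr_ge0 => i _; exact: sqr_ge0.
  have [near|] := pselect (forall i, `|Y w i| <= M).
    by rewrite (le_trans (fp _ near))// lerDl mulr_ge0.
  move=> /existsNP[i /negP]; rewrite -ltNge => far.
  apply: (@le_trans _ _ (0 + 2 * B)).
    by rewrite add0r (le_trans (ler_normB _ _))// mulr_natl mulr2n lerD.
  apply: lerD => //; rewrite (_ : 2 * B = D * M ^+ 2); last first.
    by rewrite /D divfK// gt_eqF// exprn_gt0.
  apply: ler_wpM2l => //.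
  apply: (@le_trans _ _ (Y w i ^+ 2)).
    by rewrite -(real_normK (num_real (Y w i))) ler_pXn2r ?nnegrE// ?ltW.
  by rewrite (bigD1 i)//= lerDl sumr_ge0// => j _; exact: sqr_ge0.
rewrite ge0_integralD//=; last 2 first.
- move=> w _; apply: mule_ge0; rewrite ?lee_fin//.
  by apply: sume_ge0 => i _; rewrite lee_fin sqr_ge0.
- exact: measurable_funeM.
have -> : (\int[mu]__ e%:E = e%:E)%E.
  by rewrite integral_cst//= probability_setT mule1.
rewrite EFinD leeD2l//.
rewrite ge0_integralZl ?lee_fin//; last first.
  by move=> w _; apply: sume_ge0 => i _; rewrite lee_fin sqr_ge0.
rewrite ge0_integral_sum//; last by move=> i w _; rewrite lee_fin sqr_ge0.
apply: (@le_trans _ _ (D%:E * \sum_(i < n) C%:E)%E).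
  by apply: lee_wpmul2l; rewrite ?lee_fin//; apply: lee_sum => i _.
rewrite sumEFin -EFinM lee_fin sumr_const card_ord -[C *+ n]mulr_natl /D.
by rewrite le_eqVlt; apply/orP; left; apply/eqP; field; lra.
Qed.

Lemma weak_cvg_of_char_cvg (f : 'rV[R]_n -> R) : continuous f ->
  (exists M : R, forall z, `|f z| <= M) ->
  (\int[PP]_w (f (\row_i X u w i))%:E)%E @[u --> +oo] -->
  (\int[PP']_w (f (\row_i Z w i))%:E)%E.
Proof.
move=> cf [B fB].
have B0 : 0 <= B by apply: le_trans (fB 0); exact: normr_ge0.
have [CX CX0 hX] := X2; have [CZ CZ0 hZ] := Z2.
have mfX u : 0 < u -> measurable_fun setT (fun w => f (\row_i X u w i)).
  move=> u0; apply: (@measurable_bounded_continuous_row _ _ _ _ B) => //.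
  exact: mX.
have mfZ : measurable_fun setT (fun w => f (\row_i Z w i)).
  exact: (@measurable_bounded_continuous_row _ _ _ _ B).
have iX u : 0 < u -> PP.-integrable setT (EFin \o (fun w => f (\row_i X u w i))).
  by move=> u0; apply: (@integrable_bounded _ _ _ _ _ _ B) => //; exact: mfX.
have iZ : PP'.-integrable setT (EFin \o (fun w => f (\row_i Z w i))).
  exact: (@integrable_bounded _ _ _ _ _ _ B).
suff H : \int[PP]_w (f (\row_i X u w i)) @[u --> +oo] --> \int[PP']_w (f (\row_i Z w i)).
  rewrite -[X in _ --> X]fineK; last exact: integrable_fin_num.
  apply/fine_cvgP; split => //; near=> u.
  by apply: integrable_fin_num => //; apply: iX.
apply/cvgrPdist_le => e e0.
pose C := Num.max CX CZ.
have C0 : 0 <= C by rewrite le_max CX0.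
pose D := 2 * B * n%:R * C.
have D0 : 0 <= D by rewrite /D !mulr_ge0.
have e8 : 0 < e / 8 by rewrite divr_gt0.
(* Since [M >= 1], [D / M ^ 2 <= D / M <= e / 8]. The two approximation errors and the convergence
   for [p] then cost [e / 4] each. *)
pose M := D / (e / 8) + 1.
have M1 : 1 <= M by rewrite lerDr divr_ge0// ltW.
have M0 : 0 < M by lra.
have DM : D / M ^+ 2 <= e / 8.
  rewrite ler_pdivrMr ?exprn_gt0//.
  apply: (@le_trans _ _ (e / 8 * M)).
    by rewrite /M mulrDr mulr1 mulrC divfK ?gt_eqF// lerDl ltW.
  apply: ler_wpM2l; first exact: ltW.
  by move: M1 M0; clearbody M => ? ?; nra.
have [p tp [pB fp]] := trig_poly_approx cf fB M0 e8.
have pc := trig_poly_cvg tp.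
have e4 : 0 < e / 4 by rewrite divr_gt0.
near=> u.
have u0 : 0 < u by near: u; exact: nbhs_pinfty_gt.
have u1 : 1 <= u by near: u; exact: nbhs_pinfty_ge.
have EX := @approx_error _ _ PP (X u) f p B M (e / 8) C M0 (ltW e8) B0 C0 (mX u0) _ (mfX u u0) tp fB pB fp.
have EZ := @approx_error _ _ PP' Z f p B M (e / 8) C M0 (ltW e8) B0 C0 mZ _ mfZ tp fB pB fp.
have {}EX : `|\int[PP]_w f (\row_i X u w i) - \int[PP]_w p (X u w)| <= e / 8 + e / 8.
  apply: (le_trans (EX _)); last by rewrite lerD2l.
  by move=> i; rewrite (le_trans (hX _ u1 i))// lee_fin le_max lexx.
have {}EZ : `|\int[PP']_w f (\row_i Z w i) - \int[PP']_w p (Z w)| <= e / 8 + e / 8.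
  apply: (le_trans (EZ _)); last by rewrite lerD2l.
  by move=> i; rewrite (le_trans (hZ i))// lee_fin le_max lexx orbT.
have Ep : `|\int[PP']_w p (Z w) - \int[PP]_w p (X u w)| <= e / 4.
  by near: u; move/cvgrPdist_le : pc; exact.
move: EX EZ Ep; rewrite !ler_norml => /andP[? ?] /andP[? ?] /andP[? ?].
by apply/andP; split; lra.
Unshelve. all: by end_near. Qed.

End weak_convergence.

(** * Exponential holding times *)

Section density.
Local Open Scope ereal_scope.
Context d (T : measurableType d) (R : realType).
Variables (mu nu : {measure set T -> \bar R}) (p : T -> R).
Hypothesis mp : measurable_fun setT p.
Hypothesis p0 : forall x, (0 <= p x)%R.
Hypothesis nuE : forall A, measurable A -> nu A = \int[mu]_(x in A) (p x)%:E.

Lemma ge0_integral_density (f : T -> \bar R) : measurable_fun setT f ->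
  (forall x, 0 <= f x) -> \int[nu]_x f x = \int[mu]_x (f x * (p x)%:E).
Proof.
move=> mf f0.
have mpE : measurable_fun setT (EFin \o p) by exact/measurable_EFinP.
have Hs (g : {nnsfun T >-> R}) :
    \int[nu]_x (g x)%:E = \int[mu]_x ((g x)%:E * (p x)%:E).
  have l0 i : (0 <= level (f := g) i)%R by have [x <-] := level_in_range (f := g) i.
  rewrite integral_sfun_level//.
  have E x : (g x)%:E * (p x)%:E =
     \sum_i ((level (f := g) i)%:E * ((p x)%:E * (\1_(level_set i) x)%:E)).
    rewrite (@sfun_levelE _ _ _ g id)// -sumEFin ge0_sume_distrl; last first.
      by move=> i _; rewrite lee_fin mulr_ge0.
    by apply: eq_bigr => i _; rewrite EFinM -muleA; congr (_ * _); rewrite muleC.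
  under [RHS]eq_integral do rewrite E.
  have mI i : measurable_fun setT (fun x => (p x)%:E * (\1_(level_set (f := g) i) x)%:E).
    by apply: emeasurable_funM => //; exact: measurable_indic_level_set.
  rewrite ge0_integral_sum//=.
  - apply: eq_bigr => i _; rewrite ge0_integralZl//; last 2 first.
    + by move=> x _; rewrite mule_ge0 ?lee_fin.
    + by rewrite lee_fin.
    congr (_ * _); rewrite nuE; last exact: measurable_level_set.
    rewrite integral_mkcond; apply: eq_integral => x _; rewrite patchE indicE.
    by case: ifP => _; rewrite ?mule1 ?mule0.
  - by move=> i; exact: measurable_funeM.
  - by move=> i x _; rewrite !mule_ge0 ?lee_fin.
pose g := nnsfun_approx measurableT mf.
have gf x : (g n x)%:E @[n --> \oo] --> f x.
  by apply: cvg_nnsfun_approx => // y _; exact: f0.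
have gnd x : nondecreasing_seq (fun n => (g n x)%:E).
  by move=> a b ab; rewrite lee_fin; exact/lefP/nd_nnsfun_approx.
have L : \int[nu]_x (g n x)%:E @[n --> \oo] --> \int[nu]_x f x.
  have -> : \int[nu]_x f x = \int[nu]_x limn (fun n => (g n x)%:E).
    by apply: eq_integral => x _; apply/esym/cvg_lim.
  apply: cvg_monotone_convergence => //.
  - by move=> n; exact/measurable_EFinP.
  - by move=> n x _; rewrite lee_fin.
have Rr : \int[mu]_x ((g n x)%:E * (p x)%:E) @[n --> \oo] -->
    \int[mu]_x (f x * (p x)%:E).
  have -> : \int[mu]_x (f x * (p x)%:E) =
      \int[mu]_x limn (fun n => (g n x)%:E * (p x)%:E).
    by apply: eq_integral => x _; apply/esym/cvg_lim => //; exact: cvgeZr.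
  apply: cvg_monotone_convergence => //.
  - move=> n; apply: emeasurable_funM => //; exact/measurable_EFinP.
  - by move=> n x _; rewrite mule_ge0 ?lee_fin.
  - by move=> x _ a b ab; rewrite lee_wpmul2r ?lee_fin//; exact: gnd.
apply: (cvg_unique _ L) => //=; under eq_fun do rewrite Hs; exact: Rr.
Qed.

End density.

Lemma derivable_continuous (R : realType) (F : R -> R) :
  (forall x : R, derivable F x 1) -> continuous F.
Proof.
move=> dF x; apply: differentiable_continuous; exact/derivable1_diffP/dF.
Qed.

Section exponential_moments.
Context (R : realType).
Local Notation mu := (@lebesgue_measure R).

Lemma integral_exponential_prob (f : R -> R) : measurable_fun setT f ->
  (forall x, 0 <= f x) ->
  (\int[exponential_prob (1 : R)]_x (f x)%:E =
   \int[mu]_(x in `[0%R, +oo[) (f x * expR (- x))%:E)%E.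
Proof.
move=> mf f0.
rewrite (@ge0_integral_density _ _ _ mu _ (exponential_pdf 1))//.
- rewrite [RHS]integral_mkcond; apply: eq_integral => x _.
  rewrite patchE -EFinM; case: ifPn => [|].
    by rewrite inE/= in_itv/= andbT => x0; rewrite exponential_pdfE// mul1r mulN1r.
  rewrite notin_setE/= in_itv/= andbT => /negP; rewrite -ltNge => x0.
  by rewrite lt0_exponential_pdf ?mulr0.
- exact: measurable_exponential_pdf.
- by move=> x; apply: exponential_pdf_ge0.
- exact/measurable_EFinP.
Qed.

Let cvg_powM_expN (k : nat) : (x ^+ k * expR (- x)) @[x --> +oo%R] --> (0 : R).
Proof.
apply/cvgrPdist_le => e e0; near=> x.
have x0 : 0 < x by near: x; exact: nbhs_pinfty_gt.
rewrite sub0r normrN ger0_norm ?mulr_ge0 ?exprn_ge0 ?expR_ge0 ?ltW//.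
have h : x ^+ k.+1 / k.+1`!%:R <= expR x.
  by apply: le_trans (expR_ge1Dxn k (ltW x0)); rewrite lerDr.
rewrite expRN ltr_pdivrMr ?expR_gt0//.
apply: (@lt_le_trans _ _ (e * (x ^+ k.+1 / k.+1`!%:R))); last by rewrite ler_wpM2l ?(ltW e0).
rewrite exprSr -!mulrA mulrCA ltr_pMr ?exprn_gt0// mulrA.
rewrite ltr_pdivlMr ?ltr0n ?fact_gt0// mul1r mulrC -ltr_pdivrMr//.
by near: x; apply: nbhs_pinfty_gt; exact: num_real.
Unshelve. all: by end_near. Qed.

(** [Num.max x 0] is nonnegative on the whole line and agrees with [x] on the support of the
    exponential law; this permits integration theory for nonnegative functions. *)
Lemma integral_exponential_id :
  (\int[exponential_prob (1 : R)]_x (Num.max x 0)%:E = 1)%E.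
Proof.
rewrite integral_exponential_prob; last 2 first.
- by apply: measurable_maxr.
- by move=> x; rewrite le_max lexx orbT.
rewrite (_ : \int[mu]_(x in `[0%R, +oo[) _ = \int[mu]_(x in `[0%R, +oo[) (x * expR (- x))%:E)%E; last first.
  apply: eq_integral => x.
  by rewrite inE/= in_itv/= andbT => x0; rewrite max_l.
have dF (x : R) : is_derive x 1 (fun x => - ((x + 1) * expR (- x))) (x * expR (- x)).
  by apply: is_derive_eq; rewrite /GRing.scale/=; ring.
have cf : continuous (fun x : R => x * expR (- x)).
  by apply: derivable_continuous => x; apply: ex_derive.
rewrite (@ge0_continuous_FTC2y _ _ (fun x => - ((x + 1) * expR (- x))) 0 0).
- by rewrite -EFinB !add0r opprK oppr0 expR0 mul1r.
- by move=> x x0; rewrite mulr_ge0 ?expR_ge0.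
- exact: continuous_subspaceT.
- rewrite -oppr0; apply: cvgN.
  have h : (x ^+ 1 * expR (- x) + x ^+ 0 * expR (- x)) @[x --> +oo%R] --> (0 + 0 : R).
    by apply: cvgD; exact: cvg_powM_expN.
  rewrite addr0 in h; rewrite (_ : (fun x => _) =
      (fun x : R => x ^+ 1 * expR (- x) + x ^+ 0 * expR (- x)))//.
  by apply/funext => x; rewrite expr1 expr0 mulrDl.
- by move=> x _; exact: ex_derive.
- apply: cvg_at_right_filter; apply: (derivable_continuous (F := fun x => - ((x + 1) * expR (- x)))) => x.
  exact: ex_derive.
- by move=> x _; rewrite derive1E; exact: derive_val.
Unshelve. all: by end_near. Qed.

Lemma integral_exponential_sqr :
  (\int[exponential_prob (1 : R)]_x (Num.max x 0 ^+ 2)%:E = 2%:E)%E.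
Proof.
rewrite integral_exponential_prob; last 2 first.
- by apply: measurable_funX; apply: measurable_maxr.
- by move=> x; rewrite sqr_ge0.
rewrite (_ : \int[mu]_(x in `[0%R, +oo[) _ = \int[mu]_(x in `[0%R, +oo[) (x ^+ 2 * expR (- x))%:E)%E; last first.
  apply: eq_integral => x.
  by rewrite inE/= in_itv/= andbT => x0; rewrite max_l.
have dF (x : R) : is_derive x 1 (fun x => - ((x ^+ 2 + 2 * x + 2) * expR (- x)))
    (x ^+ 2 * expR (- x)).
  by apply: is_derive_eq; rewrite /GRing.scale/=; ring.
have cf : continuous (fun x : R => x ^+ 2 * expR (- x)).
  by apply: derivable_continuous => x; apply: ex_derive.
rewrite (@ge0_continuous_FTC2y _ _ (fun x => - ((x ^+ 2 + 2 * x + 2) * expR (- x))) 0 0).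
- by rewrite -EFinB expr0n/= mulr0 !add0r oppr0 expR0 mulr1 opprK.
- by move=> x x0; rewrite mulr_ge0 ?expR_ge0 ?sqr_ge0.
- exact: continuous_subspaceT.
- rewrite -oppr0; apply: cvgN.
  have h1 : (2 * (x ^+ 1 * expR (- x))) @[x --> +oo%R] --> (2 * 0 : R).
    by apply: cvgM; [exact: cvg_cst|exact: cvg_powM_expN].
  have h0 : (2 * (x ^+ 0 * expR (- x))) @[x --> +oo%R] --> (2 * 0 : R).
    by apply: cvgM; [exact: cvg_cst|exact: cvg_powM_expN].
  have h : (x ^+ 2 * expR (- x) + 2 * (x ^+ 1 * expR (- x)) +
      2 * (x ^+ 0 * expR (- x))) @[x --> +oo%R] --> (0 + 2 * 0 + 2 * 0 : R).
    by apply: cvgD => //; apply: cvgD => //; exact: cvg_powM_expN.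
  rewrite mulr0 !addr0 in h; rewrite (_ : (fun x => _) = (fun x : R =>
      x ^+ 2 * expR (- x) + 2 * (x ^+ 1 * expR (- x)) + 2 * (x ^+ 0 * expR (- x))))//.
  by apply/funext => x; rewrite expr1 expr0; ring.
- by move=> x _; exact: ex_derive.
- apply: cvg_at_right_filter.
  apply: (derivable_continuous (F := fun x => - ((x ^+ 2 + 2 * x + 2) * expR (- x)))) => x.
  exact: ex_derive.
- by move=> x _; rewrite derive1E; exact: derive_val.
Unshelve. all: by end_near. Qed.

End exponential_moments.

Section independent_product.
Local Open Scope ereal_scope.
Context d d1 d2 (T : measurableType d) (T1 : measurableType d1)
  (T2 : measurableType d2) (R : realType).
Variables (Q : {finite_measure set T -> \bar R}) (E : set T) (X : T -> T1) (Y : T -> T2).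
Variables (c : R) (m1 : probability T1 R) (m2 : probability T2 R).
Hypothesis mE : measurable E.
Hypothesis mX : measurable_fun setT X.
Hypothesis mY : measurable_fun setT Y.
Hypothesis c0 : (0 <= c)%R.
Hypothesis lawXY : forall (A : set T1) (B : set T2), measurable A -> measurable B ->
  Q (E `&` (X @^-1` A `&` Y @^-1` B)) = c%:E * (m1 A * m2 B).

(** By uniqueness of product measures, [Q] restricted to [E] has image [c] times [m1 \x m2] under
    [(X, Y)]; then Tonelli's theorem applies. *)
Lemma ge0_integral_indep (f : T1 -> R) (g : T2 -> R) : measurable_fun setT f ->
  measurable_fun setT g -> (forall x, (0 <= f x)%R) -> (forall x, (0 <= g x)%R) ->
  \int[Q]_(x in E) (f (X x) * g (Y x))%:E =
  c%:E * (\int[m1]_x (f x)%:E * \int[m2]_x (g x)%:E).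
Proof.
move=> mf mg f0 g0.
have mXY : measurable_fun setT (fun x => (X x, Y x)) by exact/measurable_fun_pair.
have mfg : measurable_fun setT (fun z : T1 * T2 => (f z.1 * g z.2)%:E).
  apply/measurable_EFinP; apply: measurable_funM.
    by apply: (@measurableT_comp _ _ _ _ _ _ f _ fst) => //; exact: measurable_fst.
  by apply: (@measurableT_comp _ _ _ _ _ _ g _ snd) => //; exact: measurable_snd.
have fg0 z : 0 <= (f z.1 * g z.2)%:E :> \bar R by rewrite lee_fin mulr_ge0.
pose Qr : {measure set T -> \bar R} := mrestr Q mE.
have mfX : measurable_fun setT (fun x => (f (X x) * g (Y x))%:E).
  exact: (measurableT_comp mfg mXY).
have -> : \int[Q]_(x in E) (f (X x) * g (Y x))%:E =
    \int[pushforward Qr (fun x => (X x, Y x))]_z (f z.1 * g z.2)%:E.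
  rewrite ge0_integral_pushforward//=.
  rewrite preimage_setT (_ : \int[Q]_(x in E) _ = \int[Qr]_(x in E) (f (X x) * g (Y x))%:E).
    rewrite [RHS](@ge0_negligible_integral _ _ _ _ _ (~` E))//.
    - by rewrite setDE setTI setCK.
    - exact: measurableC.
    - by move=> x _; rewrite lee_fin mulr_ge0.
    - by rewrite /Qr /= /mrestr/= setICl measure0.
  apply: eq_measure_integral => A mA AE.
  by rewrite /Qr /= /mrestr; move/setIidl: AE => ->.
pose c' : {nonneg R} := NngNum c0.
rewrite (eq_measure_integral (mscale c' (m1 \x m2)%E)) => [|A mA _]; last first.
  rewrite -[RHS]/(c%:E * (m1 \x m2)%E A) -[LHS]/(Q ((fun x => (X x, Y x)) @^-1` A `&` E)).
  (* Uniqueness is applied after division by [c]; if [c = 0], then [E] itself is a null set. *)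
  have [cgt0|cle0] := ltP 0%R c; last first.
    have cz : c = 0%R by apply/eqP; rewrite eq_le cle0.
    rewrite cz mul0e; apply/eqP; rewrite -measure_le0.
    have <- : Q E = 0.
      have := lawXY measurableT measurableT.
      by rewrite !preimage_setT !setIT cz mul0e.
    apply: le_measure; rewrite ?inE//.
    by apply: measurableI => //; rewrite -[X in measurable X]setTI; exact: mXY.
  have ci0 : (0 <= c^-1)%R by rewrite invr_ge0.
  pose m' : {measure set (T1 * T2) -> \bar R} :=
    mscale (NngNum ci0) (pushforward Qr (fun x => (X x, Y x))).
  have m'E B : m' mXY B = (c^-1)%:E * Q ((fun x => (X x, Y x)) @^-1` B `&` E) by [].
  rewrite (@product_measure_unique _ _ _ _ R m1 m2 (m' mXY) _ A mA).
    by rewrite m'E muleA -EFinM divff ?mul1e// gt_eqF.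
  move=> B C mB mC; rewrite m'E.
  have -> : (fun x => (X x, Y x)) @^-1` (B `*` C) `&` E =
      E `&` (X @^-1` B `&` Y @^-1` C) by rewrite setIC.
  by rewrite lawXY// muleA -EFinM mulVf ?mul1e// gt_eqF.
rewrite ge0_integral_mscale//=; congr (_ * _).
rewrite fubini_tonelli1//=.
rewrite (eq_integral (fun x => (f x)%:E * \int[m2]_y (g y)%:E)) => [|x _].
  rewrite ge0_integralZr//; first exact/measurable_EFinP.
    by move=> x _; rewrite lee_fin.
  by apply: integral_ge0 => y _; rewrite lee_fin.
rewrite /fubini_F/=; under eq_integral do rewrite EFinM.
rewrite ge0_integralZl ?lee_fin//; first exact/measurable_EFinP.
by move=> y _; rewrite lee_fin.
Qed.

End independent_product.

(** * Trajectories and local times *)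

Section trajectory_measurability.
Context (d : nat) (R : realType).
Local Notation traj := (traj d.+1 R).
Local Notation traj_mod := (traj_mod d.+1 R).

Lemma measurable_pos n x : measurable [set w : traj | pos w n = x].
Proof. by apply: sub_sigma_algebra; left; exists n, x. Qed.

Lemma measurable_hold n : measurable_fun setT (fun w : traj => hold w n).
Proof.
move=> _ B mB; rewrite setTI.
by apply: (@sub_sigma_algebra traj setT (@traj_cylinders d.+1 R)); right; exists n, B.
Qed.

Lemma measurable_forward : measurable_fun setT (@forward d R).
Proof. by apply: measurable_walk_map => n x; exact: measurable_pos. Qed.

Lemma measurable_backward : measurable_fun setT (@backward d R).
Proof. by apply: measurable_walk_map => n x; exact: measurable_pos. Qed.

Lemma measurable_pos_in n (A : set 'rV[int]_d.+1) :
  measurable [set w : traj | A (pos w n)].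
Proof.
rewrite (_ : [set _ | _] = \bigcup_(x in A) [set w : traj | pos w n = x]).
  rewrite bigcup_mkcond; apply: countable_bigcupT_measurable => // x.
  by case: ifP => // _; exact: measurable_pos.
by apply/seteqP; split=> [w /= Aw|w [x Ax /= ->//]]; exists (pos w n).
Qed.

Lemma pi_starP (w w' : traj) : pi_star w = pi_star w' ->
  exists k : int, forall n, val w n = val w' (n + k).
Proof. by move=> /eqmodP /asboolP. Qed.

Lemma pi_star_repr (z : traj_mod) : pi_star (repr z) = z.
Proof. exact: reprK. Qed.

Lemma measurable_pi_star : measurable_fun setT (@pi_star d.+1 R).
Proof. by move=> _ A mA; rewrite setTI. Qed.

End trajectory_measurability.

Section local_time.
Local Open Scope ereal_scope.
Context (d : nat) (R : realType).
Local Notation traj := (traj d.+1 R).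
Local Notation traj_mod := (traj_mod d.+1 R).

(** [Negz n] is [- (n + 1)], so time [0] belongs to the first series only. *)
Lemma esum_int (a : int -> \bar R) : (forall n, 0 <= a n) ->
  \esum_(n in setT) a n = \sum_(n <oo) a n%:Z + \sum_(n <oo) a (Negz n).
Proof.
move=> a0; rewrite (esumID (range Posz)) ?setTI//; congr (_ + _).
  rewrite esum_image => [|m n _ _ [//]].
  by rewrite -nneseries_esumT.
rewrite (_ : ~` _ = range Negz).
  rewrite esum_image => [|m n _ _ [//]].
  by rewrite -nneseries_esumT.
apply/seteqP; split => [[n|n] /=|_ [n _ <-] [] //].
  by move=> h; exfalso; apply: h; exists n.
by move=> _; exists n.
Qed.

Definition local_time (x : 'rV[int]_d.+1) (w : traj) : \bar R :=
  \esum_(n in [set: int]) (hold w n * (pos w n == x)%:R)%:E.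

Lemma hold_gt0 (w : traj) n : (0 < hold w n)%R.
Proof. case: w => w /= h; have [h0 _ _ _ _] := set_mem h; exact: h0. Qed.

Lemma local_time_term_ge0 (w : traj) n x : 0 <= (hold w n * (pos w n == x)%:R)%:E.
Proof. by rewrite lee_fin mulr_ge0// ltW// hold_gt0. Qed.

Lemma measurable_local_time_term x n :
  measurable_fun setT (fun w : traj => (hold w n * (pos w n == x)%:R)%:E).
Proof.
apply/measurable_EFinP; apply: measurable_funM; first exact: measurable_hold.
rewrite (_ : (fun _ => _) = \1_[set w : traj | pos w n = x]).
  by apply: measurable_indic; exact: measurable_pos.
apply/funext => w; rewrite indicE; congr ((nat_of_bool _)%:R).
by apply/idP/idP; rewrite in_setE/= => /eqP.
Qed.

Lemma local_time_ge0 x w : 0 <= local_time x w.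
Proof. by apply: esum_ge0 => n _; exact: local_time_term_ge0. Qed.

Lemma measurable_local_time x : measurable_fun setT (local_time x).
Proof.
rewrite (_ : local_time x = (fun w : traj =>
    \sum_(n <oo) (hold w n%:Z * (pos w n%:Z == x)%:R)%:E +
    \sum_(n <oo) (hold w (Negz n) * (pos w (Negz n) == x)%:R)%:E)).
  apply: emeasurable_funD; apply: ge0_emeasurable_sum => n *;
    by [exact: local_time_term_ge0|exact: measurable_local_time_term].
apply/funext => w; rewrite /local_time esum_int// => n.
exact: local_time_term_ge0.
Qed.

Lemma local_time_pi_star x (w w' : traj) :
  pi_star w = pi_star w' -> local_time x w = local_time x w'.
Proof.
move=> /pi_starP[k ww']; rewrite /local_time.
rewrite [RHS](@reindex_esum R int int setT setT (fun n => n + k)%R).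
  by apply: eq_esum => n _; rewrite /hold /pos ww'.
split=> //= [m n _ _ /addIr//|n _]; exists (n - k)%R => //.
by rewrite subrK.
Qed.

Definition mod_local_time (x : 'rV[int]_d.+1) (z : traj_mod) : \bar R :=
  local_time x (repr z).

Lemma mod_local_time_pi_star x w : mod_local_time x (pi_star w) = local_time x w.
Proof. by apply: local_time_pi_star; rewrite pi_star_repr. Qed.

Lemma mod_local_time_ge0 x z : 0 <= mod_local_time x z.
Proof. exact: local_time_ge0. Qed.

(** No measurability of [repr] enters: sets of the quotient are tested through [pi_star], along
    which [mod_local_time] is [local_time] by shift invariance. *)
Lemma measurable_mod_local_time x : measurable_fun setT (mod_local_time x).
Proof.
move=> _ B mB; rewrite setTI.
suff : measurable (@pi_star d.+1 R @^-1` (mod_local_time x @^-1` B)) by [].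
rewrite -comp_preimage (_ : _ \o _ = local_time x).
  by rewrite -[X in measurable X]setTI; exact: measurable_local_time.
by apply/funext => w; exact: mod_local_time_pi_star.
Qed.

Lemma local_time_eq0 x w : (forall n, pos w n != x) -> local_time x w = 0.
Proof.
by move=> wx; apply: esum1 => n _; rewrite (negbTE (wx n)) mulr0.
Qed.

End local_time.

(** * Moments of local times under the intensity measure *)

Section entrance_law.
Local Open Scope ereal_scope.
Context (d : nat) (R : realType).
Local Notation V := 'rV[int]_d.+1.
Local Notation W := (walk_space d.+1).
Local Notation traj := (traj d.+1 R).
Variables (P : V -> probability W R) (K : {fset V}).
Variable Q : {finite_measure set traj -> \bar R}.
Hypothesis hQ : is_QK P K Q.
Local Notation mu := (exponential_prob (1 : R)).

(** The law of the forward walk under [Q]: simple random walk started from the equilibrium measure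
    of [K]. It is a finite measure whose total mass is the capacity of [K]. *)
Definition entrance_prob (A : set W) : \bar R :=
  \sum_(z <- K) (eqm P K z)%:E * P z A.

Lemma entrance_prob_ge0 A : 0 <= entrance_prob A.
Proof. by apply: sume_ge0 => z _; rewrite mule_ge0 ?lee_fin ?eqm_ge0. Qed.

Lemma entrance_prob_fin_num A : measurable A -> entrance_prob A \is a fin_num.
Proof.
move=> mA; rewrite /entrance_prob; apply/sum_fin_numP => z _ _.
by rewrite fin_numM//; exact: fin_num_measure.
Qed.

(** Each point outside [K] has mass zero, and the lattice, enumerated by [unpickle], is
    countable. *)
Lemma QK_start_notin : Q [set w | pos w 0 \notin K] = 0.
Proof.
pose F n : set traj := if @choice.unpickle V n is Some z then
  if z \in K then set0 else [set w : traj | pos w 0 = z] else set0.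
rewrite (_ : [set _ | _] = \bigcup_n F n); last first.
  apply/seteqP; split => [w /= wK|w [n _]]; last first.
    rewrite /F; case: choice.unpickle => [z|//]; case: ifPn => // zK /= -> //.
  by exists (choice.pickle (pos w 0)) => //; rewrite /F choice.pickleK (negbTE wK).
have F0 n : measurable (F n) /\ Q (F n) = 0.
  rewrite /F; case: choice.unpickle => [z|//]; case: ifPn => // zK.
  split; first exact: measurable_pos.
  by have [-> _] := hQ; rewrite /eqm (negbTE zK).
apply/eqP; rewrite -measure_le0 (le_trans (measure_sigma_subadditive _ _ _ (@subset_refl _ _)))//.
- by move=> n; have [] := F0 n.
- by apply: bigcupT_measurable => n; have [] := F0 n.
- by rewrite eseries0// => n _ _; have [] := F0 n.
Qed.

Lemma QK_split A : measurable A ->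
  Q A = \sum_(z <- K) Q (A `&` [set w | pos w 0 = z]).
Proof.
move=> mA.
have mK : measurable [set w : traj | [set` K] (pos w 0)] by exact: measurable_pos_in.
rewrite (measureDI _ mA mK) [X in X + _](_ : _ = 0) ?add0e.
  rewrite (_ : _ `&` _ = \bigcup_(z in [set` K]) (A `&` [set w | pos w 0 = z])).
    rewrite bigcup_fset measure_fbigsetU//=.
    - by move=> z _; apply: measurableI => //; exact: measurable_pos.
    - apply/trivIsetP => z z' _ _ zz'; apply/seteqP; split => // w [[_ /= h1] [_ /= h2]].
      by rewrite -h1 -h2 eqxx in zz'.
  apply/seteqP; split => [w [Aw wK]|w [z zK [Aw wz]]]; first by exists (pos w 0).
  by split => //=; rewrite wz.
apply: (@subset_measure0 _ _ _ _ _ [set w : traj | pos w 0 \notin K]).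
- exact: measurableD.
- exact: (@measurable_pos_in d R 0 [set z | z \notin K]).
- by move=> w [_ /= /negP].
- exact: QK_start_notin.
Qed.

Lemma QK_start0 A z : measurable A -> eqm P K z = 0%R -> Q (A `&` [set w | pos w 0 = z]) = 0.
Proof.
move=> mA ez; apply: (@subset_measure0 _ _ _ _ _ [set w : traj | pos w 0 = z]) => //.
- by apply: measurableI => //; exact: measurable_pos.
- exact: measurable_pos.
- by have [H _] := hQ; rewrite [LHS]H ez.
Qed.

Lemma QK_cprob A z : measurable A -> (0 < eqm P K z)%R ->
  Q (A `&` [set w | pos w 0 = z]) =
  (eqm P K z * cprob Q A [set w | pos w 0 = z])%:E.
Proof.
move=> mA ez; rewrite /cprob; have [-> _] := hQ.
rewrite /= mulrCA divff ?gt_eqF// mulr1 fineK//; apply: fin_num_measure.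
by apply: measurableI => //; exact: measurable_pos.
Qed.

(** For each starting point, independence separates the walk from the holding times, and the product
    formula is applied to the set of the two indices, whence [n != m]. Summing over the starting
    points brings in the equilibrium weights. *)
Lemma QK_law (n m : int) (A : set W) (D D' : set R) : n != m ->
  measurable A -> measurable D -> measurable D' ->
  Q (@forward d R @^-1` A `&`
     ((fun w => hold w n) @^-1` D `&` (fun w => hold w m) @^-1` D')) =
  entrance_prob A * (mu D * mu D').
Proof.
move=> nm mA mD mD'.
have mF : measurable (@forward d R @^-1` A).
  by rewrite -[X in measurable X]setTI; exact: measurable_forward.
pose C : set (hold_space R) := [set s | D (s n) /\ D' (s m)].
have mC : measurable C.
  rewrite (_ : C = [set s | D (s n)] `&` [set s | D' (s m)])//.
  by apply: measurableI; apply: sub_sigma_algebra; [exists n, D|exists m, D'].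
have mH : measurable (@holding d R @^-1` C).
  rewrite (_ : _ @^-1` _ = (fun w => hold w n) @^-1` D `&` (fun w => hold w m) @^-1` D')//.
  apply: measurableI.
    by rewrite -[X in measurable X]setTI; exact: measurable_hold.
  by rewrite -[X in measurable X]setTI; exact: measurable_hold.
rewrite (_ : _ `&` _ = @forward d R @^-1` A `&` @backward d R @^-1` setT `&` @holding d R @^-1` C); last first.
  by rewrite preimage_setT setIT.
have mA' : measurable (@forward d R @^-1` A `&` @backward d R @^-1` setT).
  by rewrite preimage_setT setIT.
rewrite QK_split; last exact: measurableI.
rewrite /entrance_prob ge0_sume_distrl; last first.
  by move=> z _; rewrite mule_ge0 ?lee_fin ?eqm_ge0.
apply: eq_bigr => z _.
have [ez|] := ltP 0%R (eqm P K z); last first.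
  move=> ez; have {}ez : eqm P K z = 0%R by apply/eqP; rewrite eq_le ez eqm_ge0.
  by rewrite QK_start0// ?ez ?mul0e//; exact: measurableI.
rewrite QK_cprob//; last exact: measurableI.
have [_ /(_ _ ez)[/(_ _ _ _ mA measurableT mC) -> /(_ _ mA) -> _ H]] := hQ.
have Q0 : fine (Q [set w | pos w 0 = z]) = eqm P K z by have [-> _] := hQ.
have -> : cprob Q (@backward d R @^-1` setT) [set w | pos w 0 = z] = 1%R.
  by rewrite preimage_setT /cprob setTI Q0 divff// gt_eqF.
have -> : cprob Q (@holding d R @^-1` C) [set w | pos w 0 = z] =
    (fine (mu D) * fine (mu D'))%R.
  have := H [fset n; m]%fset (fun k => if k == n then D else D').
  rewrite big_fsetU1 ?inE//= big_seq_fset1 eqxx eq_sym (negbTE nm) => <-; last first.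
    by move=> k; case: ifP.
  congr (cprob Q _ _); apply/seteqP; split => w /=.
    by move=> [h1 h2] k; rewrite !inE => /orP[] /eqP ->; rewrite ?eqxx// eq_sym (negbTE nm).
  move=> h; split.
    by have := h n; rewrite !inE eqxx => /(_ isT).
  by have := h m; rewrite !inE eqxx orbT eq_sym (negbTE nm) => /(_ isT).
rewrite mulr1 !EFinM !fineK ?muleA//; exact: fin_num_measure.
Qed.

(** The backward walk is conditioned on [no_return K], so time [0] is almost surely the entrance
    time of [K]. *)
Lemma QK_backward : Q [set w | exists n, pos w (Negz n) \in K] = 0.
Proof.
have mN : measurable (~` no_return K : set W) by apply: measurableC; exact: measurable_no_return.
have -> : [set w : traj | exists n, pos w (Negz n) \in K] = @backward d R @^-1` (~` no_return K).
  apply/seteqP; split => [w [n wn] /= /(_ n.+1 isT)|w /=].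
    by rewrite /backward -NegzE wn.
  move=> /existsNP[[|n] /not_implyP[//]] _ /negP; rewrite negbK => wn.
  by exists n; rewrite NegzE.
have mB : measurable (@backward d R @^-1` (~` no_return K)).
  by rewrite -[X in measurable X]setTI; exact: measurable_backward.
rewrite QK_split// big1// => z _.
have [ez|] := ltP 0%R (eqm P K z); last first.
  move=> ez; have {}ez : eqm P K z = 0%R by apply/eqP; rewrite eq_le ez eqm_ge0.
  by rewrite QK_start0.
rewrite QK_cprob//; have [_ /(_ _ ez)[_ _ /(_ _ mN) -> _]] := hQ.
by rewrite /cprob setICl measure0 mul0r mulr0.
Qed.

End entrance_law.

Section nneseries_extra.
Local Open Scope ereal_scope.
Context (R : realType).

Lemma ge0_nneseriesZr (t : nat -> \bar R) (F : \bar R) : (forall n, 0 <= t n) -> 0 <= F ->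
  (\sum_(n <oo) t n) * F = \sum_(n <oo) (t n * F).
Proof.
move=> t0; case: F => [r|_|//].
  by move=> r0; rewrite muleC -nneseriesZl//; apply: eq_eseriesr => n _; rewrite muleC.
have [t00|/existsNP[n tn]] := pselect (forall n, t n = 0).
  rewrite !eseries0 ?mul0e// => n _ _; by rewrite t00 ?mul0e.
have {}tn : 0 < t n by rewrite lt0e t0 andbT; exact/eqP.
have H (u : nat -> \bar R) : (forall k, 0 <= u k) -> u n <= \sum_(k <oo) u k.
  move=> u0; apply: le_trans (@nneseries_lim_ge _ u xpredT 0 n.+1 _) => //.
  by rewrite big_nat_recr//= leeDr// sume_ge0.
rewrite gt0_muley; last exact: lt_le_trans tn (H _ t0).
apply/esym/eqP; rewrite -leye_eq -[leLHS](gt0_muley tn).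
by apply: H => k; rewrite mule_ge0.
Qed.

Lemma nneseries_shift (f : nat -> \bar R) n : (forall k, 0 <= f k) ->
  \sum_(m <oo) (if (n <= m)%N then f (m - n)%N else 0) = \sum_(k <oo) f k.
Proof.
move=> f0; rewrite [LHS](_ : _ = \sum_(n <= m <oo) f (m - n)%N).
  rewrite -(@nneseries_addn R (fun m => f (m - n)%N) n)//.
  by apply: eq_eseriesr => k _; rewrite addnK.
by rewrite [RHS]eseries_cond/= [RHS]eseries_mkcond.
Qed.

End nneseries_extra.

Section entrance_moments.
Local Open Scope ereal_scope.
Context (d : nat) (R : realType).
Local Notation V := 'rV[int]_d.+3.
Local Notation W := (walk_space d.+3).
Local Notation traj := (traj d.+3 R).
Variable P : V -> probability W R.
Hypothesis hP : forall x, is_srw x (P x).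
Variables (K : {fset V}) (Q : {finite_measure set traj -> \bar R}).
Hypothesis hQ : is_QK P K Q.
Local Notation mu := (exponential_prob (1 : R)).

Let exp1 : probability (measurableTypeR R) R :=
  exponential_distribution_exponential_prob__canonical__probability_measure_Probability ltr01.

Let nonneg_hold (w : traj) (n : int) : Num.max (hold w n) 0%R = hold w n.
Proof. by rewrite max_l// ltW// hold_gt0. Qed.

Section hold_moments.
Variable A : set W.
Hypothesis mA : measurable A.

Let E : set traj := @forward d.+2 R @^-1` A.

Let mE : measurable E.
Proof. by rewrite -[X in measurable X]setTI; exact: measurable_forward. Qed.

Let indep n m (f g : R -> R) : n != m -> measurable_fun setT f ->
  measurable_fun setT g -> (forall x, (0 <= f x)%R) -> (forall x, (0 <= g x)%R) ->
  \int[Q]_(w in E) (f (hold w n) * g (hold w m))%:E =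
  entrance_prob P K A * (\int[mu]_x (f x)%:E * \int[mu]_x (g x)%:E).
Proof.
move=> nm mf mg f0 g0; rewrite -(fineK (entrance_prob_fin_num P K mA)).
apply: (@ge0_integral_indep _ _ _ traj (measurableTypeR R) (measurableTypeR R) R Q E (fun w => hold w n) (fun w => hold w m) _ exp1 exp1) => //;
  try exact: measurable_hold.
  by rewrite fine_ge0// entrance_prob_ge0.
by move=> B C mB mC; rewrite fineK ?entrance_prob_fin_num//; exact: QK_law.
Qed.

Let m_max : measurable_fun setT (fun x : R => Num.max x 0%R).
Proof. exact: measurable_maxr. Qed.

Let max0 (x : R) : (0 <= Num.max x 0)%R.
Proof. by rewrite le_max lexx orbT. Qed.

Let succ_neq (n : int) : n != (n + 1)%R.
Proof. by rewrite eq_sym -subr_eq0 addrAC subrr add0r oner_eq0. Qed.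

Let int1 : \int[mu]_x (cst 1%R x)%:E = 1.
Proof.
transitivity (1%E * exp1 setT); last by rewrite [exp1 _]probability_setT mule1.
exact: (integral_cst exp1 measurableT 1%E).
Qed.

Lemma integral_hold n : \int[Q]_(w in E) (hold w n)%:E = entrance_prob P K A.
Proof.
(* The formula for two holding times, with the constant [1] at another index. *)
transitivity (\int[Q]_(w in E) (Num.max (hold w n) 0%R * cst 1%R (hold w (n + 1)))%:E).
  by apply: eq_integral => w _; rewrite mulr1 nonneg_hold.
rewrite (@indep n (n + 1)%R (fun x => Num.max x 0%R) (cst 1%R))//.
by rewrite int1 integral_exponential_id !mule1.
Qed.

Lemma integral_hold_sqr n :
  \int[Q]_(w in E) (hold w n ^+ 2)%:E = 2%:E * entrance_prob P K A.
Proof.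
transitivity (\int[Q]_(w in E) (Num.max (hold w n) 0%R ^+ 2 * cst 1%R (hold w (n + 1)))%:E).
  by apply: eq_integral => w _; rewrite mulr1 nonneg_hold.
rewrite (@indep n (n + 1)%R (fun x => Num.max x 0%R ^+ 2)%R (cst 1%R))//.
- by rewrite int1 integral_exponential_sqr mule1 muleC.
- exact: measurable_funX.
- by move=> x; rewrite sqr_ge0.
Qed.

Lemma integral_hold_mul n m : n != m ->
  \int[Q]_(w in E) (hold w n * hold w m)%:E = entrance_prob P K A.
Proof.
move=> nm.
transitivity (\int[Q]_(w in E) (Num.max (hold w n) 0%R * Num.max (hold w m) 0%R)%:E).
  by apply: eq_integral => w _; rewrite !nonneg_hold.
rewrite (@indep n m (fun x => Num.max x 0%R) (fun x => Num.max x 0%R))//.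
by rewrite integral_exponential_id !mule1.
Qed.

End hold_moments.

Definition forward_time (x : V) (w : traj) : \bar R :=
  \sum_(n <oo) (hold w n%:Z * (pos w n%:Z == x)%:R)%:E.

Lemma forward_time_ge0 x w : 0 <= forward_time x w.
Proof. by apply: nneseries_ge0 => n _ _; exact: local_time_term_ge0. Qed.

Lemma measurable_forward_time x : measurable_fun setT (forward_time x).
Proof.
apply: ge0_emeasurable_sum => n *;
  by [exact: local_time_term_ge0|exact: measurable_local_time_term].
Qed.

Lemma local_time_forward x w : x \in K -> ~ (exists n, pos w (Negz n) \in K) ->
  local_time x w = forward_time x w.
Proof.
move=> xK wK; rewrite /local_time esum_int; last by move=> n; exact: local_time_term_ge0.
rewrite [X in _ + X]eseries0 ?adde0// => n _ _.
case: eqP => [wx|_]; last by rewrite mulr0.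
by exfalso; apply: wK; exists n; rewrite wx.
Qed.

Lemma ae_local_time_forward x : x \in K ->
  {ae Q, forall w, local_time x w = forward_time x w}.
Proof.
move=> xK; exists [set w | exists n, pos w (Negz n) \in K]; split.
- rewrite (_ : [set _ | _] = \bigcup_n [set w : traj | [set` K] (pos w (Negz n))]).
    by apply: bigcupT_measurable => n; exact: measurable_pos_in.
  by apply/seteqP; split => [w [n wn]|w [n _ wn]]; exists n.
- exact: (QK_backward hQ).
- by move=> w /= H; apply: contra_notP H => H; exact: local_time_forward.
Qed.

Let mcoord (n : nat) (x : V) : measurable ([set w : walk d.+3 | w n = x] : set W).
Proof. exact: measurable_walk_coord. Qed.

(** Symmetry of the transition probabilities turns the entrance law at time [n] into the [n]-th term
    of the last exit decomposition started from [x]. *)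
Lemma entrance_coord n x :
  entrance_prob P K [set w | w n = x] =
  \sum_(z <- K) (walk_prob R n x z)%:E * (eqm P K z)%:E.
Proof.
apply: eq_bigr => z _; rewrite muleC (srw_coord _ hP)// walk_prob_sym.
by [].
Qed.

Lemma entrance_coord2 n k x y :
  entrance_prob P K ([set w | w n = x] `&` [set w | w (n + k)%N = y]) =
  entrance_prob P K [set w | w n = x] * (walk_prob R k x y)%:E.
Proof.
rewrite /entrance_prob ge0_sume_distrl; last first.
  by move=> z _; rewrite mule_ge0 ?lee_fin ?eqm_ge0.
apply: eq_bigr => z _; rewrite -muleA; congr (_ * _).
by rewrite (srw_markov _ hP n z x (mcoord k y))// !(srw_coord _ hP).
Qed.

Lemma sum_entrance_coord x : x \in K ->
  \sum_(n <oo) entrance_prob P K [set w | w n = x] = 1.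
Proof.
move=> xK; rewrite (eq_eseriesr (fun n _ => entrance_coord n x)).
by apply: last_exit => // y z; exact: walk_green_fin.
Qed.

Lemma integral_local_time x : x \in K -> \int[Q]_w local_time x w = 1.
Proof.
move=> xK; rewrite (ge0_ae_eq_integral measurableT (measurable_local_time x)
  (measurable_forward_time x)); last 3 first.
- by move=> *; exact: local_time_ge0.
- by move=> *; exact: forward_time_ge0.
- by have := ae_local_time_forward xK; apply: filterS => w ? _.
rewrite integral_nneseries//; last 2 first.
- by move=> n; exact: measurable_local_time_term.
- by move=> n w _; exact: local_time_term_ge0.
rewrite -[RHS](sum_entrance_coord xK); apply: eq_eseriesr => n _.
rewrite -(integral_hold (mcoord n x) n%:Z) [RHS]integral_mkcond.
apply: eq_integral => w _; rewrite patchE; case: ifPn; rewrite ?inE ?notin_setE/=.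
  by rewrite /forward => ->; rewrite eqxx mulr1.
by rewrite /forward => /eqP/negbTE ->; rewrite mulr0.
Qed.

Lemma integral_local_time_mul x y : x \in K -> y \in K ->
  \int[Q]_w (local_time x w * local_time y w) =
  walk_green R x y + walk_green R y x.
Proof.
move=> xK yK.
have t0 := @local_time_term_ge0 d.+2 R.
have mt := @measurable_local_time_term d.+2 R.
pose E n m : set W := [set w : walk d.+3 | w n = x] `&` [set w | w m = y].
have mE n m : measurable (E n m) by exact: measurableI.
(* [E (sigma_n * sigma_m) = 1 + [n = m] = [n <= m] + [m <= n]] *)
have term n m : \int[Q]_w ((hold w n%:Z * (pos w n%:Z == x)%:R)%:E *
      (hold w m%:Z * (pos w m%:Z == y)%:R)%:E) =
    (if (n <= m)%N then entrance_prob P K (E n m) else 0) +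
    (if (m <= n)%N then entrance_prob P K (E n m) else 0).
  transitivity (\int[Q]_(w in @forward d.+2 R @^-1` E n m) (hold w n%:Z * hold w m%:Z)%:E).
    rewrite [RHS]integral_mkcond; apply: eq_integral => w _; rewrite patchE -EFinM.
    case: ifPn; rewrite ?inE ?notin_setE/=.
      by rewrite /forward => -[/= -> ->]; rewrite !eqxx !mulr1.
    move=> H; case: eqP => [h1|_]; last by rewrite mulr0 mul0r.
    case: eqP => [h2|_]; last by rewrite !mulr0.
    by exfalso; apply: H.
  have [nm|nm|<-] := ltngtP n m.
  - by rewrite integral_hold_mul ?adde0// eqz_nat ltn_eqF.
  - by rewrite integral_hold_mul ?add0e// eqz_nat gtn_eqF.
  - rewrite -[X in _ = X + _]mul1e -[X in _ = _ + X]mul1e -ge0_muleDl// -EFinD.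
    rewrite (_ : (1 + 1)%R = 2%R)//; exact: integral_hold_sqr.
rewrite (ge0_ae_eq_integral (g := fun w => forward_time x w * forward_time y w) measurableT); last first.
- have := ae_local_time_forward xK; have := ae_local_time_forward yK.
  by apply: filterS2 => w -> -> _.
- by move=> w _; rewrite mule_ge0// forward_time_ge0.
- by move=> w _; rewrite mule_ge0// local_time_ge0.
- by apply: emeasurable_funM; exact: measurable_forward_time.
- by apply: emeasurable_funM; exact: measurable_local_time.
transitivity (\sum_(n <oo) \sum_(m <oo)
    \int[Q]_w ((hold w n%:Z * (pos w n%:Z == x)%:R)%:E *
      (hold w m%:Z * (pos w m%:Z == y)%:R)%:E)).
  have mul_ge0 n m w : 0 <= (hold w n%:Z * (pos w n%:Z == x)%:R)%:E *
      (hold w m%:Z * (pos w m%:Z == y)%:R)%:E :> \bar R by rewrite mule_ge0// t0.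
  have mmul n m : measurable_fun setT (fun w : traj =>
      (hold w n%:Z * (pos w n%:Z == x)%:R)%:E * (hold w m%:Z * (pos w m%:Z == y)%:R)%:E).
    by apply: emeasurable_funM; exact: mt.
  rewrite [LHS](_ : _ = \int[Q]_w \sum_(n <oo) \sum_(m <oo)
      ((hold w n%:Z * (pos w n%:Z == x)%:R)%:E * (hold w m%:Z * (pos w m%:Z == y)%:R)%:E)).
    rewrite integral_nneseries//.
    + by apply: eq_eseriesr => n _; rewrite integral_nneseries.
    + by move=> n; apply: ge0_emeasurable_sum => *; [exact: mul_ge0|exact: mmul].
    + by move=> n w _; apply: nneseries_ge0.
  apply: eq_integral => w _; rewrite /forward_time ge0_nneseriesZr//; last exact: forward_time_ge0.
  apply: eq_eseriesr => n _; rewrite muleC ge0_nneseriesZr//.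
  by apply: eq_eseriesr => m _; rewrite muleC.
have e0 n m : 0 <= entrance_prob P K (E n m) by exact: entrance_prob_ge0.
rewrite (eq_eseriesr (fun n _ => eq_eseriesr (fun m _ => term n m))).
transitivity (\sum_(n <oo) (
    \sum_(m <oo) (if (n <= m)%N then entrance_prob P K (E n m) else 0) +
    \sum_(m <oo) (if (m <= n)%N then entrance_prob P K (E n m) else 0))).
  by apply: eq_eseriesr => n _; rewrite nneseriesD// => m _; case: ifP.
rewrite nneseriesD; last 2 first.
- by move=> n *; apply: nneseries_ge0 => m *; case: ifP.
- by move=> n *; apply: nneseries_ge0 => m *; case: ifP.
(* The Markov property at time [n] and summation over the delay [m - n] produce the Green function;
   the remaining sum over [n] equals one by [sum_entrance_coord]. *)
have half (u v : V) : u \in K ->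
    \sum_(n <oo) \sum_(m <oo) (if (n <= m)%N then
      entrance_prob P K ([set w : walk d.+3 | w n = u] `&` [set w | w m = v]) else 0) =
    walk_green R u v.
  move=> uK.
  transitivity (\sum_(n <oo) (entrance_prob P K [set w | w n = u] * walk_green R u v)).
    apply: eq_eseriesr => n _.
    transitivity (\sum_(k <oo) (entrance_prob P K [set w | w n = u] * (walk_prob R k u v)%:E)).
      rewrite -(@nneseries_shift R (fun k =>
        entrance_prob P K [set w | w n = u] * (walk_prob R k u v)%:E) n); last first.
        by move=> k; rewrite mule_ge0 ?entrance_prob_ge0 ?lee_fin ?walk_prob_ge0.
      apply: eq_eseriesr => m _; case: ifP => // nm.
      by rewrite -entrance_coord2 subnKC.
    rewrite /walk_green [RHS]muleC ge0_nneseriesZr ?entrance_prob_ge0//.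
      by apply: eq_eseriesr => k _; rewrite muleC.
    by move=> k; rewrite lee_fin walk_prob_ge0.
  rewrite -ge0_nneseriesZr ?sum_entrance_coord ?mul1e//.
    by move=> n; exact: entrance_prob_ge0.
  by apply: nneseries_ge0 => k _ _; rewrite lee_fin walk_prob_ge0.
congr (_ + _); first exact: half.
(* After exchanging the sums, the pairs with [m <= n] are those of [half] with [x] and [y]
   swapped. *)
rewrite nneseries_interchange; last by move=> n m; case: ifP.
rewrite -[RHS](half y x yK); apply: eq_eseriesr => n _; apply: eq_eseriesr => m _.
by rewrite /E setIC.
Qed.

End entrance_moments.

Section intensity_moments.
Local Open Scope ereal_scope.
Context (d : nat) (R : realType).
Local Notation V := 'rV[int]_d.+3.
Local Notation W := (walk_space d.+3).
Local Notation traj := (traj d.+3 R).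
Local Notation traj_mod := (traj_mod d.+3 R).
Variable P : V -> probability W R.
Hypothesis hP : forall x, is_srw x (P x).
Variable Q : {fset V} -> {finite_measure set traj -> \bar R}.
Hypothesis hQ : forall K, is_QK P K (Q K).
Variable nu : {sigma_finite_measure set traj_mod -> \bar R}.
Hypothesis hnu : is_intensity Q nu.
Local Notation g := (green P).

(** Since [f] vanishes off [entering K], only measurable subsets of [entering K] matter, and on
    these [is_intensity] identifies [nu] with the image of [Q K]. *)
Lemma integral_intensity (K : {fset V}) (f : traj_mod -> \bar R) :
  measurable_fun setT f -> (forall z, 0 <= f z) ->
  (forall z, ~ entering K z -> f z = 0) ->
  \int[nu]_z f z = \int[Q K]_w f (pi_star w).
Proof.
move=> mf f0 fK.
have onK (m : {measure set traj_mod -> \bar R}) :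
    \int[m]_z f z = \int[m]_(z in entering K) f z.
  rewrite [RHS]integral_mkcond; apply: eq_integral => z _; rewrite patchE.
  by case: ifPn => //; rewrite notin_setE => /fK.
pose pf : {measure set traj_mod -> \bar R} := pushforward (Q K) (@pi_star d.+3 R).
have mpi := @measurable_pi_star d.+2 R.
transitivity (\int[pf mpi]_z f z).
  rewrite [LHS]onK [RHS]onK; apply: eq_measure_integral => A mA AK.
  rewrite -[RHS](hnu K mA); congr (nu _).
  by apply/esym/setIidPl.
by rewrite /pf/= ge0_integral_pushforward.
Qed.

Lemma mod_local_time_notin (K : {fset V}) x z :
  x \in K -> ~ entering K z -> mod_local_time x z = 0 :> \bar R.
Proof.
move=> xK zK; apply: local_time_eq0 => n; apply/eqP => zx; apply: zK.
exists (repr z); last exact: pi_star_repr.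
by exists n; rewrite zx.
Qed.

Lemma integral_mod_local_time x : \int[nu]_z mod_local_time x z = 1.
Proof.
have xK : x \in [fset x]%fset by rewrite inE.
rewrite (@integral_intensity [fset x]%fset)//.
- rewrite -[RHS](integral_local_time hP (hQ [fset x]%fset) xK).
  by apply: eq_integral => w _; exact: mod_local_time_pi_star.
- exact: measurable_mod_local_time.
- by move=> z; exact: mod_local_time_ge0.
- by move=> z; exact: mod_local_time_notin.
Qed.

Lemma walk_greenE x y : walk_green R x y = (g (x - y)%R)%:E.
Proof.
rewrite (greenE _ hP)// fineK.
  by apply: eq_eseriesr => n _; rewrite walk_prob_diff.
rewrite ge0_fin_numE; first exact: walk_green_fin.
by apply: nneseries_ge0 => n *; rewrite lee_fin walk_prob_ge0.
Qed.

Lemma green_opp x : g (- x)%R = g x.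
Proof.
apply: EFin_inj; rewrite -{1}[x]subr0 opprB -walk_greenE -[in RHS](subr0 x) -walk_greenE.
by apply: eq_eseriesr => n _; rewrite walk_prob_sym.
Qed.

Lemma integral_mod_local_time_mul x y :
  \int[nu]_z (mod_local_time x z * mod_local_time y z) = (2 * g (x - y)%R)%:E.
Proof.
have xK : x \in [fset x; y]%fset by rewrite !inE eqxx.
have yK : y \in [fset x; y]%fset by rewrite !inE eqxx orbT.
rewrite (@integral_intensity [fset x; y]%fset)//.
- transitivity (walk_green R x y + walk_green R y x).
    rewrite -(integral_local_time_mul hP (hQ [fset x; y]%fset) xK yK).
    by apply: eq_integral => w _; rewrite !mod_local_time_pi_star.
  by rewrite !walk_greenE -[g (y - x)%R]green_opp opprB -EFinD mulr_natl.
- by apply: emeasurable_funM; exact: measurable_mod_local_time.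
- by move=> z; rewrite mule_ge0// mod_local_time_ge0.
- by move=> z zK; rewrite (mod_local_time_notin xK)// mul0e.
Qed.

(** Signed combinations require real values; [fine] changes the local time only on a [nu]-null set,
    because its integral is finite. *)
Definition real_local_time (x : V) (z : traj_mod) : R := fine (mod_local_time x z).

Lemma measurable_real_local_time x : measurable_fun setT (real_local_time x).
Proof. by apply: measurableT_comp => //; exact: measurable_mod_local_time. Qed.

Lemma real_local_time_ge0 x z : (0 <= real_local_time x z)%R.
Proof. by rewrite fine_ge0// mod_local_time_ge0. Qed.

Lemma ae_real_local_time x :
  {ae nu, forall z, mod_local_time x z = (real_local_time x z)%:E}.
Proof.
have : nu.-integrable setT (mod_local_time x).
  apply/integrableP; split; first exact: measurable_mod_local_time.
  under eq_integral do rewrite gee0_abs ?mod_local_time_ge0//.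
  by rewrite integral_mod_local_time ltry.
move=> /(integrable_ae measurableT); apply: filterS => z /(_ I) fz.
by rewrite /real_local_time fineK.
Qed.

Lemma integral_real_local_time x : \int[nu]_z (real_local_time x z)%:E = 1.
Proof.
rewrite -(integral_mod_local_time x); apply: ge0_ae_eq_integral => //.
- by apply/measurable_EFinP; exact: measurable_real_local_time.
- exact: measurable_mod_local_time.
- by move=> z _; rewrite lee_fin real_local_time_ge0.
- by move=> z _; exact: mod_local_time_ge0.
- by have := ae_real_local_time x; apply: filterS => z -> _.
Qed.

Lemma integral_real_local_time_mul x y :
  \int[nu]_z (real_local_time x z * real_local_time y z)%:E = (2 * g (x - y)%R)%:E.
Proof.
rewrite -(integral_mod_local_time_mul x y); apply: ge0_ae_eq_integral => //.
- apply/measurable_EFinP; apply: measurable_funM; exact: measurable_real_local_time.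
- apply: emeasurable_funM; exact: measurable_mod_local_time.
- by move=> z _; rewrite lee_fin mulr_ge0// real_local_time_ge0.
- by move=> z _; rewrite mule_ge0// mod_local_time_ge0.
- have := ae_real_local_time x; have := ae_real_local_time y.
  by apply: filterS2 => z -> -> _; rewrite EFinM.
Qed.

Lemma integrable_real_local_time x :
  nu.-integrable setT (EFin \o real_local_time x).
Proof.
apply/integrableP; split; first by apply/measurable_EFinP; exact: measurable_real_local_time.
under eq_integral do rewrite /= ger0_norm ?real_local_time_ge0//.
by rewrite integral_real_local_time ltry.
Qed.

Lemma integrable_real_local_time_mul x y :
  nu.-integrable setT (fun z => (real_local_time x z * real_local_time y z)%:E).
Proof.
apply/integrableP; split.
  by apply/measurable_EFinP; apply: measurable_funM; exact: measurable_real_local_time.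
under eq_integral do rewrite /= ger0_norm ?mulr_ge0 ?real_local_time_ge0//.
by rewrite integral_real_local_time_mul ltry.
Qed.

End intensity_moments.

(** * Occupation times as Poisson integrals *)

Section interlacement_measure.
Local Open Scope ereal_scope.
Context (d : nat) (R : realType) dO (Omega : measurableType dO).
Variable PP : probability Omega R.
Local Notation traj_mod := (traj_mod d.+1 R).
Variable nu : {sigma_finite_measure set traj_mod -> \bar R}.
Variable omega : Omega -> nat -> traj_mod * R.
Hypothesis homega : is_interlacement PP nu omega.
Variable u : R.
Hypothesis u0 : (0 < u)%R.

(** Trajectories with label above [u] keep their place in the series with weight [0]. *)
Definition level_measure (w : Omega) : {measure set traj_mod -> \bar R} :=
  mseries (fun i => mscale (NngNum (ler0n R ((omega w i).2 <= u)%R))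
    (dirac (omega w i).1)) 0.

Definition level_intensity : {measure set traj_mod -> \bar R} :=
  mscale (NngNum (ltW u0)) nu.

Lemma level_measureE w A :
  level_measure w A = point_count R omega (A `*` `]-oo, u]) w.
Proof.
apply: eq_eseriesr => i _; rewrite /= /mscale/= !diracE in_setX -EFinM -natrM.
congr (_%:R%:E); rewrite mulnb andbC; congr (nat_of_bool (_ && _)).
by apply/idP/idP => [h|]; [rewrite inE/= in_itv|rewrite inE/= in_itv].
Qed.

Lemma level_intensityE A : measurable A ->
  interlacement_intensity nu (A `*` `]-oo, u]) = level_intensity A.
Proof.
move=> mA; rewrite /interlacement_intensity -setXI setIT.
rewrite product_measure1E//; last by apply: measurableI; exact: measurable_itv.
(* Negative labels have no intensity, so the half-line []-oo, u]] weighs as much as [[0, u]], namely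
   [u]. *)
rewrite (_ : _ `&` _ = `[0%R, u]%classic); last first.
  by apply/seteqP; split => x /=; rewrite !in_itv/= ?andbT; [move=> [-> ->]|move=> /andP[]].
have h : lebesgue_measure `[0%R, u]%classic = u%:E.
  by rewrite lebesgue_measure_itv/= lte_fin u0 -EFinB subr0.
rewrite -[RHS]/(u%:E * nu A) muleC; congr (_ * _); exact: h.
Qed.

Lemma level_measure_prm : poisson_random_measure PP level_measure level_intensity.
Proof.
have [_ [mp p1 _ p3]] := homega.
have mL A : measurable A -> measurable (A `*` `]-oo, u]%classic : set (traj_mod * R)).
  by move=> mA; apply: measurableX.
have E A : (fun w => level_measure w A) = point_count R omega (A `*` `]-oo, u]).
  by apply/funext => w; exact: level_measureE.
split.
- by move=> A mA; rewrite E; apply: mp; exact: mL.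
- move=> A k mA moo; rewrite -level_intensityE//.
  under eq_set do rewrite level_measureE.
  by apply: p1; [exact: mL|rewrite level_intensityE].
- move=> n D B mD tD mB.
  have := p3 n (fun i => D i `*` `]-oo, u]%classic) B (fun i => mL _ (mD i)) _ mB.
  have -> : \bigcap_i [set w | B i (level_measure w (D i))] =
      \bigcap_i (point_count R omega (D i `*` `]-oo, u]) @^-1` B i).
    by apply: eq_bigcapr => i _; apply/seteqP; split=> w /=; rewrite level_measureE.
  move=> ->.
    congr EFin; apply: eq_bigr => i _; congr (fine (PP _)).
    by apply/seteqP; split=> w /=; rewrite level_measureE.
  move=> i j _ _ [[z v] [[/= h1 _] [h2 _]]].
  by apply: tD => //; exists z.
Qed.

Lemma occupation_erealE x w :
  occupation_ereal omega x u w = \int[level_measure w]_z mod_local_time x z.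
Proof.
rewrite ge0_integral_measure_series//; last 2 first.
- by move=> z _; exact: mod_local_time_ge0.
- exact: measurable_mod_local_time.
apply: eq_eseriesr => i _.
rewrite ge0_integral_mscale//; last 2 first.
- exact: measurable_mod_local_time.
- by move=> z _; exact: mod_local_time_ge0.
rewrite integral_dirac//; last exact: measurable_mod_local_time.
rewrite diracT mul1e/= /mod_local_time /local_time.
case: (_ <= _)%R; rewrite ?mul1e ?mul0e.
  by apply: eq_esum => n _; rewrite andbT.
by apply: esum1 => n _; rewrite andbF mulr0.
Qed.

Lemma measurable_occupation x : measurable_fun setT (occupation omega x u).
Proof.
apply: measurableT_comp => //; rewrite (_ : occupation_ereal _ _ _ =
    (fun w => \int[level_measure w]_z mod_local_time x z)).
  have [mN _ _] := level_measure_prm.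
  apply: measurable_fun_integral_kernel => //; last exact: measurable_mod_local_time.
  by move=> z; exact: mod_local_time_ge0.
by apply/funext => w; exact: occupation_erealE.
Qed.

End interlacement_measure.

(** * Vanishing scales and second moments *)

Lemma cvg_Rintegral_dominated d (T : measurableType d) (R : realType)
    (m : {measure set T -> \bar R}) (f_ : nat -> T -> R) (f g : T -> R) :
  (forall n, measurable_fun setT (f_ n)) -> measurable_fun setT f ->
  (forall x, f_ n x @[n --> \oo] --> f x) ->
  m.-integrable setT (EFin \o g) -> (forall n x, `|f_ n x| <= g x) ->
  \int[m]_x f_ n x @[n --> \oo] --> \int[m]_x f x.
Proof.
move=> mf_ mf ff ig fg.
have [|||||iif _ L] := @dominated_convergence _ _ _ m setT measurableT
  (fun n => EFin \o f_ n) (EFin \o f) (EFin \o g).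
- by move=> n; exact/measurable_EFinP.
- exact/measurable_EFinP.
- by apply: aeW => x _ /=; apply: cvg_EFin; [exact: nearW|exact: ff].
- exact: ig.
- by apply: aeW => x n _ /=; rewrite lee_fin.
apply: fine_cvg; rewrite fineK; last exact: integrable_fin_num.
exact: L.
Qed.

Lemma cvg_sqr0 (R : realType) (s : nat -> R) :
  s n @[n --> \oo] --> (0 : R) -> s n ^+ 2 @[n --> \oo] --> (0 : R).
Proof.
move=> s0; have h : (s n * s n) @[n --> \oo] --> (0 * 0 : R) by exact: cvgM.
by rewrite mulr0 in h.
Qed.

Section small_scale_integrals.
Context dT (T : measurableType dT) (R : realType).
Variables (m : {measure set T -> \bar R}) (h : T -> R).
Hypothesis ih : m.-integrable setT (EFin \o h).
Hypothesis ih2 : m.-integrable setT (EFin \o (fun x => h x ^+ 2)).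

Let mh : measurable_fun setT h.
Proof. exact/measurable_EFinP/(measurable_int _ ih). Qed.

Let msh s : measurable_fun setT (fun x => s * h x).
Proof. exact: measurable_funM. Qed.

Let mcos s : measurable_fun setT (fun x => cos (s * h x) - 1).
Proof. by apply: measurable_funB => //; exact: measurable_cos_comp. Qed.

Let msin s : measurable_fun setT (fun x => sin (s * h x)).
Proof.
by apply: (@measurableT_comp _ _ _ _ _ _ (@sin R)) => //; exact: measurable_sin.
Qed.

Let normr_cosB1 (y : R) : `|cos y - 1| <= y ^+ 2 / 2.
Proof.
rewrite distrC ger0_norm ?subr_ge0 ?cos_le1//.
by have := cos_ge_quadratic y; rewrite lerBlDr addrC -lerBlDr.
Qed.

Let ih2Z (c : R) : m.-integrable setT (EFin \o (fun x => c * h x ^+ 2)).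
Proof. by have := integrableZl measurableT c ih2; apply: eq_integrable. Qed.

Lemma integrable_scale s : m.-integrable setT (EFin \o (fun x => s * h x)).
Proof. by have := integrableZl measurableT s ih; apply: eq_integrable. Qed.

Lemma integrable_cosB1 s : m.-integrable setT (EFin \o (fun x => cos (s * h x) - 1)).
Proof.
apply: (le_integrable measurableT _ _ (ih2Z (s ^+ 2 / 2))).
  exact/measurable_EFinP.
move=> x _ /=; rewrite lee_fin (le_trans (normr_cosB1 _))// ger0_norm.
  by rewrite exprMn mulrAC.
by rewrite mulr_ge0 ?sqr_ge0// divr_ge0 ?sqr_ge0.
Qed.

Lemma integrable_sin s : m.-integrable setT (EFin \o (fun x => sin (s * h x))).
Proof.
apply: (le_integrable measurableT _ _ (integrable_scale s)).
  exact/measurable_EFinP.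
by move=> x _ /=; rewrite lee_fin normr_sin_le.
Qed.

Lemma Rintegral_cosB1_bound s :
  `|\int[m]_x (cos (s * h x) - 1)| <= s ^+ 2 / 2 * \int[m]_x (h x ^+ 2).
Proof.
apply: (le_trans (le_normr_Rintegral measurableT (integrable_cosB1 s))).
rewrite -RintegralZl//; apply: le_Rintegral => //.
- by apply/integrable_norm/integrable_cosB1.
- by move=> x _; rewrite (le_trans (normr_cosB1 _))// exprMn mulrAC.
Qed.

Lemma Rintegral_sinB_bound s :
  `|\int[m]_x sin (s * h x) - s * \int[m]_x h x| <= s ^+ 2 / 2 * \int[m]_x (h x ^+ 2).
Proof.
rewrite -RintegralZl// -RintegralB//; last 2 first.
- exact: integrable_sin.
- exact: integrable_scale.
have iB := integrableB_EFin measurableT (integrable_sin s) (integrable_scale s).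
apply: (le_trans (le_normr_Rintegral measurableT iB)).
rewrite -RintegralZl//; apply: le_Rintegral => //.
- exact/integrable_norm.
- by move=> x _; rewrite (le_trans (normr_sinB_id _))// exprMn mulrAC.
Qed.

Section vanishing_scale.
Variable s : nat -> R.
Hypothesis s0 : s n @[n --> \oo] --> (0 : R).
Hypothesis s_neq0 : \forall n \near \oo, s n != 0.

(** The cubic error serves for pointwise convergence only. Domination comes from the quadratic
    bound, by [h ^ 2 / 2], so that a second moment of [h] suffices. *)
Let cvg_Rintegral_quadratic (r : R -> R) (l : R) : measurable_fun setT r ->
  (forall y, `|r y| <= y ^+ 2 / 2) -> (forall y, `|l * y ^+ 2 - r y| <= `|y| ^+ 3) ->
  \int[m]_x ((s n ^+ 2)^-1 * r (s n * h x)) @[n --> \oo] -->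
  l * \int[m]_x (h x ^+ 2).
Proof.
move=> mr r2 r3; rewrite -RintegralZl//.
apply: (@cvg_Rintegral_dominated _ _ _ _ _ _ (fun x => 2^-1 * h x ^+ 2)).
- by move=> n; apply: measurable_funM => //; exact: measurableT_comp.
- by apply: measurable_funM => //; exact: measurable_funX.
- move=> x; apply/cvgrPdist_le => e e0.
  have K : `|s n| * `|h x| ^+ 3 @[n --> \oo] --> (0 : R).
    rewrite -(mul0r (`|h x| ^+ 3)); apply: cvgM; last exact: cvg_cst.
    by rewrite -(normr0 R); exact: cvg_norm.
  near=> n.
  have sn : s n != 0 by near: n.
  have sn2 : 0 < s n ^+ 2 by rewrite exprn_even_gt0.
  apply: (@le_trans _ _ (`|s n| * `|h x| ^+ 3)); last first.
    apply: (le_trans (ler_norm _)); rewrite -[X in `|X|]subr0 distrC.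
    by near: n; move/cvgrPdist_le : K; apply.
  rewrite -(ler_pM2l sn2) -{1}(gtr0_norm sn2) -normrM mulrBr mulVKf ?gt_eqF//.
  rewrite mulrCA -exprMn (le_trans (r3 _))// normrM exprMn.
  by rewrite -(real_normK (num_real (s n))) [leRHS]mulrA -exprSr.
- exact: ih2Z.
- move=> n x; rewrite normrM ger0_norm ?invr_ge0 ?sqr_ge0//.
  (* Domination is required for every [n]; where [s n = 0] the integrand vanishes, as the inverse of
     zero is zero. *)
  have [->|sn] := eqVneq (s n) 0.
    by rewrite expr0n invr0 mul0r mulr_ge0 ?sqr_ge0.
  have sn2 : 0 < s n ^+ 2 by rewrite exprn_even_gt0.
  by rewrite ler_pdivrMl// (le_trans (r2 _))// exprMn -mulrA (mulrC (h x ^+ 2)).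
Unshelve. all: by end_near. Qed.

Lemma cvg_Rintegral_cosB1 :
  (\int[m]_x (cos (s n * h x) - 1)) / s n ^+ 2 @[n --> \oo] -->
  - (\int[m]_x (h x ^+ 2)) / 2.
Proof.
rewrite (_ : (fun n => _) =
    (fun n => \int[m]_x ((s n ^+ 2)^-1 * (cos (s n * h x) - 1)))); last first.
  by apply/funext => n; rewrite RintegralZl// 1?[RHS]mulrC//; exact: integrable_cosB1.
have -> : - (\int[m]_x (h x ^+ 2)) / 2 = - 2^-1 * \int[m]_x (h x ^+ 2).
  by rewrite mulrC mulrN mulNr.
apply: (@cvg_Rintegral_quadratic (fun y => cos y - 1)) => //.
  by apply: measurable_funB => //; exact: measurable_cos.
move=> y; have c1 := cos_ge_quadratic y; have c2 := cos_le_quartic y.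
have yE (k : nat) : y ^+ k.*2 = `|y| ^+ k.*2.
  by rewrite -!mul2n !exprM real_normK ?num_real.
rewrite (yE 1%N) in c1 c2 *; rewrite (yE 2%N) in c2; have y0 := normr_ge0 y.
have c3 := cos_le1 y; rewrite ler_norml.
move: c1 c2 c3 y0; move: `|y| (cos y) => a c c1 c2 c3 a0.
(* Up to [24] the quartic remainder [a ^ 4 / 24] is at most [a ^ 3]; beyond, [a ^ 2 / 2] already
   is. *)
have [a24|/ltW a24] := leP a 24.
  have : a ^+ 4 <= 24 * a ^+ 3 by rewrite exprS ler_wpM2r ?exprn_ge0.
  by have := exprn_ge0 3 a0; lra.
have : 24 * a ^+ 2 <= a ^+ 3 by rewrite [leRHS]exprS ler_wpM2r ?exprn_ge0.
by have := exprn_ge0 2 a0; lra.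
Qed.

Lemma cvg_Rintegral_sinB :
  (\int[m]_x sin (s n * h x) - s n * \int[m]_x h x) / s n ^+ 2 @[n --> \oo] --> (0 : R).
Proof.
rewrite (_ : (fun n => _) =
    (fun n => \int[m]_x ((s n ^+ 2)^-1 * (sin (s n * h x) - s n * h x)))); last first.
  apply/funext => n; have i1 := integrable_sin (s n); have i2 := integrable_scale (s n).
  rewrite RintegralZl//; last exact: integrableB_EFin.
  by rewrite RintegralB// RintegralZl// mulrC.
rewrite -[X in _ --> X](mul0r (\int[m]_x (h x ^+ 2))).
apply: (@cvg_Rintegral_quadratic (fun y => sin y - y)) => [|y|y].
- by apply: measurable_funB => //; exact: measurable_sin.
- exact: normr_sinB_id.
- rewrite mul0r sub0r normrN (le_trans (normr_sinB_id_cubic _))//.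
  by rewrite ler_piMr ?exprn_ge0// invf_le1// ler1n.
Qed.

End vanishing_scale.
End small_scale_integrals.

(** * Second moments of Poisson integrals *)

Section poisson_second_moment.
Context (R : realType) dO (Omega : measurableType dO) (PP : probability Omega R).
Context dT (T : measurableType dT).
Variables (N : Omega -> {measure set T -> \bar R}) (m : {measure set T -> \bar R}).
Hypothesis prm : poisson_random_measure PP N m.
Variable h : T -> R.
Hypothesis ih : m.-integrable setT (EFin \o h).
Hypothesis ih2 : m.-integrable setT (EFin \o (fun x => h x ^+ 2)).

Lemma prm_char_scale t a : \int[PP]_w cos (t * \int[N w]_x h x + a) =
  expR (\int[m]_x (cos (t * h x) - 1)) * cos (\int[m]_x sin (t * h x) + a).
Proof.
rewrite -(prm_char prm a (integrable_scale ih t)).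
have mh : measurable_fun setT h by exact/measurable_EFinP/(measurable_int _ ih).
congr fine; apply: ae_eq_integral => //.
- apply/measurable_EFinP/measurable_cos_comp; apply: measurable_funD => //.
  by apply: measurable_funM => //; exact: (measurable_prm_Rintegral prm).
- apply/measurable_EFinP/measurable_cos_comp; apply: measurable_funD => //.
  by apply: (measurable_prm_Rintegral prm); exact: measurable_funM.
- have := prm_ae_integrable prm ih; apply: filterS => w iw _.
  by rewrite RintegralZl.
Qed.

(* Fatou along [t = 1 / (k + 1)] in [2 (1 - cos (t S)) / t ^ 2 --> S ^ 2] *)
Lemma prm_sqr_le : (\int[PP]_w ((\int[N w]_x h x) ^+ 2)%:E <=
  (\int[m]_x (h x ^+ 2) +
   (`|\int[m]_x h x| + (\int[m]_x (h x ^+ 2)) / 2) ^+ 2)%:E)%E.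
Proof.
set V := \int[m]_x (h x ^+ 2); set M := \int[m]_x h x.
have V0 : 0 <= V by apply: Rintegral_ge0 => x _; exact: sqr_ge0.
pose S w := \int[N w]_x h x.
have mS : measurable_fun setT S.
  by apply: (measurable_prm_Rintegral prm); exact/measurable_EFinP/(measurable_int _ ih).
pose t (k : nat) : R := k.+1%:R^-1.
have t0 k : 0 < t k by rewrite invr_gt0.
have t1 k : t k <= 1 by rewrite invf_le1// ler1n.
pose F k w := 2 * (1 - cos (t k * S w)) / t k ^+ 2.
have F0 k w : 0 <= F k w.
  by rewrite /F divr_ge0 ?sqr_ge0// mulr_ge0// subr_ge0 cos_le1.
have mF k : measurable_fun setT (F k).
  apply: measurable_funM => //; apply: measurable_funM => //.
  by apply: measurable_funB => //; apply: measurable_cos_comp; exact: measurable_funM.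
have FS w : F k w @[k --> \oo] --> S w ^+ 2.
  have K : t k ^+ 2 * (S w ^+ 4 / 12) @[k --> \oo] --> (0 : R).
    rewrite -(mul0r (S w ^+ 4 / 12)); apply: cvgM; last exact: cvg_cst.
    by apply: cvg_sqr0; exact: cvg_harmonic.
  apply/cvgrPdist_le => e e0; near=> k.
  apply: (@le_trans _ _ (t k ^+ 2 * (S w ^+ 4 / 12))); last first.
    apply: (le_trans (ler_norm _)); rewrite -[X in `|X|]subr0 distrC.
    by near: k; move/cvgrPdist_le : K; apply.
  have t2 : 0 < t k ^+ 2 by rewrite exprn_gt0.
  have c1 := cos_ge_quadratic (t k * S w); have c2 := cos_le_quartic (t k * S w).
  rewrite -(ler_pM2l t2) -{1}(gtr0_norm t2) -normrM mulrBr /F [X in _ - X]mulrC divfK ?gt_eqF//.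
  by rewrite !exprMn in c1 c2; rewrite ler_norml; apply/andP; split; nra.
(* By [prm_char_scale] the mean is [2 (1 - exp A cos B) / t ^ 2] with [A <= 0], and [1 - exp A cos B
   <= - A + (1 - cos B) <= - A + B ^ 2 / 2], where [A] is of order [t ^ 2] and [B] of order [t]. *)
have EF k : (\int[PP]_w (F k w)%:E <= (V + (`|M| + V / 2) ^+ 2)%:E)%E.
  have iC : PP.-integrable setT (EFin \o (fun w => cos (t k * S w))).
    apply: (@integrable_bounded _ _ _ _ _ _ 1) => //.
      by apply: measurable_cos_comp; exact: measurable_funM.
    by move=> w; rewrite ler_norml cos_geN1 cos_le1.
  have i1 : PP.-integrable setT (EFin \o cst (1 : R)).
    by apply: (@integrable_bounded _ _ _ _ _ _ 1) => // w; rewrite normr1.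
  have i2 := integrableB_EFin measurableT i1 iC.
  rewrite (_ : (\int[PP]_w _)%E = (2 / t k ^+ 2 * (1 - \int[PP]_w cos (t k * S w)))%:E); last first.
    transitivity (\int[PP]_w ((2 / t k ^+ 2)%:E * (1 - cos (t k * S w))%:E))%E.
      by apply: eq_integral => w _; rewrite -EFinM mulrAC.
    rewrite integralZl// [RHS]EFinM; congr (_ * _)%E.
    rewrite -[LHS]fineK; last exact: integrable_fin_num.
    rewrite -/(Rintegral _ _ _) RintegralB// /Rintegral integral_cst//=.
    by rewrite probability_setT mule1.
  have -> : \int[PP]_w cos (t k * S w) =
      expR (\int[m]_x (cos (t k * h x) - 1)) * cos (\int[m]_x sin (t k * h x)).
    have := prm_char_scale (t k) 0; rewrite addr0 => <-.
    by apply: eq_Rintegral => w _; rewrite addr0.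
  rewrite lee_fin.
  set A := \int[m]_x (cos _ - 1); set B := \int[m]_x sin _.
  have t2 : 0 < t k ^+ 2 by rewrite exprn_gt0.
  have A1 : `|A| <= t k ^+ 2 / 2 * V by exact: Rintegral_cosB1_bound.
  have A0 : A <= 0.
    rewrite -oppr_ge0 -mulN1r /A -RintegralZl//; last exact: integrable_cosB1.
    by apply: Rintegral_ge0 => x _; rewrite mulN1r opprB subr_ge0 cos_le1.
  have B1 : `|B - t k * M| <= t k ^+ 2 / 2 * V by exact: Rintegral_sinB_bound.
  (* Here [t k <= 1] absorbs the quadratic error; this produces the summand [V / 2], which the exact
     second moment would not contain. *)
  have B2 : `|B| <= t k * (`|M| + V / 2).
    rewrite -[B](subrK (t k * M)) (le_trans (ler_normD _ _))//.
    rewrite mulrDr addrC normrM (gtr0_norm (t0 k)) lerD2l (le_trans B1)//.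
    have G (a b : R) : 0 < a -> a <= 1 -> 0 <= b -> a ^+ 2 / 2 * b <= a * (b / 2).
      by move=> a0 a1 b0; have := mulr_ge0 (ltW a0) b0; nra.
    exact: G.
  have B3 : B ^+ 2 <= t k ^+ 2 * (`|M| + V / 2) ^+ 2.
    rewrite -exprMn -(real_normK (num_real B)) ler_pXn2r// nnegrE//.
    by rewrite mulr_ge0 ?(ltW (t0 k))// addr_ge0// divr_ge0.
  have eA : 1 + A <= expR A by exact: expR_ge1Dx.
  have eA1 : expR A <= 1 by rewrite -expR0 ler_expR.
  have eA0 := expR_ge0 A.
  have cB := cos_ge_quadratic B; have cB1 := cos_le1 B.
  rewrite mulrAC ler_pdivrMr//.
  have A2 : - A <= t k ^+ 2 / 2 * V by rewrite -(ler0_norm A0).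
  move: A2 B3 eA eA1 eA0 cB cB1; move: (t k ^+ 2) (B ^+ 2) (cos B) (expR A) => a b c e.
  move: ((`|M| + V / 2) ^+ 2) => D *.
  have : e * (1 - c) <= 1 - c by nra.
  nra.
apply: (@le_trans _ _ (limn_einf (fun k => \int[PP]_w (F k w)%:E))%E).
  rewrite (_ : (\int[PP]_w _)%E = (\int[PP]_w limn_einf (fun k => (F k w)%:E))%E).
    apply: fatou => //.
    - by move=> k; exact/measurable_EFinP.
    - by move=> k w _; rewrite lee_fin.
  apply: eq_integral => w _; apply/esym.
  have L : (F k w)%:E @[k --> \oo] --> (S w ^+ 2)%:E.
    by apply: cvg_EFin; [exact: nearW|exact: FS].
  rewrite is_cvg_limn_einfE; first exact/cvg_lim.
  by apply/cvg_ex; eexists; exact: L.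
rewrite limn_einf_lim; apply: lime_le; first exact: is_cvg_einfs.
apply: nearW => k; apply: le_trans (EF k); apply: ereal_inf_lbound.
by exists k => //=.
Unshelve. all: by end_near. Qed.

End poisson_second_moment.

(** * Gaussian characteristic functions *)

Section normal_moments.
Context (R : realType).
Local Notation mu := (@lebesgue_measure R).

(** The fundamental theorem of calculus on growing symmetric intervals, then dominated convergence.
    It supplies the boundary terms of Gaussian integration by parts. *)
Lemma integral_derive_line (F f : R -> R) : continuous f ->
  (forall x : R, is_derive x 1 F (f x)) -> mu.-integrable setT (EFin \o f) ->
  F n.+1%:R @[n --> \oo] --> (0 : R) -> F (- n.+1%:R) @[n --> \oo] --> (0 : R) ->
  \int[mu]_x f x = 0.
Proof.
move=> cf dF fi Fp Fm.
have cF : continuous F by apply: derivable_continuous => x; exact: ex_derive.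
pose J (n : nat) := `[- n.+1%:R, n.+1%:R : R]%classic.
have mJ n : measurable (J n) by exact: measurable_itv.
have mf : measurable_fun setT f by exact: continuous_measurable_fun.
have mfJ n : measurable_fun setT (fun x : R => f x * \1_(J n) x).
  by apply: measurable_funM => //; exact: measurable_indic.
have FTC n : \int[mu]_x (f x * \1_(J n) x) = F n.+1%:R - F (- n.+1%:R).
  transitivity (\int[mu]_(x in J n) f x).
    rewrite /Rintegral [in RHS]integral_mkcond; congr fine; apply: eq_integral => x _.
    by rewrite patchE indicE; case: ifP => _; rewrite ?mulr1 ?mulr0.
  rewrite /Rintegral (@continuous_FTC2 _ f F)//.
  - by rewrite gtrN.
  - exact: continuous_subspaceT.
  - split; first by move=> x _; exact: ex_derive.
      exact/cvg_at_right_filter/cF.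
    exact/cvg_at_left_filter/cF.
  - by move=> x _; rewrite derive1E; exact: derive_val.
have L : \int[mu]_x (f x * \1_(J n) x) @[n --> \oo] --> \int[mu]_x f x.
  apply: (@cvg_Rintegral_dominated _ _ _ mu (fun n x => f x * \1_(J n) x) f (fun x => `|f x|)) => //.
  - move=> x; apply: cvg_near_cst; exists `|Num.ceil `|x| |%N => // n /= xn.
    rewrite indicE mem_set ?mulr1// /J/= in_itv/= -ler_norml.
    rewrite (le_trans (ceil_ge _))// (le_trans (ler_norm _))// -intr_norm.
    by rewrite -natr_absz ler_nat (leq_trans xn).
  - exact: integrable_norm.
  - by move=> n x; rewrite normrM indicE ler_piMr// normr_nat lern1 leq_b1.
apply: (cvg_unique _ L) => //=.
under eq_fun do rewrite FTC.
by rewrite -(subr0 (0 : R)); apply: cvgB.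
Qed.

Variable s : R.
Hypothesis s_neq0 : s != 0.
Local Notation p := (normal_pdf 0 s).

Let s2_gt0 : 0 < s ^+ 2. Proof. by rewrite exprn_even_gt0. Qed.

Let pE x : p x = normal_peak s * expR (- x ^+ 2 / (s ^+ 2 *+ 2)).
Proof. by rewrite normal_pdfE// /normal_fun subr0. Qed.

Let is_derive_pdf (x : R) : is_derive x 1 p (- (x / s ^+ 2) * p x).
Proof.
rewrite (_ : p = (fun x => normal_peak s * expR (- x ^+ 2 / (s ^+ 2 *+ 2)))); last first.
  by apply/funext => y; exact: pE.
by apply: is_derive_eq; rewrite /GRing.scale/=; field.
Qed.

Let cont_pdf : continuous p. Proof. exact: continuous_normal_pdf. Qed.

Let p_ge0 x : 0 <= p x. Proof. exact: normal_pdf_ge0. Qed.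

Let mp : measurable_fun setT p. Proof. exact: measurable_normal_pdf. Qed.

Let ip : mu.-integrable setT (EFin \o p). Proof. exact: integrable_normal_pdf. Qed.

Let int_p : \int[mu]_x p x = 1.
Proof. by rewrite /Rintegral integral_normal_pdf. Qed.

(* [exp (- y) <= 1 / y] trades a quarter of the exponent for the factor [x ^ 2] *)
Let sqr_pdf_le : exists2 C, 0 <= C & forall x, x ^+ 2 * p x <= C * normal_pdf 0 (2 * s) x.
Proof.
have s2_neq0 : 2 * s != 0 by rewrite mulf_neq0.
have pk0 := normal_peak_gt0 s_neq0; have pk20 := normal_peak_gt0 s2_neq0.
exists (4 * s ^+ 2 * normal_peak s / normal_peak (2 * s)).
  by apply: divr_ge0; [apply: mulr_ge0; [apply: mulr_ge0 => //; exact: ltW|exact: ltW]|exact: ltW].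
move=> x; rewrite pE normal_pdfE// /normal_fun subr0 [leRHS]mulrA divfK ?gt_eqF//.
rewrite mulrCA [leRHS](_ : _ = normal_peak s *
  (4 * s ^+ 2 * expR (- x ^+ 2 / ((2 * s) ^+ 2 *+ 2)))); last by ring.
rewrite ler_pM2l//.
have -> : - x ^+ 2 / (s ^+ 2 *+ 2) =
    - x ^+ 2 / ((2 * s) ^+ 2 *+ 2) + - (3 * x ^+ 2 / (8 * s ^+ 2)) by field.
rewrite expRD mulrCA [leRHS]mulrC ler_pM2l ?expR_gt0// expRN.
rewrite ler_pdivrMr ?expR_gt0//.
have y0 : 0 <= 3 * x ^+ 2 / (8 * s ^+ 2) by apply: divr_ge0; apply: mulr_ge0 => //; exact: sqr_ge0.
have H : 1 + 3 * x ^+ 2 / (8 * s ^+ 2) <= expR (3 * x ^+ 2 / (8 * s ^+ 2)).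
  by apply: expR_ge1Dx; rewrite (le_trans _ y0)// lerN10.
apply: (@le_trans _ _ (4 * s ^+ 2 * (3 * x ^+ 2 / (8 * s ^+ 2)))).
  rewrite (_ : _ * (_ / _) = 3 / 2 * x ^+ 2); last by field.
  by rewrite ler_peMl ?sqr_ge0//; lra.
apply: ler_wpM2l; first by apply: mulr_ge0 => //; exact: ltW.
by apply: le_trans H; rewrite lerDr.
Qed.

Lemma integrable_sqr_normal_pdf : mu.-integrable setT (EFin \o (fun x => x ^+ 2 * p x)).
Proof.
have [C C0 HC] := sqr_pdf_le.
have i2 : mu.-integrable setT (EFin \o (fun x => C * normal_pdf 0 (2 * s) x)).
  have := integrableZl measurableT C (integrable_normal_pdf 0 (2 * s)).
  exact: eq_integrable.
apply: (le_integrable measurableT _ _ i2).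
  apply/measurable_EFinP; apply: measurable_funM => //; exact: measurable_funX.
move=> x _ /=; rewrite lee_fin !ger0_norm//; last by rewrite mulr_ge0// sqr_ge0.
by rewrite mulr_ge0// normal_pdf_ge0.
Qed.

Let le_pdf (q : R -> R) (D : R) : measurable_fun setT q ->
  (forall x, `|q x| <= D * (1 + x ^+ 2)) ->
  mu.-integrable setT (EFin \o (fun x => q x * p x)).
Proof.
move=> mq hq.
have i2 : mu.-integrable setT (EFin \o (fun x => D * (p x + x ^+ 2 * p x))).
  have := integrableZl measurableT D (integrableD measurableT ip integrable_sqr_normal_pdf).
  exact: eq_integrable.
apply: (le_integrable measurableT _ _ i2).
  by apply/measurable_EFinP; exact: measurable_funM.
move=> x _ /=; rewrite lee_fin normrM (ger0_norm (p_ge0 x)).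
apply: le_trans (ler_norm _); rewrite -{2}[p x]mul1r -mulrDl mulrA ler_wpM2r//.
Qed.

Let cvg_pdf (q : R -> R) (e : R) : `|e| = 1 -> (forall x, `|q x| <= 1 + `|x|) ->
  (q (e * n.+1%:R) * p (e * n.+1%:R)) @[n --> \oo] --> (0 : R).
Proof.
move=> e1 hq; have [C C0 HC] := sqr_pdf_le.
have s2_neq0 : 2 * s != 0 by rewrite mulf_neq0.
pose K := 2 * C * normal_peak (2 * s).
have K0 : 0 <= K by rewrite !mulr_ge0// normal_peak_ge0.
have L : K * n.+1%:R^-1 @[n --> \oo] --> (0 : R).
  by rewrite -(mulr0 K); apply: cvgM; [exact: cvg_cst|exact: cvg_harmonic].
apply/cvgrPdist_le => eps eps0; near=> n.
rewrite sub0r normrN; apply: (@le_trans _ _ (K * n.+1%:R^-1)); last first.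
  apply: (le_trans (ler_norm _)); rewrite -[X in `|X|]subr0 distrC.
  by near: n; move/cvgrPdist_le : L; apply.
set x := e * n.+1%:R.
have xn : `|x| = n.+1%:R by rewrite normrM e1 mul1r normr_nat.
rewrite normrM (ger0_norm (p_ge0 x)) ler_pdivlMr//.
apply: (@le_trans _ _ (2 * (x ^+ 2 * p x))).
  rewrite -xn -(real_normK (num_real x)) [leLHS]mulrAC mulrA ler_wpM2r//.
  have := hq x; have x1 : 1 <= `|x| by rewrite xn ler1n.
  by move: (`|q x|) (`|x|) x1 => a b *; nra.
apply: (@le_trans _ _ (2 * (C * normal_pdf 0 (2 * s) x))).
  by rewrite ler_pM2l.
by rewrite /K -(mulrA 2) ler_pM2l// ler_wpM2l// normal_pdf_ub.
Unshelve. all: by end_near. Qed.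

(** Stein's identity: since the density satisfies [p' = - x p / s ^ 2], the function [q p] has
    derivative [dq p - x q p / s ^ 2], and it vanishes at both ends of the line. *)
Let stein (q dq : R -> R) (D : R) : (forall x : R, is_derive x 1 q (dq x)) -> continuous dq ->
  (forall x, `|q x| <= 1 + `|x|) -> (forall x, `|dq x| <= D * (1 + x ^+ 2)) ->
  (forall x, `|x * q x| <= 1 + x ^+ 2) ->
  \int[mu]_x (x * q x * p x) = s ^+ 2 * \int[mu]_x (dq x * p x).
Proof.
move=> dqE cdq q1 dq1 xq1.
have cq : continuous q by apply: derivable_continuous => x; exact: ex_derive.
have mq : measurable_fun setT q by exact: continuous_measurable_fun.
have mdq : measurable_fun setT dq by exact: continuous_measurable_fun.
have i1 := le_pdf mdq dq1.
have i2 : mu.-integrable setT (EFin \o (fun x => x * q x * p x)).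
  by apply: (@le_pdf _ 1) => [|x]; [exact: measurable_funM|rewrite mul1r].
have i3 : mu.-integrable setT (EFin \o (fun x => (s ^+ 2)^-1 * (x * q x * p x))).
  by have := integrableZl measurableT (s ^+ 2)^-1 i2; apply: eq_integrable.
have := @integral_derive_line (fun x => q x * p x)
  (fun x => dq x * p x - (s ^+ 2)^-1 * (x * q x * p x)).
rewrite RintegralB// RintegralZl// => H.
have {}H : \int[mu]_x (dq x * p x) - (s ^+ 2)^-1 * \int[mu]_x (x * q x * p x) = 0.
  apply: H.
  - move=> x; apply: cvgB; first by apply: cvgM; [exact: cdq|exact: cont_pdf].
    apply: cvgM; first exact: cvg_cst.
    apply: cvgM; last exact: cont_pdf.
    by apply: cvgM; [exact: cvg_id|exact: cq].
  - move=> x; have dq_ := dqE x; have dp := is_derive_pdf x; apply: is_derive_eq.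
    by rewrite /GRing.scale/=; field.
  - exact: integrableB_EFin.
  - by have := @cvg_pdf q 1 (normr1 _) q1; under eq_fun do rewrite mul1r.
  - have := @cvg_pdf q (-1) _ q1; rewrite normrN1 => /(_ erefl).
    by under eq_fun do rewrite mulN1r.
move/eqP: H; rewrite subr_eq0 => /eqP ->.
by rewrite mulrA divff ?mul1r// gt_eqF.
Qed.

Lemma normal_pdf_sqr : \int[mu]_x (x ^+ 2 * p x) = s ^+ 2.
Proof.
have := @stein id (cst 1) 1; rewrite (_ : \int[mu]_x (cst 1 x * p x) = 1); last first.
  by under eq_Rintegral do rewrite mul1r.
rewrite mulr1 => <-.
- by apply: eq_Rintegral => x _; rewrite expr2.
- exact: cst_continuous.
- by move=> x; rewrite lerDr.
- by move=> x; rewrite normr1 mul1r lerDl sqr_ge0.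
- by move=> x; rewrite -expr2 ger0_norm ?sqr_ge0// lerDr.
Qed.

Lemma integrable_cos_normal_pdf (t a : R) :
  mu.-integrable setT (EFin \o (fun x => cos (t * x + a) * p x)).
Proof.
apply: (@le_pdf _ 1) => [|x].
  apply: measurable_cos_comp; apply: measurable_funD => //; exact: measurable_funM.
rewrite mul1r (@le_trans _ _ 1) ?lerDl ?sqr_ge0//.
by rewrite ler_norml cos_geN1 cos_le1.
Qed.

Lemma normal_pdf_char (t a : R) :
  \int[mu]_x (cos (t * x + a) * p x) = expR (- (s ^+ 2 * t ^+ 2 / 2)) * cos a.
Proof.
(* Gaussian integration by parts yields [phi' t = - s ^ 2 * t * phi t]. *)
pose phi (t : R) := \int[mu]_x (cos (t * x + a) * p x).
have mlin (u : R) : measurable_fun setT (fun x : R => u * x + a).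
  by apply: measurable_funD => //; exact: measurable_funM.
have msin (u : R) : measurable_fun setT (fun x : R => sin (u * x + a)).
  by apply: (@measurableT_comp _ _ _ _ _ _ (@sin R)) => //; exact: measurable_sin.
have cos1 (y : R) : `|cos y| <= 1 by rewrite ler_norml cos_geN1 cos_le1.
have sin1 (y : R) : `|sin y| <= 1 by rewrite ler_norml sin_geN1 sin_le1.
have le1 (x : R) : 1 <= 1 + x ^+ 2 by rewrite lerDl sqr_ge0.
have lex (x : R) : `|x| <= 1 + x ^+ 2.
  by rewrite -(real_normK (num_real x)); have := normr_ge0 x; move: `|x| => y ?; nra.
have icos u := integrable_cos_normal_pdf u a.
have dc (x u : R) : is_derive u 1 (fun u => cos (u * x + a) * p x) (- x * sin (u * x + a) * p x).
  by apply: is_derive_eq; rewrite /GRing.scale/=; ring.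
have dphi (u : R) : is_derive u 1 phi (- (s ^+ 2 * u) * phi u).
  have uI : `]u - 1, u + 1[%classic u by rewrite /= in_itv/= ltrBlDr ltrDl ltr01.
  have iG : mu.-integrable setT (EFin \o (fun x => `|x| * p x)).
    by apply: (@le_pdf _ 1) => [|x]; [exact: normr_measurable|rewrite normr_id mul1r; exact: lex].
  have G0 (x : R) : 0 <= `|x| * p x by rewrite mulr_ge0.
  have pE' v x : partial1of2 (fun u x => cos (u * x + a) * p x) v x =
      - x * sin (v * x + a) * p x.
    by rewrite /partial1of2 derive1E; exact: derive_val.
  have bd (v x : R) : `]u - 1, u + 1[%classic v -> setT x ->
      `|partial1of2 (fun u x => cos (u * x + a) * p x) v x| <= `|x| * p x.
    move=> _ _; rewrite pE' !normrM normrN (ger0_norm (p_ge0 x)) ler_wpM2r//.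
    by rewrite ler_piMr.
  have dv (v x : R) : `]u - 1, u + 1[%classic v -> setT x ->
      derivable (fun v' : R => cos (v' * x + a) * p x) (v : R) 1 by move=> _ _; exact: ex_derive.
  have D1 := derivable_under_integral measurableT uI (fun v _ => icos v) dv G0 iG bd.
  have D2 := differentiation_under_integral measurableT uI (fun v _ => icos v) dv G0 iG bd.
  apply: DeriveDef; first exact: D1.
  transitivity (\int[mu]_x (- x * sin (u * x + a) * p x)).
    by rewrite -derive1E [LHS]D2; apply: eq_Rintegral => x _; exact: pE'.
  transitivity (- \int[mu]_x (x * sin (u * x + a) * p x)).
    rewrite -mulN1r -RintegralZl//.
      by apply: eq_Rintegral => x _; rewrite mulN1r !mulNr.
    apply: (@le_pdf _ 1) => [|x]; first exact: measurable_funM.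
    by rewrite mul1r normrM (le_trans _ (lex x))// ler_piMr.
  have dsin (x : R) : is_derive x 1 (fun x => sin (u * x + a)) (u * cos (u * x + a)).
    by apply: is_derive_eq; rewrite /GRing.scale/=; ring.
  rewrite (stein (D := `|u|) dsin).
  - rewrite mulNr; congr (- _); rewrite [RHS](_ : _ = s ^+ 2 * (u * phi u)); last by rewrite mulrA.
    congr (_ * _); rewrite /phi -RintegralZl//.
    by apply: eq_Rintegral => x _; rewrite mulrA.
  - apply: (derivable_continuous (F := fun x => u * cos (u * x + a))) => x; exact: ex_derive.
  - by move=> x; rewrite (le_trans (sin1 _))// lerDl.
  - by move=> x; rewrite normrM ler_wpM2l// (le_trans (cos1 _)).
  - by move=> x; rewrite normrM (le_trans _ (lex x))// ler_piMr.
have phi0 : phi 0 = cos a.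
  transitivity (\int[mu]_x (cos a * p x)).
    by apply: eq_Rintegral => x _; rewrite mul0r add0r.
  by rewrite RintegralZl// int_p mulr1.
rewrite -/(phi t); clearbody phi.
pose psi (u : R) := phi u * expR (s ^+ 2 * u ^+ 2 / 2).
have dpsi (u : R) : is_derive u 1 psi 0.
  by have du := dphi u; rewrite /psi; apply: is_derive_eq; rewrite /GRing.scale/=; field.
have := @is_derive_0_is_cst R psi t 0 dpsi.
rewrite /psi phi0 expr0n/= mulr0 mul0r expR0 mulr1 => <-.
by rewrite mulrCA -expRD addNr expR0 mulr1.
Qed.

End normal_moments.

Section centered_normal_variable.
Context (R : realType) dO (Omega : measurableType dO) (PP : probability Omega R).
Variable Y : Omega -> R.
Hypothesis mY : measurable_fun setT Y.
Hypothesis hY : centered_normal PP Y.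

(** The variance [v] is left to be identified from the covariance later; the Dirac mass at [0] fits
    the same formula with [v = 0]. *)
Lemma centered_normal_char : exists v : R, (\int[PP]_w (Y w ^+ 2)%:E = v%:E)%E /\
  forall a, \int[PP]_w cos (Y w + a) = expR (- (v / 2)) * cos a.
Proof.
have [s hs] := hY.
have mY' : measurable_fun setT (Y : Omega -> measurableTypeR R) by exact: mY.
pose pf : {measure set (measurableTypeR R) -> \bar R} :=
  pushforward PP (Y : Omega -> measurableTypeR R).
have pfE (f : R -> R) : measurable_fun setT f -> (forall x, 0 <= f x) ->
    (\int[PP]_w (f (Y w))%:E = \int[pf mY']_x (f x)%:E)%E.
  move=> mf f0; rewrite /pf/= ge0_integral_pushforward//.
    exact/measurable_EFinP.
  by move=> x _; rewrite lee_fin.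
have msq : measurable_fun setT (fun x : R => x ^+ 2) by exact: measurable_funX.
(* Adding [1] makes the integrand nonnegative. *)
have mc a : measurable_fun setT (fun x : R => 1 + cos (x + a)).
  apply: measurable_funD => //; apply: measurable_cos_comp.
  exact: measurable_funD.
have c0 (a x : R) : 0 <= 1 + cos (x + a) by rewrite -lerBlDl sub0r cos_geN1.
have icos a : PP.-integrable setT (EFin \o (fun w => cos (Y w + a))).
  apply: (@integrable_bounded _ _ _ _ _ _ 1) => //.
    by apply: measurable_cos_comp; exact: measurable_funD.
  by move=> w; rewrite ler_norml cos_geN1 cos_le1.
have i1 : PP.-integrable setT (EFin \o cst (1 : R)).
  by apply: (@integrable_bounded _ _ _ _ _ _ 1) => // w; rewrite normr1.
have E1 a : \int[PP]_w cos (Y w + a) = fine (\int[pf mY']_x (1 + cos (x + a))%:E) - 1.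
  rewrite -pfE// -/(Rintegral PP setT (fun w => 1 + cos (Y w + a))) RintegralD//.
  rewrite [X in X + _ - 1](_ : _ = 1); first by rewrite addrAC subrr add0r.
  by rewrite /Rintegral integral_cst//= probability_setT mule1.
have [s0|s_neq0] := eqVneq s 0.
  pose dl : {measure set (measurableTypeR R) -> \bar R} := dirac (0 : measurableTypeR R).
  have pfd A : measurable A -> pf mY' A = dl A.
    by move=> mA; rewrite -[LHS]/(PP (Y @^-1` A)) hs// s0 eqxx.
  exists 0; split=> [|a].
    rewrite (pfE (fun x => x ^+ 2))//; last by move=> x; exact: sqr_ge0.
    rewrite (eq_measure_integral dl) => [|A mA _]; last exact: pfd.
    by rewrite integral_dirac ?expr0n ?mule0//; exact/measurable_EFinP.
  rewrite E1 (eq_measure_integral dl) => [|A mA _]; last exact: pfd.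
  rewrite integral_dirac//; last by apply/measurable_EFinP; exact: mc.
  by rewrite diracT mul1e/= add0r addrAC subrr add0r mul0r oppr0 expR0 mul1r.
have dens (f : R -> R) : measurable_fun setT f -> (forall x, 0 <= f x) ->
    (\int[pf mY']_x (f x)%:E = \int[lebesgue_measure]_x (f x * normal_pdf 0 s x)%:E)%E.
  move=> mf f0; rewrite [LHS](@ge0_integral_density _ _ _ lebesgue_measure (pf mY') (normal_pdf 0 s))//.
  - exact: measurable_normal_pdf.
  - exact: normal_pdf_ge0.
  - by move=> A mA; rewrite -[LHS]/(PP (Y @^-1` A)) hs// (negbTE s_neq0).
  - exact/measurable_EFinP.
have Hs := normal_pdf_sqr s_neq0.
exists (s ^+ 2); split=> [|a].
  rewrite (pfE (fun x => x ^+ 2))//; last by move=> x; exact: sqr_ge0.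
  rewrite (dens (fun x => x ^+ 2))//; last by move=> x; exact: sqr_ge0.
  rewrite -Hs /Rintegral fineK//; apply: integrable_fin_num => //.
  exact: integrable_sqr_normal_pdf.
rewrite E1 (dens (fun x => 1 + cos (x + a)))// -/(Rintegral _ _ _).
under eq_Rintegral do rewrite mulrDl mul1r.
rewrite RintegralD//; last 2 first.
- exact: integrable_normal_pdf.
- have := integrable_cos_normal_pdf s_neq0 1 a; apply: eq_integrable => // x _ /=.
  by rewrite mul1r.
have -> : \int[lebesgue_measure]_x normal_pdf 0 s x = 1.
  by rewrite /Rintegral integral_normal_pdf.
rewrite addrAC subrr add0r; have := normal_pdf_char s_neq0 1 a.
by rewrite expr1n mulr1 => <-; apply: eq_Rintegral => x _; rewrite mul1r.
Qed.

End centered_normal_variable.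

(** * Scaled fields *)

Section linear_combination.
Context dT (T : measurableType dT) (R : realType).
Variable mu : {measure set T -> \bar R}.
Variables (I : Type) (t : I -> R) (k : I -> T -> R).
Hypothesis ik : forall i, mu.-integrable setT (EFin \o k i).

Let lincomb (r : seq I) : mu.-integrable setT (EFin \o (fun z => \sum_(i <- r) t i * k i z)) /\
  \int[mu]_z (\sum_(i <- r) t i * k i z) = \sum_(i <- r) t i * \int[mu]_z k i z.
Proof.
elim: r => [|i r [IH1 IH2]].
  split; first by rewrite (_ : _ \o _ = cst 0%E);
    [exact: integrable0|apply/funext => z; rewrite /= big_nil].
  by rewrite big_nil; under eq_Rintegral do rewrite big_nil; rewrite /Rintegral integral0.
have i1 : mu.-integrable setT (EFin \o (fun z => t i * k i z)) by exact: integrable_scale.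
split.
  have := integrableD measurableT i1 IH1; apply: eq_integrable => // z _ /=.
  by rewrite big_cons.
rewrite big_cons; under eq_Rintegral do rewrite big_cons.
by rewrite RintegralD// RintegralZl// IH2.
Qed.

Lemma integrable_lincomb (r : seq I) :
  mu.-integrable setT (EFin \o (fun z => \sum_(i <- r) t i * k i z)).
Proof. by have [] := lincomb r. Qed.

Lemma Rintegral_lincomb (r : seq I) :
  \int[mu]_z (\sum_(i <- r) t i * k i z) = \sum_(i <- r) t i * \int[mu]_z k i z.
Proof. by have [] := lincomb r. Qed.

End linear_combination.

Section quadratic_form.
Context dT (T : measurableType dT) (R : realType).
Variable mu : {measure set T -> \bar R}.
Variables (n : nat) (t : 'I_n -> R) (k : 'I_n -> T -> R).
Hypothesis ikk : forall i j, mu.-integrable setT (EFin \o (fun z => k i z * k j z)).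

(** Nested so that linearity can be applied twice, over [j] and then over [i]. *)
Let sqrE z : (\sum_i t i * k i z) ^+ 2 = \sum_i t i * (\sum_j t j * (k i z * k j z)).
Proof.
rewrite expr2 mulr_suml; apply: eq_bigr => i _.
rewrite -mulrA mulr_sumr; congr (_ * _); apply: eq_bigr => j _.
by rewrite mulrCA.
Qed.

Lemma integrable_lincomb_sqr :
  mu.-integrable setT (EFin \o (fun z => (\sum_i t i * k i z) ^+ 2)).
Proof.
have := integrable_lincomb t (fun i => integrable_lincomb t (ikk i) (index_enum 'I_n))
  (index_enum 'I_n).
by apply: eq_integrable => // z _ /=; rewrite sqrE.
Qed.

Lemma Rintegral_lincomb_sqr :
  \int[mu]_z (\sum_i t i * k i z) ^+ 2 =
  \sum_i t i * \sum_j t j * \int[mu]_z (k i z * k j z).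
Proof.
under eq_Rintegral do rewrite sqrE.
rewrite (Rintegral_lincomb t (fun i => integrable_lincomb t (ikk i) (index_enum 'I_n))).
by apply: eq_bigr => i _; rewrite Rintegral_lincomb.
Qed.

End quadratic_form.

Section scaled_measure.
Context dT (T : measurableType dT) (R : realType).
Variables (mu : {measure set T -> \bar R}) (c : {nonneg R}) (f : T -> R).
Hypothesis fi : mu.-integrable setT (EFin \o f).

Let mf : measurable_fun setT f.
Proof. exact/measurable_EFinP/(measurable_int _ fi). Qed.

Lemma integrable_mscale : (mscale c mu).-integrable setT (EFin \o f).
Proof.
apply/integrableP; split; first exact/measurable_EFinP.
rewrite ge0_integral_mscale//; last first.
  by apply/measurable_EFinP; exact: measurableT_comp.
have /integrableP[_ h] := fi; apply: lte_mul_pinfty => //.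
Qed.

Lemma Rintegral_mscale : \int[mscale c mu]_x f x = c%:num * \int[mu]_x f x.
Proof.
have fim : (\int[mu]_x (f x)%:E)%E \is a fin_num by exact: integrable_fin_num.
rewrite /Rintegral -[RHS]/(fine (c%:num)%:E * _) -fineM//; congr fine.
rewrite integralE [in RHS]integralE !ge0_integral_mscale//; last 2 first.
- exact/measurable_funeneg/measurable_EFinP.
- exact/measurable_funepos/measurable_EFinP.
have hp := integrable_pos_fin_num measurableT fi.
exact/esym/(muleBr (isT : c%:num%:E \is a fin_num) (fin_num_adde_defr _ hp)).
Qed.

End scaled_measure.

Section interlacement_limits.
Context (d : nat) (R : realType).
Local Notation V := 'rV[int]_d.+3.
Local Notation traj := (traj d.+3 R).
Local Notation traj_mod := (traj_mod d.+3 R).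
Variable P : V -> probability (walk_space d.+3) R.
Hypothesis hP : forall x, is_srw x (P x).
Variable Q : {fset V} -> {finite_measure set traj -> \bar R}.
Hypothesis hQ : forall K, is_QK P K (Q K).
Variable nu : {sigma_finite_measure set traj_mod -> \bar R}.
Hypothesis hnu : is_intensity Q nu.
Context dO (Omega : measurableType dO).
Variables (PP : probability Omega R) (omega : Omega -> nat -> traj_mod * R).
Hypothesis homega : is_interlacement PP nu omega.
Local Notation g := (green P).
Local Notation L := (occupation omega).
Local Notation N u := (level_measure omega u).
Local Notation G := (@real_local_time d R).

(** By Campbell's formula the integral of the extended local time against [N u w] is almost surely
    finite, so [fine] loses nothing, whether outside or inside the integral. *)
Lemma occupation_ae u x : 0 < u ->
  {ae PP, forall w, L x u w = \int[N u w]_z G x z /\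
    (N u w).-integrable setT (EFin \o G x)}.
Proof.
move=> u0; have prm := level_measure_prm homega u0.
have mmod := @measurable_mod_local_time d.+2 R x.
have mod0 := @mod_local_time_ge0 d.+2 R x.
have moo : (\int[level_intensity nu u0]_z mod_local_time x z < +oo)%E.
  rewrite ge0_integral_mscale//.
  by rewrite (integral_mod_local_time hP hQ hnu) mule1 ltry.
have iI : PP.-integrable setT (fun w => \int[N u w]_z mod_local_time x z)%E.
  have I0 w : (0 <= \int[N u w]_z mod_local_time x z)%E.
    by apply: integral_ge0 => z _; exact: mod0.
  apply/integrableP; split.
    by have [mN _ _] := prm; exact: measurable_fun_integral_kernel.
  under eq_integral do rewrite gee0_abs//.
  by rewrite (prm_mean prm).
have := integrable_ae measurableT iI; apply: filterS => w /(_ I) Ifin.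
have im : (N u w).-integrable setT (mod_local_time x).
  apply/integrableP; split => //.
  under eq_integral do rewrite gee0_abs//.
  by rewrite ltey_eq Ifin.
have E : (\int[N u w]_z mod_local_time x z = \int[N u w]_z (G x z)%:E)%E.
  apply: ge0_ae_eq_integral => //.
  - by apply/measurable_EFinP; exact: measurable_real_local_time.
  - by move=> z _; rewrite lee_fin real_local_time_ge0.
  - have := integrable_ae measurableT im; apply: filterS => z /(_ I) zf _.
    by rewrite fineK.
split; first by rewrite /occupation occupation_erealE E.
apply/integrableP; split; first by apply/measurable_EFinP; exact: measurable_real_local_time.
under eq_integral do rewrite /= ger0_norm ?real_local_time_ge0//.
by rewrite -E ltey_eq Ifin.
Qed.

Section scaled_field.
Variables (n : nat) (k : 'I_n -> traj_mod -> R).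
Hypothesis ik : forall i, nu.-integrable setT (EFin \o k i).
Hypothesis ikk : forall i j, nu.-integrable setT (EFin \o (fun z => k i z * k j z)).
Variables (s : R -> R) (X : R -> Omega -> 'I_n -> R).
Hypothesis mX : forall u, 0 < u -> forall i, measurable_fun setT (fun w => X u w i).
Hypothesis hX : forall u, 0 < u -> forall i,
  {ae PP, forall w, X u w i = s u * \int[N u w]_z k i z /\
    (N u w).-integrable setT (EFin \o k i)}.

(** Common to both limits: [k i] stands for a difference of local times or a single one, and [s u]
    for [1 / sqrt (2 u)] or [1 / u]. *)
Lemma scaled_field_char (t : 'I_n -> R) a u : 0 < u ->
  \int[PP]_w cos (\sum_i t i * X u w i + a) =
  expR (u * \int[nu]_z (cos (s u * \sum_i t i * k i z) - 1)) *
  cos (u * \int[nu]_z sin (s u * \sum_i t i * k i z) + a).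
Proof.
move=> u0; have prm := level_measure_prm homega u0.
pose h z := \sum_i t i * k i z.
have ih : nu.-integrable setT (EFin \o h) by exact: integrable_lincomb.
have ih2 : nu.-integrable setT (EFin \o (fun z => h z ^+ 2)).
  exact: integrable_lincomb_sqr.
pose c := NngNum (ltW u0).
have mh : measurable_fun setT h by have /integrableP[/measurable_EFinP] := ih.
have := prm_char_scale prm (integrable_mscale c ih) (s u) a.
rewrite !Rintegral_mscale; [|exact: integrable_sin|exact: integrable_cosB1] => <-.
congr fine; apply: ae_eq_integral => //.
- apply/measurable_EFinP/measurable_cos_comp; apply: measurable_funD => //.
  apply: measurable_sum => i; apply: measurable_funM => //; exact: mX.
- apply/measurable_EFinP/measurable_cos_comp; apply: measurable_funD => //.
  by apply: measurable_funM => //; exact: (measurable_prm_Rintegral prm).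
- have := ae_foralln_ord (hX u0); apply: filterS => w Hw _ /=.
  congr (cos (_ + _))%:E.
  rewrite [in RHS](Rintegral_lincomb t (fun i => proj2 (Hw i))) mulr_sumr.
  by apply: eq_bigr => i _; rewrite (proj1 (Hw i)) mulrCA.
Qed.

Lemma scaled_field_sqr u i : 0 < u ->
  (\int[PP]_w (X u w i ^+ 2)%:E <=
   (u * s u ^+ 2 * \int[nu]_z (k i z ^+ 2) +
    (`|u * s u * \int[nu]_z k i z| +
     u * s u ^+ 2 * \int[nu]_z (k i z ^+ 2) / 2) ^+ 2)%:E)%E.
Proof.
move=> u0; have prm := level_measure_prm homega u0.
pose c := NngNum (ltW u0); pose h z := s u * k i z.
have ik2 : nu.-integrable setT (EFin \o (fun z => k i z ^+ 2)).
  by have := ikk i i; apply: eq_integrable => // z _ /=; rewrite expr2.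
have ih : nu.-integrable setT (EFin \o h) by exact: integrable_scale.
have h2E : (fun z => h z ^+ 2) = (fun z => s u ^+ 2 * k i z ^+ 2).
  by apply/funext => z; rewrite exprMn.
have ih2 : nu.-integrable setT (EFin \o (fun z => h z ^+ 2)).
  by rewrite h2E; exact: integrable_scale.
have := prm_sqr_le prm (integrable_mscale c ih) (integrable_mscale c ih2).
rewrite !Rintegral_mscale// h2E !RintegralZl//= !mulrA; apply: le_trans.
rewrite le_eqVlt; apply/orP; left; apply/eqP; apply: ge0_ae_eq_integral => //.
- by apply/measurable_EFinP; apply: measurable_funX; exact: mX.
- apply/measurable_EFinP; apply: measurable_funX.
  by apply: (measurable_prm_Rintegral prm); have /integrableP[/measurable_EFinP] := ih.
- by move=> w _; rewrite lee_fin sqr_ge0.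
- by move=> w _; rewrite lee_fin sqr_ge0.
- have := hX u0 i; apply: filterS => w [-> ikw] _.
  by rewrite RintegralZl.
Qed.

(** For [s u = 1 / sqrt (2 u)] the integrals of the [k i] are zero; for [s u = 1 / u] one has
    [u * s u = 1]. *)
Hypothesis s_bound : forall u, 1 <= u -> u * s u ^+ 2 <= 1 /\
  forall i, `|u * s u * \int[nu]_z k i z| <= `|\int[nu]_z k i z|.

Lemma scaled_field_sqr_bound : exists2 C, 0 <= C & forall u, 1 <= u -> forall i,
  (\int[PP]_w (X u w i ^+ 2)%:E <= C%:E)%E.
Proof.
pose v i := \int[nu]_z (k i z ^+ 2).
have v0 i : 0 <= v i by apply: Rintegral_ge0 => z _; exact: sqr_ge0.
pose B i := v i + (`|\int[nu]_z k i z| + v i / 2) ^+ 2.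
have B0 i : 0 <= B i by rewrite addr_ge0 ?sqr_ge0.
exists (\sum_i B i); first exact: sumr_ge0.
move=> u u1 i; have u0 : 0 < u by exact: lt_le_trans u1.
have [b1 b2] := s_bound u1.
apply: (le_trans (scaled_field_sqr i u0)); rewrite lee_fin.
apply: (@le_trans _ _ (B i)); last by rewrite (bigD1 i)//= lerDl sumr_ge0.
have H : u * s u ^+ 2 * v i <= v i by rewrite ler_piMl.
have H0 : 0 <= u * s u ^+ 2 * v i by apply: mulr_ge0 => //; apply: mulr_ge0; [exact: ltW|exact: sqr_ge0].
rewrite lerD// ler_pXn2r ?nnegrE ?addr_ge0 ?divr_ge0//.
by rewrite lerD ?b2// ler_pM2r.
Qed.

End scaled_field.

End interlacement_limits.

(** * Limits of characteristic functions *)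

Section characteristic_limits.
Context dT (T : measurableType dT) (R : realType).
Variables (m : {measure set T -> \bar R}) (h : T -> R).
Hypothesis ih : m.-integrable setT (EFin \o h).
Hypothesis ih2 : m.-integrable setT (EFin \o (fun x => h x ^+ 2)).

Let cvg_char_seq (v s : nat -> R) (A B a : R) :
  v n * \int[m]_x (cos (s n * h x) - 1) @[n --> \oo] --> A ->
  v n * \int[m]_x sin (s n * h x) @[n --> \oo] --> B ->
  expR (v n * \int[m]_x (cos (s n * h x) - 1)) *
  cos (v n * \int[m]_x sin (s n * h x) + a) @[n --> \oo] --> expR A * cos (B + a).
Proof.
move=> hA hB; apply: cvgM.
  by apply: (cvg_comp _ _ hA); exact: continuous_expR.
have hB' : v n * \int[m]_x sin (s n * h x) + a @[n --> \oo] --> B + a.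
  by apply: cvgD => //; exact: cvg_cst.
by apply: (cvg_comp _ _ hB'); exact: continuous_cos.
Qed.

(** Here [u = 1 / (2 s ^ 2)]: the cosine integral is [- s ^ 2 / 2] times the second moment to
    leading order, and the sine integral is negligible against [s ^ 2] because [h] has mean zero. *)
Lemma cvg_char_sqrt (a : R) : \int[m]_x h x = 0 ->
  expR (u * \int[m]_x (cos ((Num.sqrt (2 * u))^-1 * h x) - 1)) *
  cos (u * \int[m]_x sin ((Num.sqrt (2 * u))^-1 * h x) + a) @[u --> +oo] -->
  expR (- (\int[m]_x (h x ^+ 2) / 4)) * cos a.
Proof.
(* Dominated convergence works along sequences, so the limit is tested on those tending to
   infinity. *)
move=> h0; apply/cvg_pinftyP => v voo.
pose s n := (Num.sqrt (2 * v n))^-1.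
have v_gt (e : R) : \forall n \near \oo, e < v n by move/cvgryPgt : voo; exact.
have s_neq0 : \forall n \near \oo, s n != 0.
  near=> n; rewrite invr_eq0 gt_eqF// sqrtr_gt0 mulr_gt0//.
  by near: n; exact: v_gt.
have vE : \forall n \near \oo, v n = (s n ^+ 2)^-1 / 2.
  near=> n; have vn : 0 < v n by near: n; exact: v_gt.
  by rewrite exprVn invrK sqr_sqrtr ?mulr_ge0 ?ltW// mulrAC divff ?mul1r.
have s0 : s n @[n --> \oo] --> (0 : R).
  apply/cvgrPdist_le => e e0; near=> n.
  have vn : (e ^+ 2)^-1 / 2 < v n by near: n; exact: v_gt.
  rewrite sub0r normrN ger0_norm ?invr_ge0// -[leRHS]invrK lef_pV2 ?posrE ?invr_gt0//.
    have -> : e^-1 = Num.sqrt (e^-1 ^+ 2) by rewrite sqrtr_sqr ger0_norm// invr_ge0 ltW.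
    rewrite ler_wsqrtr// exprVn.
    by rewrite mulrC -ler_pdivrMr// ltW.
  rewrite sqrtr_gt0 mulr_gt0// (lt_trans _ vn)// divr_gt0// invr_gt0 exprn_gt0//.
have := @cvg_char_seq v s (- (\int[m]_x (h x ^+ 2) / 4)) 0 a; rewrite add0r; apply.
- have H : (\int[m]_x (cos (s n * h x) - 1)) / s n ^+ 2 * 2^-1 @[n --> \oo] -->
      - (\int[m]_x (h x ^+ 2)) / 2 * 2^-1.
    by apply: cvgM; [exact: cvg_Rintegral_cosB1|exact: cvg_cst].
  rewrite (_ : - (_ / 4) = - (\int[m]_x (h x ^+ 2)) / 2 / 2); last by field.
  apply: cvg_trans H; apply: near_eq_cvg; near=> n => /=.
  have -> : v n = (s n ^+ 2)^-1 / 2 by near: n.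
  by rewrite -mulrA mulrC.
- have H : (\int[m]_x sin (s n * h x) - s n * \int[m]_x h x) / s n ^+ 2 * 2^-1 @[n --> \oo] --> (0 * 2^-1 : R).
    by apply: cvgM; [exact: cvg_Rintegral_sinB|exact: cvg_cst].
  rewrite -(mul0r (2^-1 : R)).
  apply: cvg_trans H; apply: near_eq_cvg; near=> n => /=.
  have -> : v n = (s n ^+ 2)^-1 / 2 by near: n.
  by rewrite h0 mulr0 subr0 -mulrA mulrC.
Unshelve. all: by end_near. Qed.

(** Here [u s = 1]: the cosine integral, of order [s ^ 2], vanishes even after multiplication by
    [u], while the sine integral is [s] times the mean up to a smaller term. *)
Lemma cvg_char_inv (a : R) :
  expR (u * \int[m]_x (cos (u^-1 * h x) - 1)) *
  cos (u * \int[m]_x sin (u^-1 * h x) + a) @[u --> +oo] -->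
  cos (\int[m]_x h x + a).
Proof.
apply/cvg_pinftyP => v voo.
pose s n := (v n)^-1.
have v_gt (e : R) : \forall n \near \oo, e < v n by move/cvgryPgt : voo; exact.
have s_neq0 : \forall n \near \oo, s n != 0.
  near=> n; rewrite invr_eq0 gt_eqF//.
  by near: n; exact: v_gt.
have vE : \forall n \near \oo, v n = s n * (s n ^+ 2)^-1.
  near=> n; have sn : s n != 0 by near: n.
  by rewrite expr2 invfM mulrA divff// mul1r invrK.
have s0 : s n @[n --> \oo] --> (0 : R).
  apply/cvgrPdist_le => e e0; near=> n.
  have vn : e^-1 < v n by near: n; exact: v_gt.
  have vn0 : 0 < v n by rewrite (lt_trans _ vn)// invr_gt0.
  rewrite sub0r normrN ger0_norm ?invr_ge0 ?(ltW vn0)// -[leRHS]invrK.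
  by rewrite lef_pV2 ?posrE ?invr_gt0// ltW.
have := @cvg_char_seq v s 0 (\int[m]_x h x) a; rewrite expR0 mul1r; apply.
- have H : s n * ((\int[m]_x (cos (s n * h x) - 1)) / s n ^+ 2) @[n --> \oo] -->
      0 * (- (\int[m]_x (h x ^+ 2)) / 2).
    by apply: cvgM; [exact: s0|exact: cvg_Rintegral_cosB1].
  rewrite mul0r in H.
  apply: cvg_trans H; apply: near_eq_cvg; near=> n => /=.
  have {1}-> : v n = s n * (s n ^+ 2)^-1 by near: n.
  by rewrite -mulrA (mulrC (s n ^+ 2)^-1).
- have H : s n * ((\int[m]_x sin (s n * h x) - s n * \int[m]_x h x) / s n ^+ 2) + \int[m]_x h x @[n --> \oo] --> 0 * 0 + \int[m]_x h x.
    apply: cvgD; last exact: cvg_cst.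
    by apply: cvgM; [exact: s0|exact: cvg_Rintegral_sinB].
  rewrite mul0r add0r in H.
  apply: cvg_trans H; apply: near_eq_cvg; near=> n => /=.
  have sn : s n != 0 by near: n.
  have {1}-> : v n = s n * (s n ^+ 2)^-1 by near: n.
  by rewrite /cst; field.
Unshelve. all: by end_near. Qed.

End characteristic_limits.

Section gaussian_field.
Context (R : realType) (I : Type) dO (Omega : measurableType dO).
Variables (PP : probability Omega R) (phi : I -> Omega -> R) (C : I -> I -> R).
Hypothesis hphi : centered_gaussian_field PP phi C.

Let mphi x : measurable_fun setT (phi x). Proof. by case: hphi. Qed.

Let cov x y : (\int[PP]_w (phi x w * phi y w)%:E = (C x y)%:E)%E.
Proof. by case: hphi => _ _ /(_ x y); rewrite unlock. Qed.

Lemma gaussian_field_sqr x : (\int[PP]_w (phi x w ^+ 2)%:E = (C x x)%:E)%E.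
Proof. by rewrite -cov; apply: eq_integral => w _; rewrite expr2. Qed.

Let isqr x : PP.-integrable setT (EFin \o (fun w => phi x w ^+ 2)).
Proof.
apply/integrableP; split; first by apply/measurable_EFinP; exact: measurable_funX.
under eq_integral do rewrite /= ger0_norm ?sqr_ge0//.
by rewrite gaussian_field_sqr ltry.
Qed.

Let imul x y : PP.-integrable setT (EFin \o (fun w => phi x w * phi y w)).
Proof.
apply: (le_integrable measurableT _ _ (integrableD measurableT (isqr x) (isqr y))).
  by apply/measurable_EFinP; exact: measurable_funM.
move=> w _ /=; rewrite lee_fin (ger0_norm (_ : 0 <= _ + _)) ?addr_ge0 ?sqr_ge0//.
rewrite normrM -(real_normK (num_real (phi x w))) -(real_normK (num_real (phi y w))).
by move: (`|phi x w|) (`|phi y w|) => b c; nra.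
Qed.

(** [centered_normal] does not specify the variance of the combination; it is read off the second
    moment, expanded by bilinearity into covariances. *)
Lemma gaussian_field_char n (x : 'I_n -> I) (t : 'I_n -> R) a :
  \int[PP]_w cos (\sum_i t i * phi (x i) w + a) =
  expR (- ((\sum_i t i * \sum_j t j * C (x i) (x j)) / 2)) * cos a.
Proof.
have [_ hn _] := hphi.
have mY : measurable_fun setT (fun w => \sum_(i < n) t i * phi (x i) w).
  by apply: measurable_sum => i; exact: measurable_funM.
have [v [Ev ->]] := centered_normal_char mY (hn n x t).
congr (expR (- (_ / 2)) * _).
have := Rintegral_lincomb_sqr t (fun i j => imul (x i) (x j)).
rewrite {1}/Rintegral Ev/= => ->.
apply: eq_bigr => i _; congr (_ * _); apply: eq_bigr => j _; congr (_ * _).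
by rewrite /Rintegral cov.
Qed.

Lemma gaussian_field_sqr_bound n (x : 'I_n -> I) : exists2 B, 0 <= B &
  forall i, (\int[PP]_w (phi (x i) w ^+ 2)%:E <= B%:E)%E.
Proof.
have C0 y : 0 <= C y y.
  by rewrite -lee_fin -gaussian_field_sqr integral_ge0// => w _; rewrite lee_fin sqr_ge0.
exists (\sum_i C (x i) (x i)); first exact: sumr_ge0.
move=> i; rewrite gaussian_field_sqr lee_fin (bigD1 i)//= lerDl; exact: sumr_ge0.
Qed.

End gaussian_field.

Theorem theorem5p1 (R : realType) (d : nat)
    (P : 'rV[int]_d.+3 -> probability (walk_space d.+3) R)
    (hP : forall x, is_srw x (P x))
    (Q : {fset 'rV[int]_d.+3} -> {finite_measure set (traj d.+3 R) -> \bar R})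
    (hQ : forall K, is_QK P K (Q K))
    (nu : {sigma_finite_measure set (traj_mod d.+3 R) -> \bar R})
    (hnu : is_intensity Q nu)
    (dO : measure_display) (Omega : measurableType dO)
    (PP : probability Omega R)
    (omega : Omega -> nat -> traj_mod d.+3 R * R)
    (homega : is_interlacement PP nu omega) :
  let L := occupation omega in
  let g := green P in
  (forall (dO' : measure_display) (Omega' : measurableType dO')
      (PP' : probability Omega' R) (phi : 'rV[int]_d.+3 -> Omega' -> R),
    centered_gaussian_field PP' phi
      (fun x x' => g (x' - x) + g 0 - g x - g x') ->
    field_cvg_dist PP (fun u x w => (L x u w - L 0 u w) / Num.sqrt (2 * u))
      PP' phi)
  /\ field_cvg_dist PP (fun u x w => L x u w / u)
       PP (fun _ _ => 1).
Proof.
move=> L g.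
have mL u x : 0 < u -> measurable_fun setT (L x u).
  by move=> u0; exact: (measurable_occupation homega u0).
have iG := integrable_real_local_time hP hQ hnu.
have iGG := integrable_real_local_time_mul hP hQ hnu.
have EG x : \int[nu]_z real_local_time x z = 1.
  by rewrite /Rintegral (integral_real_local_time hP hQ hnu).
have EGG x y : \int[nu]_z (real_local_time x z * real_local_time y z) = 2 * g (x - y).
  by rewrite /Rintegral (integral_real_local_time_mul hP hQ hnu).
have occ := occupation_ae hP hQ hnu homega.
have gN y : g (- y) = g y := green_opp hP y.
split.
- move=> dO' Omega' PP' phi hphi.
  have mX u : 0 < u -> forall x, measurable_fun setT
      (fun w => (L x u w - L 0 u w) / Num.sqrt (2 * u)).
    move=> u0 x; apply: measurable_funM => //.
    by apply: measurable_funB; exact: mL.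
  have mphi x : measurable_fun setT (phi x) by case: hphi.
  split=> // n x f cf fB.
  pose s (u : R) := (Num.sqrt (2 * u))^-1.
  pose k (i : 'I_n) (z : traj_mod d.+3 R) : R :=
    real_local_time (x i) z - real_local_time 0 z.
  have ik i : nu.-integrable setT (EFin \o k i) by exact: integrableB_EFin.
  have k0 i : \int[nu]_z k i z = 0.
    by rewrite RintegralB//; [rewrite !EG subrr|exact: iG|exact: iG].
  have kkE i j z : k i z * k j z =
      (real_local_time (x i) z * real_local_time (x j) z -
       real_local_time (x i) z * real_local_time 0 z) -
      (real_local_time 0 z * real_local_time (x j) z -
       real_local_time 0 z * real_local_time 0 z) by rewrite /k; ring.
  have iD y y' y'' : nu.-integrable setT (EFin \o (fun z =>
      real_local_time y z * real_local_time y' z - real_local_time y z * real_local_time y'' z)).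
    by apply: integrableB_EFin => //; exact: iGG.
  have ED y y' y'' : \int[nu]_z (real_local_time y z * real_local_time y' z -
      real_local_time y z * real_local_time y'' z) = 2 * g (y - y') - 2 * g (y - y'').
    by rewrite RintegralB//; [rewrite !EGG|exact: iGG|exact: iGG].
  have ikk i j : nu.-integrable setT (EFin \o (fun z => k i z * k j z)).
    have := integrableB_EFin measurableT (iD (x i) (x j) 0) (iD 0 (x j) 0).
    by apply: eq_integrable => // z _ /=; rewrite kkE.
  have Ekk i j : \int[nu]_z (k i z * k j z) =
      2 * (g (x j - x i) + g 0 - g (x i) - g (x j)).
    under eq_Rintegral do rewrite kkE.
    rewrite RintegralB// !ED.
    by rewrite !subr0 sub0r gN -[g (x i - x j)]gN opprB; ring.
  have hX u : 0 < u -> forall i, {ae PP, forall w,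
      (L (x i) u w - L 0 u w) / Num.sqrt (2 * u) =
        s u * \int[level_measure omega u w]_z k i z /\
      (level_measure omega u w).-integrable setT (EFin \o k i)}.
    move=> u0 i; have := occ u (x i) u0; have := occ u 0 u0.
    apply: filterS2 => w [E0 i0] [E1 i1]; split; last exact: integrableB_EFin.
    by rewrite RintegralB// [in LHS]/L E0 E1 mulrC.
  apply: (weak_cvg_of_char_cvg (X := fun u w i => (L (x i) u w - L 0 u w) / Num.sqrt (2 * u))
    (Z := fun w i => phi (x i) w)) => //.
  + by move=> u u0 i; exact: mX.
  + move=> t a.
    rewrite (gaussian_field_char hphi).
    have h0 : \int[nu]_z (\sum_i t i * k i z) = 0.
      by rewrite Rintegral_lincomb// big1// => i _; rewrite k0 mulr0.
    have := cvg_char_sqrt (a := a) (integrable_lincomb t ik (index_enum 'I_n))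
      (integrable_lincomb_sqr t ikk) h0.
    rewrite Rintegral_lincomb_sqr//.
    (* The factor [2] in [Ekk] turns the [/ 4] of [cvg_char_sqrt] into the [/ 2] of the Gaussian
       characteristic function. *)
    rewrite (_ : _ / 4 = (\sum_i t i * \sum_j t j *
        (g (x j - x i) + g 0 - g (x i) - g (x j))) / 2); last first.
      rewrite (_ : \sum_i _ = 2 * \sum_i t i * \sum_j t j *
        (g (x j - x i) + g 0 - g (x i) - g (x j))); first by field.
      rewrite mulr_sumr; apply: eq_bigr => i _; rewrite mulrCA; congr (_ * _).
      by rewrite mulr_sumr; apply: eq_bigr => j _; rewrite Ekk mulrCA.
    apply: cvg_trans; apply: near_eq_cvg; near=> u.
    by rewrite (scaled_field_char homega ik ikk (fun u u0 i => mX u u0 (x i)) hX).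
  + apply: (scaled_field_sqr_bound homega ik ikk (s := s)) => //.
    * by move=> u u0 i; exact: mX.
    * move=> u u1; split=> [|i]; last by rewrite k0 mulr0.
      have u0 : 0 < u by exact: lt_le_trans u1.
      rewrite exprVn sqr_sqrtr ?mulr_ge0 ?(ltW u0)// invfM mulrCA divff ?gt_eqF// mulr1.
      by rewrite invf_le1// ler1n.
  + exact: (gaussian_field_sqr_bound hphi).
- have mX u : 0 < u -> forall x, measurable_fun setT (fun w => L x u w / u).
    by move=> u0 x; apply: measurable_funM => //; exact: mL.
  split=> // n x f cf fB.
  pose s (u : R) := u^-1.
  pose k (i : 'I_n) := @real_local_time d R (x i).
  have ik i : nu.-integrable setT (EFin \o k i) by exact: iG.
  have ikk i j : nu.-integrable setT (EFin \o (fun z => k i z * k j z)) by exact: iGG.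
  have hX u : 0 < u -> forall i, {ae PP, forall w,
      L (x i) u w / u = s u * \int[level_measure omega u w]_z k i z /\
      (level_measure omega u w).-integrable setT (EFin \o k i)}.
    move=> u0 i; have := occ u (x i) u0.
    by apply: filterS => w [E1 i1]; split=> //; rewrite [in LHS]/L E1 mulrC.
  apply: (weak_cvg_of_char_cvg (X := fun u w i => L (x i) u w / u)
    (Z := fun w i => 1)) => //.
  + by move=> u u0 i; exact: mX.
  + move=> t a.
    (* For the constant field the expectation is the cosine of the sum of the [t i] plus [a]; that
       sum is the mean of the combination, each local time having mean one. *)
    rewrite [X in _ --> X](_ : _ = cos (\int[nu]_z (\sum_i t i * k i z) + a)); last first.
      rewrite Rintegral_lincomb// /Rintegral integral_cst//= probability_setT mule1/=.
      congr (cos (_ + _)); apply: eq_bigr => i _; congr (_ * _).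
      exact/esym/EG.
    have := @cvg_char_inv _ _ _ _ _ (integrable_lincomb t ik (index_enum 'I_n))
      (integrable_lincomb_sqr t ikk) a.
    apply: cvg_trans; apply: near_eq_cvg; near=> u.
    by rewrite (scaled_field_char homega ik ikk (fun u u0 i => mX u u0 (x i)) hX).
  + apply: (scaled_field_sqr_bound homega ik ikk (s := s)) => //.
    * by move=> u u0 i; exact: mX.
    * move=> u u1; have u0 : 0 < u by exact: lt_le_trans u1.
      split=> [|i]; last by rewrite /s divff ?mul1r// gt_eqF.
      by rewrite /s expr2 mulrA divff ?gt_eqF// mul1r invf_le1.
  + exists 1 => // i; rewrite expr1n integral_cst//= probability_setT mule1.
    exact: lexx.
Unshelve. all: by end_near. Qed.
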